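(* Let $S\subset\mathbf P^3$ be the quartic surface of the context. Then $S$ has exactly four rational double points (its singular points) $$P_1=(1,0,0,0),\quad P_2=(0,1,0,0),\quad P_3=(0,0,1,0),\quad P_4=(0,0,0,1),$$ each of type $D_4$, and $S$ contains the four tropes $$\overline\Theta_1:\ x=(a_1+a_2)\sqrt{d_3}\,zt+(a_1+a_3)\sqrt{d_2}\,yt+(a_2+a_3)\sqrt{d_1}\,yz=0,$$ $$\overline\Theta_2:\ y=(a_1+a_2)\sqrt{d_3}\,zt+(a_1+a_3)\sqrt{c_2}\,xz+(a_2+a_3)\sqrt{c_1}\,xt=0,$$ $$\overline\Theta_3:\ z=(a_1+a_2)\sqrt{c_3}\,xy+(a_1+a_3)\sqrt{d_2}\,yt+(a_2+a_3)\sqrt{c_1}\,xt=0,$$ $$\overline\Theta_4:\ t=(a_1+a_2)\sqrt{c_3}\,xy+(a_1+a_3)\sqrt{c_2}\,xz+(a_2+a_3)\sqrt{d_1}\,yz=0.$$ The trope $\overline\Theta_i$ passes through the three points $P_j$ $(j\neq i)$ among the four points.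
   Context: $k$ is an algebraically closed field of characteristic $2$; $(x,y,z,t)$ are homogeneous coordinates on $\mathbf P^3$. The constants $a_i,c_i,d_i\in k$ $(i=1,2,3)$ satisfy: $a_1,a_2,a_3$ are pairwise distinct and $\prod_ic_id_i\neq0$ (this is the condition that $\{\sum X_iY_i=0\}\cap\{\sum(a_iX_iY_i+c_iX_i^2+d_iY_i^2)=0\}\subset\mathbf P^5$ be non-singular). $S$ is the quartic surface (the set of foci of singular lines of that quadratic line complex) $$(a_1+a_2)^2(c_3x^2y^2+d_3z^2t^2)+(a_1+a_3)^2(c_2x^2z^2+d_2y^2t^2)+(a_2+a_3)^2(c_1x^2t^2+d_1y^2z^2)+(a_1+a_2)(a_2+a_3)(a_3+a_1)xyzt=0.$$ A trope of $S$ is a conic on $S$ such that some plane cuts $S$ along this conic with multiplicity two (a double conic). A rational double point of type $D_4$ is a surface singularity whose minimal resolution has exceptional divisor consisting of $(-2)$-curves with dual graph the Dynkin diagram $D_4$. *)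

(* Defs.v *)
(* Mathematical Components, with multinomials for the homogeneous forms. *)
From HB Require Import structures.
From mathcomp Require Import all_boot all_order all_algebra.
From mathcomp Require Export mpoly.

Set Implicit Arguments.
Unset Strict Implicit.
Unset Printing Implicit Defensive.

Import GRing.Theory.
Local Open Scope ring_scope.

(* Points of projective space: nonzero coordinate functions 'I_n -> k, compared
   up to a nonzero scalar. *)
Section ProjectivePoints.
Variables (k : fieldType) (n : nat).

Definition nonzero_vec (p : 'I_n -> k) : Prop := exists i, p i != 0.

Definition proj_eq (p q : 'I_n -> k) : Prop :=
  exists2 c : k, c != 0 & forall i, p i = c * q i.

(* Singular points of the hypersurface f = 0. *)
Definition singular_point (f : {mpoly k[n]}) (p : 'I_n -> k) : Prop :=
  [/\ nonzero_vec p, f.@[p] = 0 & forall i, (f^`M(i)).@[p] = 0].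

End ProjectivePoints.

(* Projective varieties over an algebraically closed field k are handled in the
   style of Weil and Zariski.  An integral closed subvariety X of projective
   space is given by a generic point g with homogeneous coordinates in its
   function field K; the homogeneous ideal of X consists of the forms F with
   F(g) = 0.  All local rings of X are subrings of K, and birational models of
   one field K are compared through them. *)
Section Models.
Variables (k K : fieldType) (iota : {rmorphism k -> K}).

Definition hvanish n (g : 'I_n -> K) (F : {mpoly k[n]}) : Prop :=
  mmap iota g F = 0.

(* g is the generic point of a projective variety whose function field is the
   whole of K. *)
Definition projective_model n (g : 'I_n -> K) : Prop :=
  nonzero_vec g /\
  forall a : K, exists d, exists F G : {mpoly k[n]},
    [/\ F \is d.-homog, G \is d.-homog, ~ hvanish g G
      & a = mmap iota g F / mmap iota g G].

(* The closed points of the variety. *)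
Definition on_model n (g : 'I_n -> K) (p : 'I_n -> k) : Prop :=
  nonzero_vec p /\
  forall d (F : {mpoly k[n]}), F \is d.-homog -> hvanish g F -> F.@[p] = 0.

(* The local ring at the closed point p, and its maximal ideal. *)
Definition local_ring n (g : 'I_n -> K) (p : 'I_n -> k) (a : K) : Prop :=
  exists d, exists F G : {mpoly k[n]},
    [/\ F \is d.-homog, G \is d.-homog, G.@[p] != 0
      & a = mmap iota g F / mmap iota g G].

Definition local_max n (g : 'I_n -> K) (p : 'I_n -> k) (a : K) : Prop :=
  exists d, exists F G : {mpoly k[n]},
    [/\ F \is d.-homog, G \is d.-homog, F.@[p] = 0, G.@[p] != 0
      & a = mmap iota g F / mmap iota g G].

(* Domination of local rings: the birational correspondence between the two
   models is regular at w and maps it to p. *)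
Definition lies_over n m (g : 'I_n -> K) (w : 'I_n -> k)
    (xi : 'I_m -> K) (p : 'I_m -> k) : Prop :=
  (forall a, local_ring xi p a -> local_ring g w a) /\
  (forall a, local_max xi p a -> local_max g w a).

Definition same_local_ring n m (g : 'I_n -> K) (w : 'I_n -> k)
    (xi : 'I_m -> K) (p : 'I_m -> k) : Prop :=
  forall a, local_ring g w a <-> local_ring xi p a.

(* Two models of K are isomorphic over K when they have the same local rings. *)
Definition isomorphic_models n m (g : 'I_n -> K) (xi : 'I_m -> K) : Prop :=
  (forall w, on_model g w -> exists2 p, on_model xi p & same_local_ring g w xi p)
  /\
  (forall p, on_model xi p -> exists2 w, on_model g w & same_local_ring g w xi p).

(* For a variety of dimension 2 every closed point has a local ring of Krull
   dimension 2, which is thus regular iff two elements generate its maximal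
   ideal. *)
Definition regular_surface_point n (g : 'I_n -> K) (w : 'I_n -> k) : Prop :=
  exists a b : K, [/\ local_max g w a, local_max g w b
    & forall c, local_max g w c -> exists u v : K,
        [/\ local_ring g w u, local_ring g w v & c = u * a + v * b]].

(* A projective birational morphism X -> S, X having generic point g and S
   having generic point xi, which is an isomorphism away from the point P and
   whose source is regular at all the points over P. *)
Definition resolution_at n m (g : 'I_n -> K) (xi : 'I_m -> K)
    (P : 'I_m -> k) : Prop :=
  [/\ projective_model g,
      forall w, on_model g w -> exists2 p, on_model xi p & lies_over g w xi p,
      forall w p, on_model g w -> on_model xi p -> lies_over g w xi p ->
        ~ proj_eq p P -> same_local_ring g w xi p
    & forall w, on_model g w -> lies_over g w xi P ->
        regular_surface_point g w].

(* r has order m at the point w of a variety of dimension 1 whose local ring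
   at w is a discrete valuation ring with uniformizer tau. *)
Definition order_at n (e : 'I_n -> K) (w : 'I_n -> k) (r : K) (m : int) : Prop :=
  exists tau v : K,
    [/\ forall a, local_max e w a <-> exists2 b, local_ring e w b & a = tau * b,
        v != 0, local_ring e w v, local_ring e w v^-1 & r = v * tau ^ m].

(* xi is the generic point of the hypersurface f = 0; in particular this
   hypersurface is integral. *)
Definition generic_point_of n (f : {mpoly k[n]}) (xi : 'I_n -> K) : Prop :=
  projective_model xi /\
  forall d (F : {mpoly k[n]}), F \is d.-homog ->
    (hvanish xi F <-> exists H, F = H * f).

End Models.

(* n is the degree of the cycle sum_w mu(w) w, where w runs through the points
   w satisfying C and mu is given as a relation. *)
Definition cycle_degree (k : fieldType) N (C : ('I_N -> k) -> Prop)
    (mu : ('I_N -> k) -> int -> Prop) (n : int) : Prop :=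
  exists r, exists p : 'I_r -> ('I_N -> k), exists m : 'I_r -> int,
    [/\ forall i, C (p i) /\ mu (p i) (m i),
        forall i j, proj_eq (p i) (p j) -> i = j,
        forall w, C w -> (exists i, proj_eq w (p i)) \/ mu w 0
      & n = \sum_(i < r) m i].

(* Smooth rational curves are parametrized: their function field is k(u). *)
Section RationalCurves.
Variable k : fieldType.

Definition ratfun := {fraction {poly k}}.

Definition ratfun_const : {rmorphism k -> ratfun} :=
  @FracField.tofrac {poly k} \o polyC.

Definition line_generic (i : 'I_2) : ratfun :=
  if i == ord0 then 1 else FracField.tofrac 'X.

Definition smooth_rational_curve N (e : 'I_N -> ratfun) : Prop :=
  projective_model ratfun_const e /\
  isomorphic_models ratfun_const e line_generic.

Definition on_curve N (e : 'I_N -> ratfun) : ('I_N -> k) -> Prop :=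
  on_model ratfun_const e.

Variables (K : fieldType) (iota : {rmorphism k -> K}).
Variables (N : nat) (g : 'I_N -> K).

(* The curve e lies on the variety g. *)
Definition curve_on (e : 'I_N -> ratfun) : Prop :=
  forall d (F : {mpoly k[N]}), F \is d.-homog ->
    hvanish iota g F -> hvanish ratfun_const e F.

(* The ideal of the curve e in the local ring of the variety g at w. *)
Definition curve_ideal (e : 'I_N -> ratfun) (w : 'I_N -> k) (a : K) : Prop :=
  exists d, exists F G : {mpoly k[N]},
    [/\ F \is d.-homog, G \is d.-homog, hvanish ratfun_const e F, G.@[w] != 0
      & a = mmap iota g F / mmap iota g G].

Definition local_equation (e : 'I_N -> ratfun) (w : 'I_N -> k) (eps : K) : Prop :=
  forall a, curve_ideal e w a <->
    exists2 b, local_ring iota g w b & a = eps * b.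

(* The rational function a of the variety g is defined at the generic point of
   the curve e, and restricts to the rational function r on this curve. *)
Definition restricts_to (e : 'I_N -> ratfun) (a : K) (r : ratfun) : Prop :=
  exists d, exists F G : {mpoly k[N]},
    [/\ F \is d.-homog, G \is d.-homog, ~ hvanish ratfun_const e G,
        a = mmap iota g F / mmap iota g G
      & r = mmap ratfun_const e F / mmap ratfun_const e G].

(* The intersection number (D . E), i.e. the degree on E of the line bundle
   O(D), for curves D and E in the regular locus of the surface g (D = E is
   allowed).  If eps is a local equation of D at w, then O(D) is generated at w
   by 1/eps; a rational function h with the same valuation along E as D yields
   the rational section 1/h of the restriction of O(D) to E, whose order at w
   is the order of the restriction of eps/h. *)
Definition intersection_number (D E : 'I_N -> ratfun) (n : int) : Prop :=
  exists2 h : K, h != 0 &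
    cycle_degree (on_curve E)
      (fun w m => exists eps : K, exists r : ratfun,
         [/\ local_equation D w eps, restricts_to E (eps / h) r
           & order_at ratfun_const E w r m]) n.

Definition smooth_rational_curve_of_square (e : 'I_N -> ratfun) (n : int) : Prop :=
  [/\ smooth_rational_curve e, curve_on e & intersection_number e e n].

(* A resolution is minimal when no exceptional curve is a (-1)-curve. *)
Definition minimal_resolution_at m (xi : 'I_m -> K) (P : 'I_m -> k) : Prop :=
  resolution_at iota g xi P /\
  forall e, smooth_rational_curve_of_square e (-1) ->
    ~ (forall w, on_curve e w -> lies_over iota g w xi P).

End RationalCurves.

(* Edges of the Dynkin diagram D_4, with central vertex 0. *)
Definition D4_edge (i j : 'I_4) : bool :=
  (i != j) && ((i == ord0) || (j == ord0)).

(* The surface f = 0 in P^3 has a rational double point of type D_4 at P. *)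
Definition rdp_D4 (k : closedFieldType) (f : {mpoly k[4]}) (P : 'I_4 -> k) : Prop :=
  exists (K : fieldType) (iota : {rmorphism k -> K}) (xi : 'I_4 -> K),
  exists (N : nat) (g : 'I_N -> K) (E : 'I_4 -> ('I_N -> ratfun k)),
    [/\ generic_point_of iota f xi /\ on_model iota xi P,
        minimal_resolution_at iota g xi P,
        forall w, on_model iota g w ->
          (lies_over iota g w xi P <-> exists i, on_curve (E i) w),
        forall i, smooth_rational_curve_of_square iota g (E i) (-2)
      & forall i j, i != j ->
          intersection_number iota g (E i) (E j) (D4_edge i j)%:Z].

(* A conic C in P^3 (an integral curve of degree 2 in a plane l = 0, cut out
   there by the quadric q = 0), such that the plane l = 0 cuts the surface
   f = 0 along 2 C. *)
Definition trope (k : closedFieldType) (f : {mpoly k[4]}) (C : ('I_4 -> k) -> Prop) : Prop :=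
  exists l q : {mpoly k[4]},
    [/\ l \is 1.-homog, l != 0, q \is 2.-homog
      & [/\ (forall l1 l2 H : {mpoly k[4]}, l1 \is 1.-homog -> l2 \is 1.-homog ->
               q <> l1 * l2 + l * H),
            forall p, nonzero_vec p -> (C p <-> l.@[p] = 0 /\ q.@[p] = 0)
          & exists (c : k) (H : {mpoly k[4]}), c != 0 /\ f = c *: q ^+ 2 + l * H]].

Section FocalSurface.
Variable k : closedFieldType.

Definition cx : {mpoly k[4]} := 'X_(@Ordinal 4 0 isT).
Definition cy : {mpoly k[4]} := 'X_(@Ordinal 4 1 isT).
Definition cz : {mpoly k[4]} := 'X_(@Ordinal 4 2 isT).
Definition ct : {mpoly k[4]} := 'X_(@Ordinal 4 3 isT).

Definition vertex (i : 'I_4) : 'I_4 -> k := fun j => (i == j)%:R.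

Definition focal_quartic (a1 a2 a3 c1 c2 c3 d1 d2 d3 : k) : {mpoly k[4]} :=
    (a1 + a2) ^+ 2 *: (c3 *: (cx ^+ 2 * cy ^+ 2) + d3 *: (cz ^+ 2 * ct ^+ 2))
  + (a1 + a3) ^+ 2 *: (c2 *: (cx ^+ 2 * cz ^+ 2) + d2 *: (cy ^+ 2 * ct ^+ 2))
  + (a2 + a3) ^+ 2 *: (c1 *: (cx ^+ 2 * ct ^+ 2) + d1 *: (cy ^+ 2 * cz ^+ 2))
  + ((a1 + a2) * (a2 + a3) * (a3 + a1)) *: (cx * cy * cz * ct).

(* The quadrics cutting out the four tropes; ri and si stand for the square
   roots of c_i and d_i. *)
Definition trope_quadric (a1 a2 a3 r1 r2 r3 s1 s2 s3 : k) (i : 'I_4) :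
    {mpoly k[4]} :=
  tnth [tuple
    ((a1 + a2) * s3) *: (cz * ct) + ((a1 + a3) * s2) *: (cy * ct)
      + ((a2 + a3) * s1) *: (cy * cz);
    ((a1 + a2) * s3) *: (cz * ct) + ((a1 + a3) * r2) *: (cx * cz)
      + ((a2 + a3) * r1) *: (cx * ct);
    ((a1 + a2) * r3) *: (cx * cy) + ((a1 + a3) * s2) *: (cy * ct)
      + ((a2 + a3) * r1) *: (cx * ct);
    ((a1 + a2) * r3) *: (cx * cy) + ((a1 + a3) * r2) *: (cx * cz)
      + ((a2 + a3) * s1) *: (cy * cz)] i.

Definition trope_curve (a1 a2 a3 r1 r2 r3 s1 s2 s3 : k) (i : 'I_4)
    (p : 'I_4 -> k) : Prop :=
  [/\ nonzero_vec p, p i = 0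
    & (trope_quadric a1 a2 a3 r1 r2 r3 s1 s2 s3 i).@[p] = 0].

End FocalSurface.

(* Main.v *)
(* In characteristic 2 the equation of S is the square of a quadric up to the
   term in xyzt.  Singling out any one of the four coordinates as x, with y_1,
   y_2, y_3 the others, it reads W^2 = e x y_1 y_2 y_3, where W = x L(y) + M(y),
   the linear form L and the quadric M = m_1 y_2 y_3 + m_2 y_1 y_3 + m_3 y_1 y_2
   having nonzero coefficients.  So the plane x = 0 cuts S along twice the conic
   M = 0.  Squares have zero derivatives, so that at a singular point all triple
   products of coordinates vanish, and so does W; this leaves the vertices.

   At the vertex y = 0 put x = 1 and rescale to L = Y_1 + Y_2 + Y_3.  The
   resolution is the closure of the image of S under
     (1 : Y_1 : Y_2 : Y_3) x (Y_1 : Y_2 : Y_3) x (W : Y_1^2 : Y_2^2 : Y_3^2).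
   Let v_i = Y_i / Y_j, v_l = Y_l / Y_j and h = Y_j^2 / W, with {i, j, l} =
   {1, 2, 3}.  Then
     Y_j = e h^2 v_i v_l   and   v_i + 1 + v_l = h e v_i v_l (1 - h mu)
   for a polynomial mu in v_i, v_l, so that, up to constants, v and h (or 1/h and Y_j)
   generate the maximal ideals over the vertex.  The fibre consists of the
   central line h = 0 and of the three lines v_i = 0, which meet it at distinct
   points.

   The resolution is minimal because up to units and squares the local equations
   of each exceptional curve come from one global rational function, which makes
   its self-intersection number even, hence different from -1. *)
Require Import Defs.
From mathcomp Require Import all_boot all_order all_algebra all_field.
From mathcomp Require Import mpoly ring zify.
From Stdlib Require Import Classical.
Set Implicit Arguments.
Unset Strict Implicit.
Unset Printing Implicit Defensive.
Import GRing.Theory.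
Local Open Scope ring_scope.

(** * Specialization of rational functions *)

(** The second factor of the map blows up the vertex. Then w = W / Y_j satisfies w^2 = e Y_j v_i
    v_l, and over the vertex lies the single line v_i + 1 + v_l = 0, with nodes of the surface at
    its three points where a coordinate vanishes. The third factor blows up the ideal (w, Y_j) of
    this line, which fails to be principal only at the nodes; this resolves all three of them
    together. Closed points and curves are treated alike, through the relation [gspec] between a
    function and its value at a point with coordinates in some field, k or k(u). The obstacle is
    that no equations of the image in projective space are at hand, so that a line cannot be shown
    to lie on it by substitution. Instead, a form that vanishes on the image is evaluated along arcs
    whose lifts tend to the generic point of the line. Exact arcs would require power series;
    polynomial arcs that satisfy the quartic to a high order suffice, because the form has a fixed
    degree. That the quartic is integral is not assumed either: its function field is built as a
    quadratic extension of k(Z, T). *)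

Section MmapTheory.
Variables (k A B : comNzRingType).
Variables (f : {rmorphism k -> A}) (g : {rmorphism k -> B}) (n : nat).

(** Polynomial evaluation respects every relation compatible with constants, sums and products. The
    relations used below are graphs of morphisms, membership in a subring, congruence modulo a
    polynomial, and specialization. *)
Lemma mmap_rel (T : A -> B -> Prop) (v : 'I_n -> A) (w : 'I_n -> B) F :
    (forall c, T (f c) (g c)) ->
    (forall a b a' b', T a b -> T a' b' -> T (a + a') (b + b')) ->
    (forall a b a' b', T a b -> T a' b' -> T (a * a') (b * b')) ->
  (forall i, T (v i) (w i)) -> T (mmap f v F) (mmap g w F).
Proof.
move=> Tc TD TM Tvw.
have T1 : T 1 1 by have := Tc 1; rewrite !rmorph1.
rewrite /mmap; apply: (big_rec2 T) => [|m a b _ Tab].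
  by have := Tc 0; rewrite !rmorph0.
apply: (TD) => //; apply: (TM) => //; rewrite /mmap1.
apply: (big_rec2 T) => // i x y _ Txy; apply: (TM) => //.
by elim: (m i) => // l IHl; rewrite !exprS; apply: (TM).
Qed.

Lemma mmap_homogZ c (v : 'I_n -> A) d F : F \is d.-homog ->
  mmap f (fun i => c * v i) F = c ^+ d * mmap f v F.
Proof.
move=> /dhomogP homF; rewrite /mmap mulr_sumr.
apply: eq_big_seq => m /homF /= <-; rewrite mulrCA; congr (_ * _).
rewrite /mmap1 mdegE -prodrXr -big_split /=.
by apply: eq_bigr => i _; rewrite exprMn.
Qed.

Lemma rmorph_mmap (h : {rmorphism A -> B}) (v : 'I_n -> A) (w : 'I_n -> B) F :
  (forall c, g c = h (f c)) -> (forall i, w i = h (v i)) ->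
  mmap g w F = h (mmap f v F).
Proof.
move=> gE wE; apply: (@mmap_rel (fun a b => b = h a)) => //.
  by move=> a _ a' _ -> ->; rewrite rmorphD.
by move=> a _ a' _ -> ->; rewrite rmorphM.
Qed.

Lemma mmapXU (v : 'I_n -> A) i : mmap f v 'X_i = v i.
Proof. by rewrite mmapX mmap1U. Qed.

End MmapTheory.

Lemma eq_mmap (k A : comNzRingType) (f : {rmorphism k -> A}) n
    (v w : 'I_n -> A) F : v =1 w -> mmap f v F = mmap f w F.
Proof. by move=> vw; apply: (@rmorph_mmap _ _ _ _ _ _ idfun) => // i; rewrite vw. Qed.

Lemma mmap_ind (k A : comNzRingType) (f : {rmorphism k -> A}) n
    (T : A -> Prop) (v : 'I_n -> A) F :
    (forall c, T (f c)) -> (forall a b, T a -> T b -> T (a + b)) ->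
    (forall a b, T a -> T b -> T (a * b)) ->
  (forall i, T (v i)) -> T (mmap f v F).
Proof.
move=> Tc TD TM Tv.
apply: (@mmap_rel _ _ _ f f n (fun a _ => T a) v v) => //.
- by move=> a _ a' _; apply: TD.
- by move=> a _ a' _; apply: TM.
Qed.

Lemma dhomogC n (k : nzRingType) (c : k) : c%:MP_[n] \is 0.-homog.
Proof. by rewrite -[c%:MP]mulr1 mul_mpolyC dhomogZ ?dhomog1. Qed.

Lemma dhomogXU n (k : nzRingType) (i : 'I_n) : ('X_i : {mpoly k[n]}) \is 1.-homog.
Proof. by rewrite dhomogX /= mdeg1. Qed.

Section Specialization.
Variables (k K L : fieldType) (f : {rmorphism k -> K}) (j : {rmorphism k -> L}).
Variables (n : nat) (g : 'I_n -> K) (h : 'I_n -> L).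

(** For [L = k] this is the incidence of a closed point with a variety ([on_model]), for
    [L = ratfun k] that of a curve ([curve_on]). *)
Definition specializes := forall d (F : {mpoly k[n]}),
  F \is d.-homog -> mmap f g F = 0 -> mmap j h F = 0.

(* The rational function a is defined at h and takes the value r there. *)
Definition gspec (a : K) (r : L) := exists d, exists F G : {mpoly k[n]},
  [/\ F \is d.-homog, G \is d.-homog, mmap j h G != 0,
      a = mmap f g F / mmap f g G & r = mmap j h F / mmap j h G].

Hypothesis gh : specializes.

Lemma specializes_neq0 d (F : {mpoly k[n]}) :
  F \is d.-homog -> mmap j h F != 0 -> mmap f g F != 0.
Proof. by move=> homF; apply: contra_neq; apply: gh homF. Qed.

Lemma gspecC c : gspec (f c) (j c).
Proof.
exists 0, c%:MP, 1; rewrite dhomogC dhomog1 !rmorph1 oner_neq0 !divr1 !mmapC.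
by split.
Qed.

Lemma gspecD a r a' r' : gspec a r -> gspec a' r' -> gspec (a + a') (r + r').
Proof.
move=> [d [F [G [hF hG nzG -> ->]]]] [d' [F' [G' [hF' hG' nzG' -> ->]]]].
exists (d + d')%N, (F * G' + F' * G), (G * G').
have gG := specializes_neq0 hG nzG; have gG' := specializes_neq0 hG' nzG'.
split; rewrite ?rmorphD ?rmorphM /= ?mulf_neq0 //.
- by apply: rpredD; [|rewrite addnC]; apply: dhomogM.
- exact: dhomogM.
- by rewrite addf_div.
- by rewrite addf_div.
Qed.

Lemma gspecM a r a' r' : gspec a r -> gspec a' r' -> gspec (a * a') (r * r').
Proof.
move=> [d [F [G [hF hG nzG -> ->]]]] [d' [F' [G' [hF' hG' nzG' -> ->]]]].
exists (d + d')%N, (F * F'), (G * G').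
by split; rewrite ?rmorphM /= ?mulf_neq0 ?dhomogM // mulf_div.
Qed.

Lemma gspecN a r : gspec a r -> gspec (- a) (- r).
Proof.
move=> ar; rewrite -mulN1r -(mulN1r r); apply: gspecM ar.
by have := gspecC (-1); rewrite !rmorphN !rmorph1.
Qed.

Lemma gspec1 : gspec 1 1.
Proof. by have := gspecC 1; rewrite !rmorph1. Qed.

Lemma gspec0 : gspec 0 0.
Proof. by have := gspecC 0; rewrite !rmorph0. Qed.

Lemma gspecB a r a' r' : gspec a r -> gspec a' r' -> gspec (a - a') (r - r').
Proof. by move=> ar ar'; apply: gspecD => //; apply: gspecN. Qed.

Lemma gspecX m a r : gspec a r -> gspec (a ^+ m) (r ^+ m).
Proof.
move=> ar; elim: m => [|m IHm]; first exact: gspec1.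
by rewrite !exprS; apply: gspecM.
Qed.

Lemma gspecV a r : r != 0 -> gspec a r -> gspec a^-1 r^-1.
Proof.
move=> nzr [d [F [G [hF hG nzG -> rE]]]].
exists d, G, F; rewrite rE !invf_div; split=> //.
by apply: contra_neq nzr; rewrite rE => ->; rewrite mul0r.
Qed.

Lemma gspec_neq0 a r : r != 0 -> gspec a r -> a != 0.
Proof.
move=> nzr [d [F [G [hF hG nzG -> rE]]]].
have nzF : mmap j h F != 0.
  by apply: contra_neq nzr; rewrite rE => ->; rewrite mul0r.
by rewrite mulf_neq0 ?invr_eq0 ?(specializes_neq0 hF) ?(specializes_neq0 hG).
Qed.

Lemma gspec_div a r a' r' : r' != 0 ->
  gspec a r -> gspec a' r' -> gspec (a / a') (r / r').
Proof. by move=> nz ar ar'; apply: gspecM => //; apply: gspecV. Qed.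

Lemma gspec_fun a r r' : gspec a r -> gspec a r' -> r = r'.
Proof.
move=> ar ar'; apply/eqP; rewrite -subr_eq0; apply/eqP.
have [d [F [G [hF hG nzG /esym/eqP + ->]]]] := gspecB ar ar'.
rewrite subrr mulf_eq0 invr_eq0 (negbTE (specializes_neq0 hG nzG)) orbF.
by move/eqP/(gh hF) => ->; rewrite mul0r.
Qed.

Lemma gspec_ratio m i : h m != 0 -> gspec (g i / g m) (h i / h m).
Proof.
move=> nzh; exists 1%N, 'X_i, 'X_m.
by split; rewrite ?dhomogXU ?mmapXU.
Qed.

Lemma specializes_coord m : h m != 0 -> g m != 0.
Proof.
move=> nz; have := @specializes_neq0 1 'X_m; rewrite !mmapXU; apply=> //.
exact: dhomogXU.
Qed.

Lemma mmap_ratio m d (F : {mpoly k[n]}) : g m != 0 -> F \is d.-homog ->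
  mmap f g F = g m ^+ d * mmap f (fun i => g i / g m) F.
Proof.
move=> nz hF; rewrite -mmap_homogZ //; apply: eq_mmap => i.
by rewrite mulrC divfK.
Qed.

End Specialization.

Section SpecializationMin.
Variables (k K L : fieldType) (f : {rmorphism k -> K}) (j : {rmorphism k -> L}).
Variables (n : nat) (g : 'I_n -> K) (h : 'I_n -> L) (m : 'I_n).
Hypothesis gh : specializes f j g h.
Hypothesis hm : h m != 0.

(** The functions defined at h arise from the ratios of coordinates by ring operations and by
    inversion of elements with nonzero value, so a relation need only be checked on these. *)
Lemma gspec_min (T : K -> L -> Prop) :
    (forall c, T (f c) (j c)) ->
    (forall a b a' b', T a b -> T a' b' -> T (a + a') (b + b')) ->
    (forall a b a' b', T a b -> T a' b' -> T (a * a') (b * b')) ->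
    (forall a b, b != 0 -> T a b -> T a^-1 b^-1) ->
    (forall i, T (g i / g m) (h i / h m)) ->
  forall a r, gspec f j g h a r -> T a r.
Proof.
move=> Tc TD TM TV Tgh a r [d [F [G [hF hG nzG -> ->]]]].
have gm := specializes_coord gh hm.
have TF P : T (mmap f (fun i => g i / g m) P) (mmap j (fun i => h i / h m) P).
  exact: mmap_rel.
rewrite (mmap_ratio f gm hF) (mmap_ratio f gm hG).
rewrite (mmap_ratio j hm hF) (mmap_ratio j hm hG).
rewrite -!mulf_div !divff ?expf_neq0 // !mul1r; apply: TM => //; apply: TV => //.
by move: nzG; rewrite (mmap_ratio j hm hG) mulf_eq0 negb_or => /andP[].
Qed.

End SpecializationMin.

Lemma specializes_trans (k K L M : fieldType) (f : {rmorphism k -> K})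
    (j : {rmorphism k -> L}) (l : {rmorphism k -> M}) n g h p :
  @specializes k K L f j n g h -> specializes j l h p -> specializes f l g p.
Proof. by move=> gh hp d F hF /(gh _ _ hF)/(hp _ _ hF). Qed.

(** For a curve h through a point p: a function defined at p restricts to the curve, and its value
    at p is that of the restriction. *)
Lemma gspec_mid (k K L M : fieldType) (f : {rmorphism k -> K})
    (j : {rmorphism k -> L}) (l : {rmorphism k -> M}) n (g : 'I_n -> K) h p a c :
    specializes j l h p -> gspec f l g p a c ->
  exists2 r, gspec f j g h a r & gspec j l h p r c.
Proof.
move=> hp [d [F [G [hF hG nzG -> ->]]]].
exists (mmap j h F / mmap j h G); exists d, F, G; split=> //.
exact: (specializes_neq0 hp hG nzG).
Qed.

Section ClosedPoints.
Variables (k K : fieldType) (f : {rmorphism k -> K}) (n : nat).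
Implicit Types (g : 'I_n -> K) (p : 'I_n -> k).

Definition cspec g p := gspec f idfun g p.

Lemma local_ringP g p a : local_ring f g p a <-> exists c, cspec g p a c.
Proof.
split=> [[d [F [G [hF hG nzG ->]]]]|[c [d [F [G [hF hG nzG -> _]]]]]].
  by exists (F.@[p] / G.@[p]), d, F, G.
by exists d, F, G.
Qed.

Lemma local_maxP g p a : local_max f g p a <-> cspec g p a 0.
Proof.
split=> [[d [F [G [hF hG F0 nzG ->]]]]|[d [F [G [hF hG nzG -> /esym/eqP]]]]].
  by exists d, F, G; split=> //; rewrite -/(meval p F) F0 mul0r.
rewrite mulf_eq0 invr_eq0 (negbTE nzG) orbF => /eqP F0.
by exists d, F, G.
Qed.

End ClosedPoints.

Section LiesOver.
Variables (k K : fieldType) (f : {rmorphism k -> K}) (n n' : nat).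
Variables (g : 'I_n -> K) (w : 'I_n -> k) (xi : 'I_n' -> K) (p : 'I_n' -> k).
Hypotheses (gw : specializes f idfun g w) (xp : specializes f idfun xi p).

(** The residue fields are k, so domination preserves values: subtracting the value lands in the
    maximal ideal. *)
Lemma lies_overP : lies_over f g w xi p <->
  (forall a c, cspec f xi p a c -> cspec f g w a c).
Proof.
split=> [[_ dom] a c ac|dom].
  have /local_maxP/dom/local_maxP : cspec f xi p (a - f c) 0.
    by rewrite -(subrr c); apply: gspecB => //; apply: gspecC.
  move=> /(gspecD gw)/(_ (gspecC f idfun g w c)).
  by rewrite subrK add0r.
split=> a; first by move=> /local_ringP[c /dom ac]; apply/local_ringP; exists c.
by move=> /local_maxP/dom ac; apply/local_maxP.
Qed.

Lemma cspec_lies_over m : p m != 0 ->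
    (forall i, cspec f g w (xi i / xi m) (p i / p m)) ->
  forall a c, cspec f xi p a c -> cspec f g w a c.
Proof.
move=> pm xgw; apply: (gspec_min xp pm) => // *.
- exact: gspecC.
- exact: gspecD.
- exact: gspecM.
- exact: gspecV.
Qed.

End LiesOver.

Lemma same_local_ringP (k K : fieldType) (f : {rmorphism k -> K}) n n'
    (g : 'I_n -> K) (w : 'I_n -> k) (xi : 'I_n' -> K) (p : 'I_n' -> k) :
    (forall a c, cspec f xi p a c <-> cspec f g w a c) ->
  same_local_ring f g w xi p.
Proof.
by move=> eqs a; rewrite !local_ringP; split=> -[c /eqs ac]; exists c.
Qed.

Lemma cspec_projZ (k K : fieldType) (f : {rmorphism k -> K}) n
    (g : 'I_n -> K) (p q : 'I_n -> k) a c : proj_eq p q ->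
  cspec f g q a c -> cspec f g p a c.
Proof.
move=> [b nzb pq] [d [F [G [hF hG nzG -> ->]]]].
have pE P : P \is d.-homog -> mmap idfun p P = b ^+ d * mmap idfun q P.
  by move=> hP; rewrite (eq_mmap _ _ pq) (mmap_homogZ _ _ _ hP).
exists d, F, G; split=> //; rewrite !pE // ?mulf_neq0 ?expf_neq0 //.
by rewrite -mulf_div divff ?expf_neq0 // mul1r.
Qed.

Lemma proj_eq_sym (k : fieldType) n (p q : 'I_n -> k) : proj_eq p q -> proj_eq q p.
Proof.
by move=> [c nzc pq]; exists c^-1; rewrite ?invr_eq0 // => i; rewrite pq mulKf.
Qed.

Lemma gspec_poly (k K L : fieldType) (f : {rmorphism k -> K})
    (j : {rmorphism k -> L}) n (g : 'I_n -> K) (h : 'I_n -> L) :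
    specializes f j g h -> forall (p : {poly k}) a r, gspec f j g h a r ->
  gspec f j g h (map_poly f p).[a] (map_poly j p).[r].
Proof.
move=> gh p a r ar; elim/poly_ind: p => [|p c IHp].
  by rewrite !rmorph0 !horner0; apply: gspec0.
rewrite !rmorphD !rmorphM /= !map_polyX !map_polyC /= !hornerE.
by apply: gspecD => //; [apply: gspecM | apply: gspecC].
Qed.

Lemma cspec_poly (k K : fieldType) (f : {rmorphism k -> K}) n (g : 'I_n -> K) w :
    specializes f idfun g w -> forall (p : {poly k}) a c, cspec f g w a c ->
  cspec f g w (map_poly f p).[a] p.[c].
Proof.
move=> gw p a c ac; have := gspec_poly gw p ac.
by rewrite (@map_poly_id _ idfun p).
Qed.

Section Chart.
Variables (k K : fieldType) (f : {rmorphism k -> K}) (n : nat).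
Variables (g : 'I_n -> K) (w : 'I_n -> k) (m : 'I_n).
Hypotheses (gw : specializes f idfun g w) (wm : w m != 0).
Variables (xi eta : K) (xi0 : k).
Hypotheses (xi_spec : cspec f g w xi xi0) (eta_spec : cspec f g w eta 0).

(** These elements form a subring of the local ring at w. Once it contains the ratios of the
    coordinates, xi - xi0 and eta generate the maximal ideal. *)
Definition polynomial_mod (a : K) := exists p b c,
  cspec f g w b c /\ a = (map_poly f p).[xi] + eta * b.

Lemma polynomial_modC c : polynomial_mod (f c).
Proof.
exists c%:P, 0, 0; split; first exact: gspec0.
by rewrite mulr0 addr0 map_polyC hornerC.
Qed.

Lemma polynomial_mod_xi : polynomial_mod xi.
Proof.
exists 'X, 0, 0; split; first exact: gspec0.
by rewrite mulr0 addr0 map_polyX hornerX.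
Qed.

Lemma polynomial_mod_eta b c : cspec f g w b c -> polynomial_mod (eta * b).
Proof. by move=> bc; exists 0, b, c; rewrite rmorph0 horner0 add0r. Qed.

Lemma polynomial_modD a b :
  polynomial_mod a -> polynomial_mod b -> polynomial_mod (a + b).
Proof.
move=> [p [x [c [xc ->]]]] [q [y [d [yd ->]]]].
exists (p + q), (x + y), (c + d); split; first exact: gspecD.
by rewrite rmorphD hornerD; ring.
Qed.

Lemma polynomial_modM a b :
  polynomial_mod a -> polynomial_mod b -> polynomial_mod (a * b).
Proof.
move=> [p [x [c [xc ->]]]] [q [y [d [yd ->]]]].
exists (p * q), ((map_poly f p).[xi] * y + (map_poly f q).[xi] * x + eta * x * y).
exists (p.[xi0] * d + q.[xi0] * c + 0 * c * d); split.
  have px := cspec_poly gw p xi_spec; have qx := cspec_poly gw q xi_spec.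
  apply: gspecD => //; last by apply: gspecM => //; apply: gspecM.
  by apply: gspecD => //; apply: gspecM.
by rewrite rmorphM hornerM; ring.
Qed.

Hypothesis coords : forall i, polynomial_mod (g i / g m).

Lemma cspec_chart a c : cspec f g w a c -> exists p b u c' c'',
  [/\ cspec f g w b c', cspec f g w u c'', c'' != 0
    & a = u * ((map_poly f p).[xi] + eta * b)].
Proof.
move=> [d [F [G [hF hG nzG -> _]]]].
have gm := specializes_coord gw wm.
have [] : polynomial_mod (mmap f (fun i => g i / g m) F).
  by apply: mmap_ind coords; [apply: polynomial_modC | apply: polynomial_modD
    | apply: polynomial_modM].
move=> p [b [c' [bc' FE]]].
exists p, b, (g m ^+ d / mmap f g G), c', (w m ^+ d / mmap idfun w G).
split=> //.
- exists d, ('X_m ^+ d), G; split=> //; rewrite ?rmorphXn /= ?mmapXU //.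
  by have := dhomogMn d (dhomogXU k m); rewrite mul1n.
- by rewrite mulf_neq0 ?expf_neq0 ?invr_eq0.
- by rewrite -FE (mmap_ratio f gm hF) mulrAC.
Qed.

(** Taking values at w gives p(xi0) = 0, so that X - xi0 divides p. *)
Lemma chart_max a : cspec f g w a 0 -> exists u v,
  [/\ local_ring f g w u, local_ring f g w v & a = u * (xi - f xi0) + v * eta].
Proof.
move=> a0; have [p [b [u [c' [c'' [bc' uc'' nzc'' aE]]]]]] := cspec_chart a0.
have px := cspec_poly gw p xi_spec.
have : cspec f g w a (c'' * (p.[xi0] + 0 * c')).
  by rewrite aE; apply: gspecM => //; apply: gspecD => //; apply: gspecM.
move=> /(gspec_fun gw a0)/esym/eqP; rewrite mul0r addr0 mulf_eq0 (negbTE nzc'').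
move=> /factor_theorem[q qE]; exists (u * (map_poly f q).[xi]), (u * b); split.
- apply/local_ringP; exists (c'' * q.[xi0]); apply: gspecM => //.
  exact: cspec_poly.
- by apply/local_ringP; exists (c'' * c'); apply: gspecM.
- by rewrite aE qE rmorphM rmorphB /= map_polyX map_polyC /= !hornerE; ring.
Qed.

Lemma chart_regular : regular_surface_point f g w.
Proof.
exists (xi - f xi0), eta; split; last by move=> a /local_maxP/chart_max.
  by apply/local_maxP; rewrite -(subrr xi0); apply: gspecB => //; apply: gspecC.
exact/local_maxP.
Qed.

End Chart.

Section Order.
Variables (k K : fieldType) (f : {rmorphism k -> K}) (n : nat).
Variables (g : 'I_n -> K) (w : 'I_n -> k) (m : 'I_n) (xi : K) (xi0 : k).
Hypotheses (gw : specializes f idfun g w) (wm : w m != 0).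
Hypothesis xi_spec : cspec f g w xi xi0.
Hypothesis coords : forall i, exists p : {poly k}, g i / g m = (map_poly f p).[xi].

(** The previous chart with eta = 0, as on a curve. *)
Lemma uniformizer a :
  local_max f g w a <-> exists2 b, local_ring f g w b & a = (xi - f xi0) * b.
Proof.
have spec0 := gspec0 f idfun g w.
have coords0 i : polynomial_mod f g w xi 0 (g i / g m).
  by have [p pE] := coords i; exists p, 0, 0; rewrite mulr0 addr0.
rewrite local_maxP; split=> [a0|[b /local_ringP[d bd] ->]].
  have [x [y [xP _]]] := chart_max gw wm xi_spec spec0 coords0 a0.
  by rewrite mulr0 addr0 mulrC => ->; exists x.
rewrite -(mul0r d); apply: gspecM bd; rewrite -(subrr xi0).
by apply: gspecB => //; apply: gspecC.
Qed.

Lemma order_atI (v : K) c (l : int) : cspec f g w v c -> c != 0 ->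
  order_at f g w (v * (xi - f xi0) ^ l) l.
Proof.
move=> vc nzc; exists (xi - f xi0), v; split; last by [].
- exact: uniformizer.
- exact: (gspec_neq0 gw nzc vc).
- by apply/local_ringP; exists c.
- by apply/local_ringP; exists c^-1; apply: gspecV.
Qed.

End Order.

Lemma fractionP (R : idomainType) (r : {fraction R}) : exists p q : R,
  q != 0 /\ r = FracField.tofrac p / FracField.tofrac q.
Proof.
elim/quotW: r => r; exists \n_r, \d_r; split; first exact: denom_ratioP.
have nzd : FracField.tofrac \d_r != 0 by rewrite tofrac_eq0 denom_ratioP.
apply: (mulIf nzd); rewrite divfK //; unlock FracField.tofrac.
rewrite -[LHS]FracField.pi_mul; apply/eqmodP.
rewrite /= FracField.equivfE /FracField.mulf.
by rewrite !numden_Ratio ?mulr1 ?mul1r ?denom_ratioP ?oner_eq0 // mulrC.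
Qed.

Section RatFun.
Variable k : closedFieldType.
Local Notation rc := (ratfun_const k).
Local Notation u := (FracField.tofrac ('X : {poly k}) : ratfun k).

Lemma ratfun_polyE (p : {poly k}) : FracField.tofrac p = (map_poly rc p).[u].
Proof.
elim/poly_ind: p => [|p c IHp]; first by rewrite !rmorph0 horner0.
rewrite !rmorphD !rmorphM /= IHp map_polyX map_polyC /= !hornerE.
by [].
Qed.

(** p splits over k, so all its roots in k(u) are among its roots in k. *)
Lemma ratfun_algebraic (p : {poly k}) (r : ratfun k) :
  p != 0 -> (map_poly rc p).[r] = 0 -> exists c, r = rc c.
Proof.
move=> nzp; have [s ->] := closed_field_poly_normal p.
rewrite map_polyZ hornerZ => /eqP; rewrite mulf_eq0 fmorph_eq0 lead_coef_eq0.
rewrite (negbTE nzp) /= rmorph_prod horner_prod prodf_seq_eq0 => /hasP[c _ /=].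
rewrite rmorphB /= map_polyX map_polyC hornerXsubC subr_eq0 => /eqP ->.
by exists c.
Qed.

Lemma eq_poly_fun (p q : {poly k}) : (forall x, x != 0 -> p.[x] = q.[x]) -> p = q.
Proof.
move=> pq; apply/eqP; rewrite -subr_eq0.
apply: contraT => nz; have : (p - q) * 'X != 0 by rewrite mulf_neq0 ?polyX_eq0.
move=> /closed_nonrootP[x]; rewrite /root !hornerE mulf_eq0 negb_or subr_eq0.
by move=> /andP[pqx /pq]; move/eqP: pqx.
Qed.

End RatFun.

(** * Lines *)

Section LinearCurves.
Variable k : closedFieldType.
Local Notation rc := (ratfun_const k).
Local Notation u := (FracField.tofrac ('X : {poly k}) : ratfun k).

Section OneCurve.
Variables (n : nat) (la mu : 'I_n -> k).

(** Generic point of the line joining the points [la] and [mu]. *)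
Definition lin : 'I_n -> ratfun k := fun i => rc (la i) + rc (mu i) * u.

Lemma lin_specializes (w : 'I_n -> k) a b :
  (forall i, w i = a * la i + b * mu i) -> specializes rc idfun lin w.
Proof.
move=> wE d F hF F0.
pose P := mmap polyC (fun i => (la i)%:P + (mu i)%:P * 'X) F.
have P0 : P = 0.
  apply/eqP; rewrite -tofrac_eq0 -F0; apply/eqP.
  rewrite [RHS](rmorph_mmap (f := polyC) (h := @FracField.tofrac {poly k})
    (v := fun i => (la i)%:P + (mu i)%:P * 'X)) //.
  by move=> i; rewrite rmorphD rmorphM.
pose Q := mmap polyC (fun i => (a *: 'X) * (la i)%:P + (b * mu i)%:P) F.
have evalQ s : Q.[s] = mmap idfun (fun i => a * s * la i + b * mu i) F.
  rewrite (rmorph_mmap (g := idfun) (f := polyC) (h := horner_eval s)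
    (v := fun i => (a *: 'X) * (la i)%:P + (b * mu i)%:P)) //.
    by move=> c; rewrite /= ?horner_evalE hornerC.
  by move=> i; rewrite /= ?horner_evalE !hornerE.
have evalP s : mmap idfun (fun i => la i + mu i * s) F = 0.
  rewrite (rmorph_mmap (f := polyC) (h := horner_eval s)
    (v := fun i => (la i)%:P + (mu i)%:P * 'X)).
  - by rewrite -/P P0 rmorph0.
  - by move=> c; rewrite /= ?horner_evalE hornerC.
  - by move=> i; rewrite /= ?horner_evalE !hornerE.
have [a0|nza] := eqVneq a 0; last first.
  rewrite (eq_mmap _ (w := fun i => a * (la i + mu i * (b / a)))).
    by rewrite (mmap_homogZ _ _ _ hF) evalP mulr0.
  by move=> i; rewrite wE; field.
(* The point [mu] itself is not of the form la + s mu. It is reached as a limit: R vanishes at every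
   nonzero s, hence also at 0. *)
pose R := mmap polyC (fun i => 'X * (la i)%:P + (b * mu i)%:P) F.
have evalR s : R.[s] = mmap idfun (fun i => s * la i + b * mu i) F.
  rewrite (rmorph_mmap (g := idfun) (f := polyC) (h := horner_eval s)
    (v := fun i => 'X * (la i)%:P + (b * mu i)%:P)) //.
    by move=> c; rewrite /= ?horner_evalE hornerC.
  by move=> i; rewrite /= ?horner_evalE !hornerE.
have R0 : R = 0.
  apply: eq_poly_fun => s nzs; rewrite horner0 evalR.
  rewrite (eq_mmap _ (w := fun i => s * (la i + mu i * (b / s)))).
    by rewrite (mmap_homogZ _ _ _ hF) evalP mulr0.
  by move=> i; field.
by rewrite (eq_mmap _ (w := fun i => 0 * la i + b * mu i)) -?evalR ?R0 ?horner0 // => i; rewrite wE a0.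
Qed.

Variables (na nb : 'I_n).
Hypotheses (la_na : la na = 1) (mu_na : mu na = 0).
Hypotheses (la_nb : la nb = 0) (mu_nb : mu nb = 1).

Lemma lin_na : lin na = 1.
Proof. by rewrite /lin la_na mu_na rmorph1 rmorph0 mul0r addr0. Qed.

Lemma lin_nb : lin nb = u.
Proof. by rewrite /lin la_nb mu_nb rmorph1 rmorph0 mul1r add0r. Qed.

Lemma lin_on_curveP w : on_curve lin w <->
  nonzero_vec w /\ forall i, w i = w na * la i + w nb * mu i.
Proof.
split=> [[nzw ow]|[nzw wE]]; split=> //; last exact: lin_specializes wE.
(* These linear forms cut out the line. *)
move=> i; pose F : {mpoly k[n]} := 'X_i - la i *: 'X_na - mu i *: 'X_nb.
have hF : F \is 1.-homog by rewrite !rpredB ?rpredZ ?dhomogXU.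
have FE (A : comNzRingType) (j : {rmorphism k -> A}) h :
    mmap j h F = h i - j (la i) * h na - j (mu i) * h nb.
  by rewrite !rmorphB /= !mmapZ !mmapXU.
have := ow _ F hF; rewrite /hvanish /meval !FE.
rewrite lin_na lin_nb {1}/lin => wE0.
have /wE0/eqP : rc (la i) + rc (mu i) * u - rc (la i) * 1 - rc (mu i) * u = 0.
  by ring.
by rewrite -addrA -opprD subr_eq0 => /eqP ->; rewrite /=; ring.
Qed.

Lemma lin_coord_neq0 w : on_curve lin w -> w na = 0 -> w nb != 0.
Proof.
move=> /lin_on_curveP[[i nzwi] wE] wa0.
by apply: contra_neq nzwi => wb0; rewrite wE wa0 wb0 !mul0r addr0.
Qed.

Lemma lin_projective_model : projective_model rc lin.
Proof.
split; first by exists na; rewrite lin_na oner_neq0.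
have sp : specializes rc rc lin lin by [].
have na0 : lin na != 0 by rewrite lin_na oner_neq0.
have uP : gspec rc rc lin lin u u.
  by have := gspec_ratio rc rc lin nb na0; rewrite lin_na lin_nb divr1; apply.
have polyP p : gspec rc rc lin lin (FracField.tofrac p) (FracField.tofrac p).
  by rewrite (@ratfun_polyE k); apply: gspec_poly.
move=> a; have [p [q [nzq ->]]] := fractionP a.
have [|d [F [G [hF hG nzG -> _]]]] := gspec_div _ (polyP p) (polyP q).
  by rewrite tofrac_eq0.
by exists d, F, G; split=> //; apply/eqP.
Qed.

Lemma lin_order_fin w v c (l : int) : on_curve lin w -> w na != 0 ->
    cspec rc lin w v c -> c != 0 ->
  order_at rc lin w (v * (u - rc (w nb / w na)) ^ l) l.
Proof.
move=> ow nza; case: (ow) => _ sp.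
apply: (@order_atI _ _ _ _ _ _ na) => //.
  by have := gspec_ratio rc idfun lin nb nza; rewrite lin_na lin_nb divr1; apply.
move=> i; exists ((la i)%:P + mu i *: 'X).
rewrite lin_na divr1 rmorphD /= map_polyC map_polyZ map_polyX !hornerE.
by [].
Qed.

(** At the point where u is infinite u^-1 is a uniformizer, hence the opposite exponent. *)
Lemma lin_order_inf w v c (l : int) : on_curve lin w -> w na = 0 ->
    cspec rc lin w v c -> c != 0 ->
  order_at rc lin w (v * u ^ (- l)) l.
Proof.
move=> ow a0; have nzb := lin_coord_neq0 ow a0; case: (ow) => _ sp vc nzc.
have nzu : u != 0 by rewrite tofrac_eq0 polyX_eq0.
have xi0 : cspec rc lin w u^-1 0.
  have := gspec_ratio rc idfun lin na nzb.
  by rewrite lin_na lin_nb a0 mul0r mul1r.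
suff coords i : exists p : {poly k}, lin i / lin nb = (map_poly rc p).[u^-1].
  by have := order_atI sp nzb xi0 coords l vc nzc; rewrite rmorph0 subr0 exprz_inv.
exists (mu i *: 1 + la i *: 'X).
rewrite lin_nb rmorphD /= !map_polyZ rmorph1 map_polyX !hornerE.
by rewrite /lin mulrDl mulfK // addrC.
Qed.

End OneCurve.

Definition pt2 (a b : k) : 'I_2 -> k := fun i => if i == ord0 then a else b.

Lemma line_mmap (F : {mpoly k[2]}) :
  mmap rc (line_generic k) F = mmap rc (lin (pt2 1 0) (pt2 0 1)) F.
Proof.
apply: eq_mmap => i; rewrite /line_generic /lin /pt2; case: ifP => _.
  by rewrite rmorph1 rmorph0 mul0r addr0.
by rewrite rmorph1 rmorph0 mul1r add0r.
Qed.

Lemma line_on_model (p : 'I_2 -> k) :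
  nonzero_vec p -> on_model rc (line_generic k) p.
Proof.
move=> nzp; split=> // d F hF; rewrite /hvanish line_mmap.
move=> F0; apply: (lin_specializes (a := p ord0) (b := p ord_max) _ hF F0) => i.
rewrite /pt2; have [->|] := eqVneq i ord0; first by ring.
rewrite mulr0 mulr1 add0r; case: i => -[|[|//]] // Hi _.
by congr (p _); apply: val_inj.
Qed.

(** A point w of the line corresponds to (w_na : w_nb). Domination in both directions follows from
    the ratios of coordinates, in the chart where the first or the second entry is nonzero. *)
Lemma lin_isomorphic n (la mu : 'I_n -> k) na nb :
    la na = 1 -> mu na = 0 -> la nb = 0 -> mu nb = 1 ->
  isomorphic_models rc (lin la mu) (line_generic k).
Proof.
move=> la_na mu_na la_nb mu_nb.
have cspecE w p : on_curve (lin la mu) w -> on_model rc (line_generic k) p ->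
    (exists c, [/\ c != 0, w na = c * p ord0 & w nb = c * p ord_max]) ->
    forall a c, cspec rc (line_generic k) p a c <-> cspec rc (lin la mu) w a c.
  move=> ow op [c [nzc waE wbE]] a v.
  have [_ spw] := ow; have [[i nzpi] spp] := op.
  have [_ wE] := (lin_on_curveP la_na mu_na la_nb mu_nb w).1 ow.
  have [lna lnb] := (lin_na la_na mu_na, lin_nb la_nb mu_nb).
  have [p0|nzp] := eqVneq (p ord0) 0.
    have nzp1 : p ord_max != 0.
      case: i nzpi => -[|[|//]] Hi; last by congr (p _ != 0); apply: val_inj.
      by rewrite (_ : Ordinal Hi = ord0) ?p0 ?eqxx //; apply: val_inj.
    have nzw : w nb != 0 by rewrite wbE mulf_neq0.
    have wa0 : w na = 0 by rewrite waE p0 mulr0.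
    split; [apply: (cspec_lies_over spw spp nzp1)|apply: (cspec_lies_over spp spw nzw)] => l.
      have := gspec_ratio rc idfun (lin la mu) na nzw.
      have := gspec1 rc idfun (lin la mu) w.
      rewrite lna lnb /line_generic; have [->|nzl] := eqVneq l ord0.
        by rewrite wa0 p0 !mul0r.
      have -> : l = ord_max by case: l nzl => -[|[|//]] // *; apply: val_inj.
      by rewrite /= !divff // tofrac_eq0 polyX_eq0.
    rewrite wE wa0 mul0r add0r lnb /lin mulrAC divff // mul1r.
    have nzu : u != 0 by rewrite tofrac_eq0 polyX_eq0.
    rewrite mulrDl mulfK //.
    have := gspec_ratio rc idfun (line_generic k) ord0 nzp1.
    rewrite p0 mul0r /line_generic /=.
    move=> /(gspecM (gspecC rc idfun _ p (la l))) /(gspecD spp).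
    move=> /(_ _ _ (gspecC rc idfun _ p (mu l))).
    by rewrite mulr0 add0r mul1r.
  have nzw : w na != 0 by rewrite waE mulf_neq0.
  have ratE : w nb / w na = p ord_max / p ord0 by rewrite wbE waE -mulf_div divff // mul1r.
  split; [apply: (cspec_lies_over spw spp nzp)|apply: (cspec_lies_over spp spw nzw)] => l.
    have := gspec_ratio rc idfun (lin la mu) nb nzw.
    have := gspec1 rc idfun (lin la mu) w.
    rewrite lna lnb /line_generic; have [->|nzl] := eqVneq l ord0.
      by rewrite !divff // oner_neq0.
    have -> : l = ord_max by case: l nzl => -[|[|//]] // *; apply: val_inj.
    by rewrite /= ratE.
  rewrite wE lna divr1 mulrDl mulrAC divff // mul1r mulrAC ratE /lin.
  have := gspec_ratio rc idfun (line_generic k) ord_max nzp.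
  rewrite /line_generic /= divr1.
  move=> /(gspecM (gspecC rc idfun _ p (mu l))).
  by rewrite [in X in _ -> X](mulrC _ (mu l)) => /(gspecD spp (gspecC rc idfun _ p (la l))).
split=> [w ow|p op].
  have [[i nzwi] wE] := (lin_on_curveP la_na mu_na la_nb mu_nb w).1 ow.
  have op : on_model rc (line_generic k) (pt2 (w na) (w nb)).
    apply: line_on_model.
    have [wa0|nza] := eqVneq (w na) 0; last by exists ord0.
    by exists ord_max; apply: (lin_coord_neq0 la_na mu_na la_nb mu_nb ow wa0).
  exists (pt2 (w na) (w nb)) => //.
  apply: same_local_ringP => a c; rewrite (cspecE _ _ ow op) //.
  by exists 1; rewrite !mul1r oner_neq0.
pose w i := p ord0 * la i + p ord_max * mu i.
have wa : w na = p ord0 by rewrite /w la_na mu_na mulr1 mulr0 addr0.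
have wb : w nb = p ord_max by rewrite /w la_nb mu_nb mulr1 mulr0 add0r.
have ow : on_curve (lin la mu) w.
  apply/(lin_on_curveP la_na mu_na la_nb mu_nb); split; last first.
    by move=> i; rewrite wa wb.
  have [[i nzpi] _] := op.
  have [p0|nzp] := eqVneq (p ord0) 0; last by exists na; rewrite wa.
  exists nb; rewrite wb; case: i nzpi => -[|[|//]] Hi; last first.
    by congr (p _ != 0); apply: val_inj.
  by rewrite (_ : Ordinal Hi = ord0) ?p0 ?eqxx //; apply: val_inj.
exists w => //; apply: same_local_ringP => a c; rewrite (cspecE _ _ ow op) //.
by exists 1; rewrite !mul1r oner_neq0.
Qed.

End LinearCurves.

(** * The function field of the quartic *)

Section Substitution.
Variables (k : fieldType) (n : nat).
Implicit Types (p q d f : {mpoly k[n]}) (s : 'I_n -> {mpoly k[n]}).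

Definition subst s p : {mpoly k[n]} := mmap (@mpolyC n k) s p.

Lemma subst_id p : subst (fun i => 'X_i) p = p.
Proof.
rewrite -[RHS]comp_mpoly_id /subst /comp_mpoly; apply: eq_mmap => i.
by rewrite tnth_mktuple.
Qed.

Lemma substM s p q : subst s (p * q) = subst s p * subst s q.
Proof. exact: rmorphM. Qed.

Lemma subst_dvd s d : (forall i, exists q, 'X_i - s i = d * q) ->
  forall p, exists q, p - subst s p = d * q.
Proof.
move=> ds p; rewrite -{1}(subst_id p).
apply: (@mmap_rel _ _ _ _ _ _ (fun a b => exists q, a - b = d * q)) => //.
- by move=> c; exists 0; rewrite subrr mulr0.
- move=> a b a' b' [q qE] [q' qE']; exists (q + q').
  by rewrite mulrDr -qE -qE'; ring.
- move=> a b a' b' [q qE] [q' qE']; exists (q * a' + b * q').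
  by rewrite mulrDr mulrA -qE (mulrCA d) -qE'; ring.
Qed.

(** The substitution s is reduction modulo d, and f stays nonzero under it. So d divides h and can
    be cancelled, one power at a time. *)
Lemma cancel_factor s d f : d != 0 -> (forall i, exists q, 'X_i - s i = d * q) ->
    subst s d = 0 -> subst s f != 0 ->
  forall l p h, d ^+ l * p = h * f -> exists h', p = h' * f.
Proof.
move=> nzd ds d0 f0; elim=> [|l IHl] p h; first by rewrite mul1r => ->; exists h.
rewrite exprS -mulrA => ph; have h0 : subst s h = 0.
  apply/eqP; rewrite -(mulIr_eq0 _ (mulIf f0)) -substM -ph substM d0.
  by rewrite mul0r.
have [q] := subst_dvd ds h; rewrite h0 subr0 => hE.
by apply: (IHl p q); apply: (mulfI nzd); rewrite ph hE mulrA.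
Qed.

End Substitution.

Notation o0 := (@Ordinal 3 0 isT).
Notation o1 := (@Ordinal 3 1 isT).
Notation o2 := (@Ordinal 3 2 isT).

Lemma ord3_ind (P : 'I_3 -> Prop) : P o0 -> P o1 -> P o2 -> forall i, P i.
Proof.
move=> P0 P1 P2 [[|[|[|//]]] Hi]; [move: P0|move: P1|move: P2];
  by congr P; apply: val_inj.
Qed.

Section Quartic.
Variables (k : comNzRingType) (al m : 'I_3 -> k) (e : k).

Section Eval.
Variables (A : comNzRingType) (j : {rmorphism k -> A}).

(** The formulas live over an arbitrary algebra, so that the form, its values at points and its
    values along arcs are instances of one expression, compared by [rmorph_quartic]. *)
Definition quad_M (y : 'I_3 -> A) : A :=
  j (m o0) * (y o1 * y o2) + j (m o1) * (y o0 * y o2) + j (m o2) * (y o0 * y o1).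

Definition quad_W (x : A) (y : 'I_3 -> A) : A :=
  x * (j (al o0) * y o0 + j (al o1) * y o1 + j (al o2) * y o2) + quad_M y.

Definition quartic (x : A) (y : 'I_3 -> A) : A :=
  quad_W x y ^+ 2 - j e * (x * (y o0 * y o1 * y o2)).

End Eval.

Lemma rmorph_quartic (A B : comNzRingType) (j : {rmorphism k -> A})
    (j' : {rmorphism k -> B}) (h : {rmorphism A -> B}) x y x' y' :
    (forall c, j' c = h (j c)) -> x' = h x -> (forall i, y' i = h (y i)) ->
  quartic j' x' y' = h (quartic j x y).
Proof.
move=> jE xE yE; rewrite /quartic /quad_W /quad_M !jE xE !yE.
by rewrite !(rmorphB, rmorphXn, rmorphD, rmorphM).
Qed.

End Quartic.

Lemma quadratic_Poly (F : fieldType) (l n c : F) :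
  (l *: 'X + n%:P) ^+ 2 - c *: 'X = Poly [:: n ^+ 2; (l * n) *+ 2 - c; l ^+ 2].
Proof.
apply/polyP => i; rewrite coef_Poly -!mul_polyC.
have -> : (l%:P * 'X + n%:P) ^+ 2 - c%:P * 'X =
    (l ^+ 2)%:P * 'X^2 + ((l * n) *+ 2 - c)%:P * 'X + (n ^+ 2)%:P.
  by rewrite !(rmorphXn, rmorphB, rmorphMn, rmorphM) /=; ring.
rewrite !coefD !coefCM coefXn coefX coefC.
by case: i => [|[|[|i]]] /=; rewrite ?(mulr0, mulr1, addr0, add0r) // nth_nil.
Qed.

Lemma quadratic_root (F K : fieldType) (h : {rmorphism F -> K}) (l n c : F) (x : K) :
  root (map_poly h ((l *: 'X + n%:P) ^+ 2 - c *: 'X)) x ->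
  (h l * x + h n) ^+ 2 - h c * x = 0.
Proof.
rewrite /root !(rmorphB, rmorphXn, rmorphD) /= !map_polyZ map_polyX map_polyC.
by rewrite /= !hornerE => /eqP.
Qed.

Lemma quadratic_clear (F : fieldType) (l n c a b : F) : b != 0 ->
  (l * (a / b) + n) ^+ 2 = c * (a / b) -> (l * a + n * b) ^+ 2 = c * a * b.
Proof.
move=> nzb eqn; have -> : l * a + n * b = (l * (a / b) + n) * b by field.
by rewrite exprMn eqn; field.
Qed.

(** The product of two linear remainders has a term in y^2, and multiplication by l^2 makes it
    removable: l^2 y^2 = f + (c - 2 l n) y - n^2. *)
Lemma pseudo_divisionM (S R : comNzRingType) (h : {rmorphism S -> R})
    (l n c A A' B B' : S) (y f H H' : R) :
    f = (h l * y + h n) ^+ 2 - h c * y ->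
  h l ^+ 2 * (H * f + h A + h B * y) * (H' * f + h A' + h B' * y) =
  (h l ^+ 2 * (H * H' * f + H * (h A' + h B' * y) + H' * (h A + h B * y)) + h B * h B') * f
  + h (l ^+ 2 * A * A' - B * B' * n ^+ 2)
  + h (l ^+ 2 * (A * B' + A' * B) + B * B' * (c - (l * n) *+ 2)) * y.
Proof.
by rewrite !(rmorphD, rmorphB, rmorphMn, rmorphM, rmorphXn) => ->; ring.
Qed.

Lemma pseudo_divisionD (S R : comNzRingType) (h : {rmorphism S -> R})
    (p q A A' B B' : S) (a b y f H H' : R) :
    h p * a = H * f + h A + h B * y -> h q * b = H' * f + h A' + h B' * y ->
  h p * h q * (a + b) = (h q * H + h p * H') * f
    + h (q * A + p * A') + h (q * B + p * B') * y.
Proof.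
move=> ab ab'; transitivity (h q * (h p * a) + h p * (h q * b)); first by ring.
by rewrite ab ab' !(rmorphD, rmorphM); ring.
Qed.

Section FunctionField.
Variables (k : closedFieldType) (al m : 'I_3 -> k) (e : k).
Hypotheses (nz_al : forall i, al i != 0) (nz_m : forall i, m i != 0) (nz_e : e != 0).

Local Notation D := {mpoly k[2]}.
Let Z : D := 'X_(@Ordinal 2 0 isT).
Let T : D := 'X_(@Ordinal 2 1 isT).
(* The quartic is (ell X + N)^2 - e Z T X in the affine coordinates X, Z, T. *)
Let ell : D := (al o0)%:MP + m o1 *: T + m o2 *: Z.
Let N : D := al o1 *: Z + al o2 *: T + m o0 *: (Z * T).

Let sig (i : 'I_2) : D := if val i == 0 then 0 else T.

Lemma subst_sig_dvd p : exists q, p - subst sig p = Z * q.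
Proof.
apply: subst_dvd => -[[|[|//]] Hi]; rewrite /sig /=.
  by exists 1; rewrite subr0 mulr1; congr 'X_(_); apply: val_inj.
exists 0; rewrite mulr0; apply/eqP; rewrite subr_eq0; apply/eqP.
by congr 'X_(_); apply: val_inj.
Qed.

Lemma meval_neq0 n (p : {mpoly k[n]}) v : p.@[v] != 0 -> p != 0.
Proof. by apply: contra_neq => ->; rewrite meval0. Qed.

Let Z_neq0 : Z != 0.
Proof. by apply: (@meval_neq0 _ _ (fun=> 1)); rewrite mevalXU oner_neq0. Qed.

Let T_neq0 : T != 0.
Proof. by apply: (@meval_neq0 _ _ (fun=> 1)); rewrite mevalXU oner_neq0. Qed.

Let sigZ : subst sig Z = 0.
Proof. by rewrite /subst mmapXU. Qed.

Let sigT : subst sig T = T.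
Proof. by rewrite /subst mmapXU. Qed.

Let sig_ell : subst sig ell = (al o0)%:MP + m o1 *: T.
Proof.
rewrite /subst /ell !rmorphD /= !mmapZ mmapC -/(subst sig Z) -/(subst sig T).
by rewrite sigZ sigT mulr0 addr0 mul_mpolyC.
Qed.

Let sig_N : subst sig N = al o2 *: T.
Proof.
rewrite /subst /N !rmorphD /= !mmapZ rmorphM /=.
rewrite -/(subst sig Z) -/(subst sig T).
by rewrite sigZ sigT mul0r !mulr0 addr0 add0r mul_mpolyC.
Qed.

(* Infinite descent: reducing modulo Z shows that Z divides a and b. *)
Lemma no_root_descent s (a b : D) : (msize b <= s)%N ->
  (ell * a + N * b) ^+ 2 = e *: (Z * T * a * b) -> b = 0.
Proof.
elim: s a b => [|s IHs] a b szb ab.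
  by apply/eqP; rewrite -msize_poly_eq0 -leqn0.
have ell0 : subst sig ell != 0.
  rewrite sig_ell; apply: (@meval_neq0 _ _ (fun=> 0)).
  by rewrite mevalD mevalZ mevalXU mevalC mulr0 addr0.
have N0 : subst sig N != 0 by rewrite sig_N scaler_eq0 negb_or nz_al.
have SM c p q : subst sig (c *: (p * q)) = c *: (subst sig p * subst sig q).
  by rewrite /subst mmapZ rmorphM mul_mpolyC.
have cab : subst sig (ell * a + N * b) = 0.
  have := congr1 (subst sig) ab.
  rewrite -2!mulrA SM sigZ mul0r scaler0 expr2 substM -expr2.
  by move/eqP; rewrite expf_eq0 => /eqP.
have [a' aE] := subst_sig_dvd a; have [b' bE] := subst_sig_dvd b.
have [c] := subst_sig_dvd (ell * a + N * b); rewrite cab subr0 => cE.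
have {cab}: subst sig ell * subst sig a = - (subst sig N * subst sig b).
  by apply/eqP; rewrite -addr_eq0 -!substM -[X in _ == X]cab /subst rmorphD.
(* Both sides of the equation contain Z. Dividing by it once leaves a factor Z on the left only, so
   that Z divides a b. *)
have tab : Z * c ^+ 2 = e *: (T * (a * b)).
  apply: (mulfI Z_neq0); rewrite -scalerAr -[RHS]/(e *: (Z * (T * (a * b)))).
  by rewrite !mulrA -ab cE; ring.
have /eqP : subst sig a * subst sig b = 0.
  have /eqP := congr1 (subst sig) tab.
  rewrite substM sigZ mul0r SM sigT substM eq_sym scaler_eq0 (negbTE nz_e).
  by rewrite mulf_eq0 (negbTE T_neq0) => /eqP.
rewrite mulf_eq0 => ab0 /eqP lN.
have {ab0} [a0 b0] : subst sig a = 0 /\ subst sig b = 0.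
  case/orP: ab0 lN => /eqP ->; rewrite mulr0.
    by rewrite eq_sym oppr_eq0 mulf_eq0 (negbTE N0) => /eqP.
  by rewrite oppr0 mulf_eq0 (negbTE ell0) => /eqP.
rewrite a0 subr0 in aE; rewrite b0 subr0 in bE.
(* The quotients satisfy the same equation, and the size of b has dropped. *)
have b'0 : b' = 0.
  apply: (IHs a' b').
    have [->|nzb'] := eqVneq b' 0; first by rewrite msize0.
    by move: szb; rewrite bE msizeM // msizeX mdeg1.
  apply: (mulfI (mulf_neq0 Z_neq0 Z_neq0)).
  rewrite -scalerAr; move: ab; rewrite aE bE => ab.
  have -> : Z * Z * (Z * T * a' * b') = Z * T * (Z * a') * (Z * b') by ring.
  by rewrite -ab; ring.
by rewrite bE b'0 mulr0.
Qed.

Local Notation F0 := {fraction D}.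
Local Notation tf := (@FracField.tofrac D).
Let pol : {poly F0} := (tf ell *: 'X + (tf N)%:P) ^+ 2 - tf (e *: (Z * T)) *: 'X.

Let ell_neq0 : ell != 0.
Proof.
apply: (@meval_neq0 _ _ (fun=> 0)).
by rewrite !mevalD !mevalZ !mevalXU mevalC !mulr0 !addr0.
Qed.

Let N_neq0 : N != 0.
Proof.
apply: (@meval_neq0 _ _ (fun i => (val i == 1)%:R)).
by rewrite !mevalD !mevalZ mevalM !mevalXU /= !(mulr0, mul0r) mulr1 add0r addr0.
Qed.

Let size_pol : size pol = 3.
Proof.
rewrite /pol quadratic_Poly.
by rewrite (@PolyK _ 0) //= expf_neq0 // tofrac_eq0 ell_neq0.
Qed.

Let pol_no_root r : ~~ root pol r.
Proof.
apply/negP; have [a [b [nzb ->]]] := fractionP r.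
rewrite /root !hornerE subr_eq0 => /eqP ab.
have nzfb : tf b != 0 by rewrite tofrac_eq0.
case/negP: nzb; apply/eqP; apply: (@no_root_descent _ a b (leqnn _)).
apply/eqP; rewrite -tofrac_eq; apply/eqP.
rewrite (_ : e *: (Z * T * a * b) = e *: (Z * T) * a * b); last first.
  by rewrite -!scalerAl.
rewrite tofracXn tofracD !tofracM.
by apply: quadratic_clear nzfb _; move: ab; rewrite /= -!mulrA.
Qed.

Let pol_irr : irreducible_poly pol.
Proof. by apply: cubic_irreducible; rewrite ?size_pol. Qed.

Let emb3 : {mpoly k[2]} -> {mpoly k[3]} :=
  mmap (@mpolyC 3 k) (fun i : 'I_2 => 'X_(if val i == 0 then o1 else o2)).

Let f1 : {mpoly k[3]} := quartic al m e (@mpolyC 3 k) 1 (fun i => 'X_i).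

Let f1E : f1 = (emb3 ell * 'X_o0 + emb3 N) ^+ 2 - emb3 (e *: (Z * T)) * 'X_o0.
Proof.
rewrite /f1 /quartic /quad_W /quad_M /emb3 /ell /N.
rewrite !(rmorphD, rmorphM) /= !mmapZ !rmorphM /= !mmapXU !mmapC /=.
by ring.
Qed.

(** [f1] is quadratic in X with leading coefficient ell^2, so a power of this coefficient times F
    has a remainder linear in X. *)
Lemma pseudo_division F : exists l H A B,
  (emb3 ell ^+ 2) ^+ l * F = H * f1 + emb3 A + emb3 B * 'X_o0.
Proof.
pose P F := exists l H A B,
  (emb3 ell ^+ 2) ^+ l * F = H * f1 + emb3 A + emb3 B * 'X_o0.
have embP A : P (emb3 A).
  by exists 0, 0, A, 0; rewrite /emb3 rmorph0; ring.
rewrite -(subst_id F) -/(P _); apply: mmap_ind.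
- by move=> c; have := embP c%:MP; rewrite /emb3 mmapC.
- move=> a b [l [H [A [B ab]]]] [l' [H' [A' [B' ab']]]].
  exists (l + l')%N, (emb3 ((ell ^+ 2) ^+ l') * H + emb3 ((ell ^+ 2) ^+ l) * H').
  exists ((ell ^+ 2) ^+ l' * A + (ell ^+ 2) ^+ l * A').
  exists ((ell ^+ 2) ^+ l' * B + (ell ^+ 2) ^+ l * B').
  have embX r : (emb3 ell ^+ 2) ^+ r = emb3 ((ell ^+ 2) ^+ r).
    by rewrite -!exprM -[RHS]/(emb3 _) /emb3 rmorphXn.
  move: ab ab'; rewrite exprD !embX; exact: pseudo_divisionD.
- move=> a b [l [H [A [B ab]]]] [l' [H' [A' [B' ab']]]].
  exists (l + l').+1, (emb3 ell ^+ 2 * (H * H' * f1 + H * (emb3 A' + emb3 B' * 'X_o0)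
     + H' * (emb3 A + emb3 B * 'X_o0)) + emb3 B * emb3 B').
  exists (ell ^+ 2 * A * A' - B * B' * N ^+ 2).
  exists (ell ^+ 2 * (A * B' + A' * B) + B * B' * (e *: (Z * T) - (ell * N) *+ 2)).
  have -> : (emb3 ell ^+ 2) ^+ (l + l').+1 * (a * b) =
    emb3 ell ^+ 2 * ((emb3 ell ^+ 2) ^+ l * a) * ((emb3 ell ^+ 2) ^+ l' * b).
    by rewrite exprS exprD -!mulrA [in RHS](mulrCA a).
  by rewrite ab ab'; apply: pseudo_divisionM f1E.
- apply: ord3_ind.
  + exists 0, 0, 0, 1; rewrite /emb3 rmorph0 rmorph1; ring.
  + suff -> : 'X_o1 = emb3 Z by apply: embP.
    by rewrite /emb3 mmapXU.
  + suff -> : 'X_o2 = emb3 T by apply: embP.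
    by rewrite /emb3 mmapXU.
Qed.

(** Solves ell = 0 for Z, hence is reduction modulo ell. *)
Let s3 (i : 'I_3) : {mpoly k[3]} :=
  if i == o1 then - (m o2)^-1 *: ((al o0)%:MP + m o1 *: 'X_o2) else 'X_i.

Let emb_ell : emb3 ell = (al o0)%:MP + m o1 *: 'X_o2 + m o2 *: 'X_o1.
Proof.
by rewrite /emb3 /ell !rmorphD /= !mmapZ !mmapXU mmapC /= !mul_mpolyC.
Qed.

Lemma cancel_ell l F H : (emb3 ell ^+ 2) ^+ l * F = H * f1 -> exists H', F = H' * f1.
Proof.
rewrite -exprM; apply: (@cancel_factor _ _ s3).
- rewrite emb_ell; apply: (@meval_neq0 _ _ (fun=> 0)).
  by rewrite !mevalD !mevalZ !mevalXU mevalC !mulr0 !addr0.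
- move=> i; rewrite /s3; case: eqP => [->|_]; last by exists 0; rewrite subrr mulr0.
  exists ((m o2)^-1)%:MP; rewrite emb_ell scaleNr opprK mulrC mul_mpolyC.
  by rewrite [RHS]scalerDr [_ *: (m o2 *: _)]scalerA mulVf // scale1r addrC.
- rewrite emb_ell /subst !rmorphD /= !mmapZ !mmapXU mmapC /s3 /= mul_mpolyC.
  by rewrite mul_mpolyC scalerA mulrN divff // scaleN1r subrr.
(* A nonroot t gives a point of ell = 0 whose coordinates z and t are both nonzero. *)
have : 'X * ((al o0)%:P + m o1 *: 'X) != 0 :> {poly k}.
  rewrite mulf_neq0 ?polyX_eq0 //; apply: contraTneq (nz_al o0) => /(congr1 (horner^~ 0)).
  by rewrite !hornerE => ->; rewrite eqxx.
move=> /closed_nonrootP[t]; rewrite /root !hornerE mulf_eq0 negb_or => /andP[nzt nzd].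
apply/negP => /eqP f0.
pose z := - (m o2)^-1 * (al o0 + m o1 * t).
have nzz : z != 0 by rewrite mulf_neq0 // oppr_eq0 invr_eq0.
have val y : quartic al m e idfun 1 (fun i => if i == o0 then y else if i == o1 then z else t) = 0.
  pose v (i : 'I_3) := if i == o0 then y else t.
  rewrite (rmorph_quartic al m e (j := @mpolyC 3 k) (h := meval v) (x := 1) (y := s3)).
  - suff <- : subst s3 f1 = quartic al m e (@mpolyC 3 k) 1 s3 by rewrite f0 rmorph0.
    rewrite /f1 /subst; symmetry; apply: rmorph_quartic => //.
    - by move=> c; rewrite /= mmapC.
    - by rewrite rmorph1.
    - by move=> i; rewrite /= mmapXU.
  - by move=> c; rewrite /= mevalC.
  - by rewrite rmorph1.
  - by apply: ord3_ind; rewrite /s3 /= ?mevalZ ?mevalD ?mevalZ ?mevalXU ?mevalC.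
have lz : al o0 + m o1 * t + m o2 * z = 0 by rewrite /z; field.
(* Where ell vanishes the equation reads N^2 = e Z T X; comparing X = 0 with X = 1 gives the
   claim. *)
have : e * z * t = 0.
  have := (val 0, val 1); rewrite /quartic /quad_W /quad_M /= => -[v0 v1].
  transitivity ((al o0 + m o1 * t + m o2 * z) * ((al o1 * z + al o2 * t + m o0 * (z * t)) *+ 2
     + (al o0 + m o1 * t + m o2 * z))); last by rewrite lz mul0r.
  apply/eqP; rewrite -subr_eq0 -[X in _ == X]subr0 -[X in _ == X - _]v0 -[X in _ == _ - X]v1.
  by apply/eqP; ring.
by move/eqP; apply/negP; apply: mulf_neq0 => //; apply: mulf_neq0.
Qed.

(** K adjoins a root X of the irreducible quadratic polynomial to k(Z, T). The third clause says, as
    an induction principle, that K is generated as a field by k and y. For the last one, the linear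
    remainder A + B X of F must vanish, since otherwise X would equal - A / B in k(Z, T); then the
    powers of ell are cancelled. *)
Lemma function_field_exists : exists (K : fieldType) (iota : {rmorphism k -> K}),
  exists y : 'I_3 -> K,
  [/\ forall i, y i != 0, quartic al m e iota 1 y = 0,
     forall P : K -> Prop, (forall c, P (iota c)) ->
       (forall a b, P a -> P b -> P (a + b)) ->
       (forall a b, P a -> P b -> P (a * b)) -> (forall a, P a -> P a^-1) ->
       (forall i, P (y i)) -> forall a, P a
   & forall F : {mpoly k[3]}, mmap iota y F = 0 ->
       exists H, F = H * quartic al m e (@mpolyC 3 k) 1 (fun i => 'X_i)].
Proof.
have [L _ [x rx genx]] := irredp_FAdjoin pol_irr.
pose inL : {rmorphism D -> L} := GRing.in_alg L \o tf.
pose iota : {rmorphism k -> L} := inL \o @mpolyC 2 k.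
pose y (i : 'I_3) : L := if i == o0 then x else if i == o1 then inL Z else inL T.
have inL0 A : inL A = 0 -> A = 0.
  by move/eqP; rewrite fmorph_eq0 tofrac_eq0 => /eqP.
have inLE A : mmap iota y (emb3 A) = inL A.
  have -> : inL A = mmap iota (fun i => inL 'X_i) A.
    by rewrite -{1}(subst_id A); apply/esym; apply: rmorph_mmap.
  apply/esym; apply: rmorph_mmap => [c|i] /=; first by rewrite mmapC.
  rewrite mmapXU; case: i => -[|[|//]] Hi /=; rewrite /y /=;
    by congr (inL 'X_(_)); apply: val_inj.
have xE : mmap iota y 'X_o0 = x by rewrite mmapXU.
have f1x : mmap iota y f1 = 0.
  rewrite f1E !(rmorphB, rmorphXn, rmorphD, rmorphM) /= xE -!/(emb3 _) !inLE.
  exact: quadratic_root rx.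
exists L, iota, y; split.
- apply: ord3_ind; rewrite /y /=.
  + apply: contraTneq isT => x0; move: f1x.
    rewrite f1E !(rmorphB, rmorphXn, rmorphD, rmorphM) /= xE -!/(emb3 _) !inLE x0.
    rewrite !mulr0 add0r subr0 => /eqP; rewrite expf_eq0 /= => /eqP/inL0 N0.
    by move: N_neq0; rewrite N0 eqxx.
  + by apply: contra_neq Z_neq0 => /inL0.
  + by apply: contra_neq T_neq0 => /inL0.
- rewrite -f1x; apply: rmorph_quartic => [c||i] /=; first by rewrite mmapC.
    by rewrite rmorph1.
  by rewrite mmapXU.
- move=> P PC PD PM PV Py a.
  have PL A : P (inL A).
    rewrite -inLE /emb3; have -> : mmap iota y (mmap (@mpolyC 3 k)
       (fun i : 'I_2 => 'X_(if val i == 0 then o1 else o2)) A) =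
       mmap iota (fun i : 'I_2 => y (if val i == 0 then o1 else o2)) A.
      apply/esym; apply: rmorph_mmap => [c|i] /=; first by rewrite mmapC.
      by rewrite mmapXU.
    by apply: mmap_ind.
  have PF (r : F0) : P (GRing.in_alg L r).
    have [A [B [_ ->]]] := fractionP r.
    by rewrite fmorph_div; apply: (PM); [exact: PL | apply: (PV); exact: PL].
  have /Fadjoin1_polyP[p ->] : a \in <<1; x>>%VS by rewrite genx memvf.
  elim/poly_ind: p => [|p c IHp].
    by rewrite rmorph0 horner0; have := PF 0; rewrite rmorph0.
  rewrite !rmorphD !rmorphM /= map_polyX map_polyC /= !hornerE.
  by apply: (PD); [apply: (PM) => //; apply: (Py o0) | apply: PF].
- move=> F F0; have [l [H [A [B FE]]]] := pseudo_division F.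
  have := congr1 (mmap iota y) FE.
  rewrite !rmorphD !rmorphM /= F0 mulr0 xE !inLE f1x mulr0 add0r => /esym ABx.
  have [B0|nzB] := eqVneq B 0.
    move: ABx; rewrite B0 rmorph0 mul0r addr0 => /inL0 A0.
    move: FE; rewrite A0 B0 /emb3 rmorph0 mul0r !addr0.
    exact: cancel_ell.
  have nziB : inL B != 0 by apply: contra_neq nzB => /inL0.
  case/negP: (pol_no_root (- (tf A / tf B))).
  rewrite -(fmorph_root (GRing.in_alg L)) rmorphN fmorph_div.
  suff -> : - (GRing.in_alg L (tf A) / GRing.in_alg L (tf B)) = x by [].
  apply: (mulfI nziB); rewrite mulrN mulrC divfK // mulrC; apply/esym/eqP.
  by rewrite -addr_eq0 addrC mulrC ABx.
Qed.

End FunctionField.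

Definition hom_pt (A : Type) (i0 : 'I_4) (x : A) (y : 'I_3 -> A) (i : 'I_4) : A :=
  if unlift i0 i is Some j then y j else x.

Lemma hom_pt0 (A : Type) i0 (x : A) y : hom_pt i0 x y i0 = x.
Proof. by rewrite /hom_pt unlift_none. Qed.

Lemma hom_pt_lift (A : Type) i0 (x : A) y j : hom_pt i0 x y (lift i0 j) = y j.
Proof. by rewrite /hom_pt liftK. Qed.

Section Homogeneous.
Variables (k : closedFieldType) (al m : 'I_3 -> k) (e : k).
Hypotheses (nz_m : forall i, m i != 0).
Variable i0 : 'I_4.

(** The coordinate [i0] plays the role of x. *)
Definition d4_quartic : {mpoly k[4]} :=
  quartic al m e (@mpolyC 4 k) 'X_i0 (fun j => 'X_(lift i0 j)).

Lemma quartic_dehomog (K : fieldType) (j : {rmorphism k -> K}) x y : x != 0 ->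
  quartic al m e j 1 (fun i => y i / x) = quartic al m e j x y / x ^+ 4.
Proof. by move=> nzx; rewrite /quartic /quad_W /quad_M; field. Qed.

Lemma mmap_d4_quartic (A : comNzRingType) (j : {rmorphism k -> A}) v :
  mmap j v d4_quartic = quartic al m e j (v i0) (fun l => v (lift i0 l)).
Proof.
by apply/esym; apply: rmorph_quartic => [c||l]; rewrite /= ?mmapXU // -[RHS]/(mmap j v c%:MP) mmapC.
Qed.

Lemma frac_clear (K : fieldType) (a b c h f : K) : a != 0 -> b != 0 ->
  a * b * (c * (h / a * (f / b))) = c * h * f.
Proof. by move=> nza nzb; field; apply/andP. Qed.

(** Divide after setting the coordinate [i0] to 1, then substitute the ratios of the coordinates to
    return to forms. This leaves a power of the coordinate [i0], which cancels because the quartic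
    reduces to M^2 modulo this coordinate. *)
Lemma d4_quartic_dvd (K : fieldType) (iota : {rmorphism k -> K}) (y : 'I_3 -> K) :
    (forall F : {mpoly k[3]}, mmap iota y F = 0 ->
      exists H, F = H * quartic al m e (@mpolyC 3 k) 1 (fun i => 'X_i)) ->
  forall d (F : {mpoly k[4]}), F \is d.-homog ->
  mmap iota (hom_pt i0 1 y) F = 0 -> exists H, F = H * d4_quartic.
Proof.
move=> dvd d F hF F0.
pose F1 := mmap (@mpolyC 3 k) (hom_pt i0 1 (fun j => 'X_j)) F.
have /dvd[H F1E] : mmap iota y F1 = 0.
  rewrite -F0; apply/esym; apply: rmorph_mmap => [c|i]; first by rewrite /= mmapC.
  by rewrite /= /hom_pt; case: unlift => [j|]; rewrite ?mmapXU ?rmorph1.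
pose tf := @FracField.tofrac {mpoly k[4]}.
pose c : {rmorphism k -> {fraction {mpoly k[4]}}} := tf \o @mpolyC 4 k.
pose x := tf 'X_i0.
have nzX : 'X_i0 != 0 :> {mpoly k[4]}.
  by apply: (@meval_neq0 _ _ _ (fun=> 1)); rewrite mevalXU oner_neq0.
have nzx : x != 0 by rewrite tofrac_eq0.
pose psi := mmap c (fun j => tf 'X_(lift i0 j) / x).
have FE : tf F = x ^+ d * psi F1.
  have -> : tf F = mmap c (fun i => tf 'X_i) F.
    by rewrite -{1}(subst_id F); apply/esym; apply: rmorph_mmap.
  rewrite (eq_mmap _ (w := fun i => x * (tf 'X_i / x))); last first.
    by move=> i; rewrite mulrC divfK.
  rewrite (mmap_homogZ _ _ _ hF); congr (_ * _).
  apply: rmorph_mmap => [b|i]; first by rewrite /= mmapC.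
  rewrite /hom_pt; case: unliftP => [l|] ->; first by rewrite /= mmapXU.
  by rewrite /= rmorph1 divff.
have fE : psi (quartic al m e (@mpolyC 3 k) 1 (fun i => 'X_i)) = tf d4_quartic / x ^+ 4.
  have -> : tf d4_quartic = quartic al m e c x (fun j => tf 'X_(lift i0 j)).
    by apply/esym; apply: rmorph_quartic.
  rewrite /psi -(@rmorph_quartic k al m e _ _ (@mpolyC 3 k) c (mmap c (fun j => tf 'X_(lift i0 j) / x)) 1
    (fun i => 'X_i) 1 (fun j => tf 'X_(lift i0 j) / x)).
  - exact: quartic_dehomog.
  - by move=> b; rewrite /= mmapC.
  - by rewrite rmorph1.
  - by move=> i; rewrite /= mmapXU.
have [l [H' HE]] : exists l H', psi H = tf H' / x ^+ l.
  apply: (mmap_ind (T := fun a => exists l H', a = tf H' / x ^+ l)).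
  - by move=> b; exists 0, b%:MP; rewrite divr1.
  - move=> a b [l [H1 ->]] [l' [H2 ->]].
    exists (l + l')%N, ('X_i0 ^+ l' * H1 + 'X_i0 ^+ l * H2).
    rewrite {3}/tf !(rmorphD, rmorphM, rmorphXn) /= -!/(tf _) -/x exprD.
    by rewrite addf_div ?expf_neq0 // [tf H2 * _]mulrC [tf H1 * _]mulrC.
  - move=> a b [l [H1 ->]] [l' [H2 ->]]; exists (l + l')%N, (H1 * H2).
    by rewrite {3}/tf rmorphM /= exprD mulf_div.
  - by move=> i; exists 1%N, 'X_(lift i0 i).
have : 'X_i0 ^+ (l + 4) * F = ('X_i0 ^+ d * H') * d4_quartic.
  apply/eqP; rewrite -tofrac_eq !(rmorphM, rmorphXn) /= -!/(tf _) -/x FE F1E.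
  rewrite /psi rmorphM /= -!/(psi _) fE HE exprD; apply/eqP.
  by apply: frac_clear; rewrite expf_neq0.
apply: (@cancel_factor _ _ (fun i => if i == i0 then 0 else 'X_i)) => //.
- move=> i; case: eqP => [->|_]; first by exists 1; rewrite subr0 mulr1.
  by exists 0; rewrite subrr mulr0.
- by rewrite /subst mmapXU eqxx.
(* At x = 0 and y = (0, 1, 1) the quartic takes the value m_0^2. *)
apply: (@meval_neq0 _ _ _ (hom_pt i0 0 (fun j => if j == o0 then 0 else 1))).
rewrite /subst mmap_d4_quartic eqxx.
rewrite -(@rmorph_quartic k al m e _ _ (@mpolyC 4 k) idfun
  (meval (hom_pt i0 0 (fun j => if j == o0 then 0 else 1))) 0 _ 0
    (fun j => if j == o0 then 0 else 1)).
- rewrite /quartic /quad_W /quad_M /= !(mul0r, mulr0, mulr1, add0r, addr0, subr0).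
  by rewrite expf_neq0.
- by move=> b; rewrite /= mevalC.
- by rewrite rmorph0.
- move=> i; have /negbTE := neq_lift i0 i; rewrite eq_sym => ->.
  by rewrite /= mevalXU hom_pt_lift.
Qed.

End Homogeneous.

(** * Parity of degrees on rational curves *)

Section SameLocalRing.
Variables (k K : fieldType) (f : {rmorphism k -> K}).

(** The maximal ideal consists of the nonunits of the local ring. *)
Lemma same_local_max n n' (g : 'I_n -> K) w (g' : 'I_n' -> K) w' :
    specializes f idfun g w -> specializes f idfun g' w' ->
    same_local_ring f g w g' w' ->
  forall a, local_max f g w a <-> local_max f g' w' a.
Proof.
suff half n1 n2 (g1 : 'I_n1 -> K) w1 (g2 : 'I_n2 -> K) w2 :
    specializes f idfun g1 w1 -> specializes f idfun g2 w2 ->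
    same_local_ring f g1 w1 g2 w2 -> forall a, local_max f g1 w1 a -> local_max f g2 w2 a.
  by move=> gw gw' same a; split; apply: half => // b; rewrite same.
move=> gw gw' same a /local_maxP a0.
have /same/local_ringP[c ac] : local_ring f g1 w1 a by apply/local_ringP; exists 0.
apply/local_maxP; have [<- //|nzc] := eqVneq c 0.
have /same/local_ringP[d a'd] : local_ring f g2 w2 a^-1.
  by apply/local_ringP; exists c^-1; apply: gspecV.
have := gspecM a0 a'd; rewrite divff ?(gspec_neq0 gw' nzc ac) // mul0r.
move=> /(gspec_fun gw (gspec1 _ _ _ _))/eqP.
by rewrite oner_eq0.
Qed.

(** The coordinates of a closed point are the residues of the ratios of the generic coordinates, and
    the local ring determines these residues. *)
Lemma same_local_ring_proj n (g : 'I_n -> K) w w' :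
    on_model f g w -> on_model f g w' -> same_local_ring f g w g w' ->
  proj_eq w w'.
Proof.
move=> [[m nzm] gw] [[m' nzm'] gw'] same.
have nzw'm : w' m != 0.
  apply: contraTneq isT => w'm0.
  have rat := gspec_ratio f idfun g m nzm'.
  rewrite w'm0 mul0r in rat.
  have /(same_local_max gw gw' same)/local_maxP rat0 :
    local_max f g w' (g m / g m') by apply/local_maxP.
  have /(gspecM rat0) := gspec_ratio f idfun g m' nzm.
  rewrite mul0r mulrA divfK ?(specializes_coord gw' nzm') //.
  rewrite divff ?(specializes_coord gw nzm) //.
  by move/(gspec_fun gw (gspec1 _ _ _ _))/eqP; rewrite oner_eq0.
exists (w m / w' m) => [|i]; first by rewrite mulf_neq0 ?invr_eq0.
have /(same_local_max gw gw' same)/local_maxP :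
    local_max f g w (g i / g m - f (w i / w m)).
  apply/local_maxP; rewrite -(subrr (w i / w m)).
  by apply: gspecB => //; [apply: gspec_ratio | apply: gspecC].
have := gspecB gw' (gspec_ratio f idfun g i nzw'm) (gspecC f idfun g w' (w i / w m)).
move=> val0 /(gspec_fun gw' val0)/eqP; rewrite subr_eq0 => /eqP wE.
by rewrite mulrAC -mulrA wE mulrC divfK.
Qed.

End SameLocalRing.

Section Parity.
Variable k : closedFieldType.
Local Notation rc := (ratfun_const k).
Local Notation tf := (@FracField.tofrac {poly k}).
Local Notation u := (tf 'X : ratfun k).
Local Notation line := (line_generic k).

Definition line_pt (x : option k) : 'I_2 -> k :=
  if x is Some a then pt2 1 a else pt2 0 1.

(** [None] is the point at infinity, where a polynomial has minus its degree as order; the sign does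
    not affect the parity. *)
Definition mult (x : option k) (p : {poly k}) : nat :=
  if x is Some a then mup a p else (size p).-1.

Lemma multM x p q : p != 0 -> q != 0 -> mult x (p * q) = (mult x p + mult x q)%N.
Proof.
move=> nzp nzq; case: x => [a|] /=; first exact: mupM.
by rewrite size_mul //; move: nzp nzq; rewrite -!size_poly_gt0; case: (size p) (size q) => [|a] [|b] // _ _; rewrite addSn addnS.
Qed.

Lemma mult1 x : mult x 1 = 0.
Proof. by case: x => [a|] /=; rewrite ?size_poly1 // mupNroot ?root1. Qed.

(** The order of a quotient is a difference of multiplicities; modulo 2 it is their sum, which stays
    in the natural numbers. *)
Definition order_parity (x : option k) (r : ratfun k) (b : bool) :=
  exists p q : {poly k}, [/\ p != 0, q != 0, r = tf p / tf q & b = odd (mult x p + mult x q)].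

Lemma order_parity_fun x r b b' : order_parity x r b -> order_parity x r b' -> b = b'.
Proof.
move=> [p [q [nzp nzq -> ->]]] [p' [q' [nzp' nzq' + ->]]].
have nzf t : t != 0 -> tf t != 0 by rewrite tofrac_eq0.
move/eqP; rewrite eqr_div ?nzf // -!tofracM tofrac_eq => /eqP pq.
have := congr1 (mult x) pq; rewrite !multM //; lia.
Qed.

Lemma order_parityM x r s b c : order_parity x r b -> order_parity x s c ->
  order_parity x (r * s) (b (+) c).
Proof.
move=> [p [q [nzp nzq -> ->]]] [p' [q' [nzp' nzq' -> ->]]].
exists (p * p'), (q * q'); split; rewrite ?mulf_neq0 //.
  by rewrite !tofracM mulf_div.
by rewrite !multM //; lia.
Qed.

Lemma order_parityV x r b : order_parity x r b -> order_parity x r^-1 b.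
Proof.
move=> [p [q [nzp nzq -> ->]]]; exists q, p; split=> //; first by rewrite invf_div.
by rewrite addnC.
Qed.

Lemma order_parity_exists x r : r != 0 -> exists b, order_parity x r b.
Proof.
have [p [q [nzq ->]]] := fractionP r => nzr.
exists (odd (mult x p + mult x q)), p, q; split=> //.
by apply: contra_neq nzr => ->; rewrite tofrac0 mul0r.
Qed.

Lemma order_parity1 x : order_parity x 1 false.
Proof. by exists 1, 1; rewrite !oner_neq0 mult1 divr1. Qed.

Lemma order_parity_sqr x r : r != 0 -> order_parity x (r ^+ 2) false.
Proof.
move=> /(order_parity_exists x)[b rb]; rewrite -(addbb b) expr2.
exact: order_parityM.
Qed.

Lemma order_parityXz x r b (l : int) : order_parity x r b ->
  order_parity x (r ^ l) (odd `|l| && b).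
Proof.
move=> rb; have Xn n : order_parity x (r ^+ n) (odd n && b).
  elim: n => [|n IHn]; first exact: order_parity1.
  have -> : odd n.+1 && b = b (+) (odd n && b) by case: b {rb IHn}; rewrite /= ?andbT ?andbF; case: odd.
  by rewrite exprS; apply: order_parityM.
case: l => n; first exact: Xn.
rewrite NegzE abszN absz_nat -exprnN; exact: order_parityV.
Qed.

Lemma line_polyE F : mmap rc line F = tf (mmap polyC (fun i : 'I_2 => if i == ord0 then 1 else 'X) F).
Proof.
apply: rmorph_mmap => // i; rewrite /line_generic; case: ifP => //.
Qed.

(** At infinity the value of F is the coefficient of X^d, so that the dehomogenized polynomial has
    degree exactly d. *)
Lemma mult_form x d (F : {mpoly k[2]}) : F \is d.-homog -> F.@[line_pt x] != 0 ->
  mult x (mmap polyC (fun i : 'I_2 => if i == ord0 then 1 else 'X) F)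
    = if x is Some _ then 0 else d.
Proof.
move=> hF; set P := mmap _ _ F; case: x => [a|] /= nzF.
  apply: mupNroot; rewrite /root; apply: contra_neq nzF => <-.
  rewrite /P -[P.[a]]/(horner_eval a P); apply: rmorph_mmap => [c|i].
    by rewrite /= ?horner_evalE hornerC.
  by rewrite /pt2 /= ?horner_evalE; case: ifP; rewrite ?hornerC ?hornerX.
have mE (m : 'X_{1..2}) : m \in msupp F -> mdeg m = d by move/dhomogP: hF => /[apply].
have PE : P = \sum_(m <- msupp F) F@_m *: 'X^(m ord_max).
  apply: eq_big_seq => m _; rewrite mul_polyC /mmap1; congr (_ *: _).
  rewrite big_ord_recl big_ord1 /= expr1n mul1r; congr ('X^(m _)).
  exact: val_inj.
have sP : (size P <= d.+1)%N.
  rewrite PE; apply: (leq_trans (size_sum _ _ _)).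
  apply/bigmax_leqP_seq => m /mE dm _; apply: (leq_trans (size_scale_leq _ _)).
  rewrite size_polyXn ltnS -dm mdegE big_ord_recl big_ord1.
  rewrite (_ : lift _ _ = ord_max) ?leq_addl //; exact: val_inj.
have Pd : P`_d = F.@[pt2 0 1].
  rewrite PE coef_sum /meval /mmap; apply: eq_big_seq => m /mE dm.
  rewrite coefZ coefXn /mmap1 big_ord_recl big_ord1 /pt2 /= expr1n mulr1; congr (_ * _).
  rewrite -dm mdegE big_ord_recl big_ord1 (_ : lift _ _ = ord_max); last exact: val_inj.
  by rewrite -[X in _ == X]add0n eqn_add2r expr0n.
have : size P = d.+1; last by move->.
apply/eqP; rewrite eqn_leq sP ltnNge; apply: contra nzF => /leq_sizeP/(_ d (leqnn _)).
by rewrite Pd => ->.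
Qed.

Lemma line_pt_neq0 x : nonzero_vec (line_pt x).
Proof. by case: x => [a|]; [exists ord0 | exists ord_max]; rewrite oner_neq0. Qed.

Lemma line_pt_on x : on_model rc line (line_pt x).
Proof. exact/line_on_model/line_pt_neq0. Qed.

(** At infinity numerator and denominator both have multiplicity d, with even sum 2 d. *)
Lemma unit_parity x v c : cspec rc line (line_pt x) v c -> c != 0 ->
  order_parity x v false.
Proof.
move=> [d [F [G [hF hG nzG -> cE]]]] nzc.
have nzF : F.@[line_pt x] != 0.
  by apply: contra_neq nzc; rewrite cE /meval => ->; rewrite mul0r.
have nzP (H : {mpoly k[2]}) : H \is d.-homog -> H.@[line_pt x] != 0 ->
    mmap polyC (fun i : 'I_2 => if i == ord0 then 1 else 'X) H != 0.
  move=> hH nzH; rewrite -tofrac_eq0 -line_polyE.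
  exact: (specializes_neq0 (line_pt_on x).2 hH nzH).
exists (mmap polyC (fun i : 'I_2 => if i == ord0 then 1 else 'X) F).
exists (mmap polyC (fun i : 'I_2 => if i == ord0 then 1 else 'X) G).
rewrite !nzP // -!line_polyE; split=> //.
by rewrite !(mult_form hF, mult_form hG) //; case: x {nzF nzP nzG cE}; rewrite ?addnn ?odd_double.
Qed.

Definition line_unif (x : option k) : ratfun k :=
  if x is Some a then u - rc a else u^-1.

Lemma line_unifP x a : local_max rc line (line_pt x) a <->
  exists2 b, local_ring rc line (line_pt x) b & a = line_unif x * b.
Proof.
have sp := (line_pt_on x).2; have nzu : u != 0 by rewrite tofrac_eq0 polyX_eq0.
case: x sp => [c|] sp.
  apply: (uniformizer sp (m := ord0)) => [||i].
  - by rewrite oner_neq0.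
  - have := @gspec_ratio _ _ _ rc idfun _ line (line_pt (Some c)) ord0 ord_max.
    by rewrite /= /line_generic !divr1; apply; rewrite oner_neq0.
  - rewrite /line_generic /= divr1; case: ifP => _; [exists 1|exists 'X].
      by rewrite rmorph1 hornerC.
    by rewrite map_polyX hornerX.
have -> : line_unif None = u^-1 - rc 0 by rewrite rmorph0 subr0.
apply: (uniformizer sp (m := ord_max)) => [||i].
- by rewrite oner_neq0.
- have := @gspec_ratio _ _ _ rc idfun _ line (line_pt None) ord_max ord0.
  by rewrite /= /line_generic /= mul0r mul1r; apply; rewrite oner_neq0.
- rewrite /line_generic /=; case: ifP => _; [exists 'X|exists 1].
    by rewrite map_polyX hornerX mul1r.
  by rewrite rmorph1 hornerC divff.
Qed.

Lemma line_unif_parity x : order_parity x (line_unif x) true.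
Proof.
case: x => [a|] /=.
  exists ('X - a%:P), 1; rewrite polyXsubC_eq0 oner_neq0 mult1 divr1 tofracB.
  by split=> //; rewrite /= -['X - _]expr1 mup_XsubCX eqxx.
exists 1, 'X; rewrite oner_neq0 polyX_eq0 mult1 mul1r; split=> //.
by rewrite /= size_polyX.
Qed.

(** Two generators of the maximal ideal differ by a unit, so every uniformizer has odd order in the
    sense of [order_parity]. *)
Lemma line_order_parity x r (l : int) :
  order_at rc line (line_pt x) r l -> order_parity x r (odd `|l|).
Proof.
have sp := (line_pt_on x).2.
move=> [tau [v [maxE nzv /local_ringP[c vc] /local_ringP[c' vc'] ->]]].
have nzc : c != 0.
  apply: contraTneq isT => c0.
  have := gspecM vc vc'; rewrite divff // c0 mul0r.
  by move=> /(gspec_fun sp (gspec1 _ _ _ _))/eqP; rewrite oner_eq0.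
have maxU y : (exists b, local_ring rc line (line_pt x) b /\ y = line_unif x * b) ->
    local_max rc line (line_pt x) y.
  by move=> [b [bO ->]]; apply/line_unifP; exists b.
have O1 : local_ring rc line (line_pt x) 1 by apply/local_ringP; exists 1; apply: gspec1.
have /maxE[b /local_ringP[d bd] uE] : local_max rc line (line_pt x) (line_unif x).
  by apply: maxU; exists 1; rewrite mulr1.
have /line_unifP[b' /local_ringP[d' bd'] tE] : local_max rc line (line_pt x) tau.
  by apply/maxE; exists 1; rewrite ?mulr1.
have nzu : line_unif x != 0.
  have [p [q [nzp nzq -> _]]] := line_unif_parity x.
  by rewrite mulf_neq0 ?invr_eq0 ?tofrac_eq0.
have b'b : b' * b = 1 by apply: (mulfI nzu); rewrite mulrA -tE -uE mulr1.
have nzd' : d' != 0.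
  apply: contraTneq isT => d0; have := gspecM bd' bd.
  by rewrite b'b d0 mul0r => /(gspec_fun sp (gspec1 _ _ _ _))/eqP; rewrite oner_eq0.
have tau_parity : order_parity x tau true.
  rewrite tE -[true]/(true (+) false).
  by apply: order_parityM; [apply: line_unif_parity | apply: unit_parity bd' nzd'].
have := order_parityM (unit_parity vc nzc) (order_parityXz l tau_parity).
by rewrite andbT.
Qed.

End Parity.

(** Modulo 2 only the elements that occur an odd number of times count, and these all belong to
    A. *)
Lemma odd_size_sum (T : eqType) (A s : seq T) : uniq A ->
    (forall a, a \notin A -> ~~ odd (count_mem a s)) ->
  odd (size s) = odd (\sum_(a <- A) count_mem a s).
Proof.
elim: A s => [|a A IHA] s.
  rewrite big_nil => _; have [l] := ubnP (size s).
  elim: l s => // l IHl [//|b s] szs even.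
  rewrite -(count_predC (pred1 b)) oddD (negbTE (even b _)) //=.
  rewrite eqxx /= add0n -size_filter IHl //.
    rewrite size_filter; apply: leq_ltn_trans (count_size _ _) _.
    by move: szs; rewrite /= ltnS.
  move=> c _; rewrite count_filter.
  have [->|nbc] := eqVneq c b.
    by rewrite (@eq_count _ _ pred0) ?count_pred0 // => x /=; case: eqP.
  have := even c isT; rewrite /= eq_sym (negbTE nbc) add0n.
  rewrite (@eq_count _ (predI _ _) (pred1 c)) // => x /=.
  by case: eqP => // ->; rewrite nbc.
move=> /= /andP[aA uA] even; rewrite big_cons -(count_predC (pred1 a) s).
rewrite !oddD; congr (_ (+) _); rewrite -size_filter IHA //.
  congr odd; apply: eq_big_seq => b bA; rewrite count_filter; apply: eq_count => x /=.
  by case: eqP => // ->; apply: contraNneq aA => <-.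
move=> b bA; rewrite count_filter.
have [->|nab] := eqVneq b a.
  by rewrite (@eq_count _ _ pred0) ?count_pred0 // => x /=; case: eqP.
have : b \notin a :: A by rewrite inE negb_or nab.
move=> /even; congr (~~ odd _); apply: eq_count => x /=.
by case: eqP => // ->; rewrite nab.
Qed.

Lemma odd_absz_sum (r : nat) (m : 'I_r -> int) :
  odd `|\sum_i m i| = odd (\sum_i odd `|m i|).
Proof.
apply: (big_rec2 (fun a b => odd `|a| = odd b)) => // i a b _ ab.
rewrite oddD -ab oddb; lia.
Qed.

Section Degree.
Variable k : closedFieldType.
Local Notation rc := (ratfun_const k).
Local Notation line := (line_generic k).
Local Notation tf := (@FracField.tofrac {poly k}).

(** The finite multiplicities of P add up to its degree, and infinity contributes the degree once
    more. The points left out of [xs] contribute even numbers. *)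
Lemma poly_mult_even (P : {poly k}) (xs : seq (option k)) : P != 0 -> uniq xs ->
    (forall x, x \notin xs -> ~~ odd (mult x P)) ->
  ~~ odd (\sum_(x <- xs) mult x P).
Proof.
have [s PE] := closed_field_poly_normal P; move=> nzP uxs even.
have nzl : lead_coef P != 0 by rewrite lead_coef_eq0.
have multE x : mult x P = if x is Some a then count_mem a s else size s.
  case: x => [a|] /=.
    rewrite {1}PE -mul_polyC mupMr; last by rewrite /root hornerC.
    exact: mu_prod_XsubC.
  by rewrite {1}PE size_scale // size_prod_XsubC.
have -> : (\sum_(x <- xs) mult x P = (None \in xs) * size s
    + \sum_(a <- pmap id xs) count_mem a s)%N.
  elim: xs uxs {even} => [|x xs IHxs] /=; first by rewrite !big_nil.
  move=> /andP[xxs uxs]; rewrite big_cons IHxs // multE in_cons.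
  case: x xxs => [a|] /= nxs; first by rewrite big_cons addnCA.
  by rewrite (negbTE nxs) add0n mul1n.
have ua : uniq (pmap id xs) by apply: (@pmap_uniq _ _ id Some); first by case.
have mem_a a : (a \in pmap id xs) = (Some a \in xs).
  by rewrite mem_pmap map_id.
have oddS := odd_size_sum ua.
rewrite oddD -oddS; last by move=> a; rewrite mem_a => /even; rewrite multE.
case: (boolP (None \in xs)) => [_|/even]; first by rewrite mul1n addbb.
by rewrite multE mul0n.
Qed.

Variables (n : nat) (e : 'I_n -> ratfun k).
Hypothesis iso_e : isomorphic_models rc e line.

Let Rel w x := on_curve e w /\ same_local_ring rc e w line (line_pt x).

Let rel_exists w : on_curve e w -> exists x, Rel w x.
Proof.
move=> ow; have [p [[i nzi] op] same] := iso_e.1 w ow.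
suff [x px] : exists x, proj_eq p (line_pt x).
  exists x; split=> // a; rewrite same !local_ringP.
  by split=> -[c ac]; exists c; [apply: (cspec_projZ (proj_eq_sym px)) | apply: (cspec_projZ px)].
have [p0|nzp0] := eqVneq (p ord0) 0.
  exists None; exists (p ord_max).
    case: i nzi => -[|[|//]] Hi; last by congr (p _ != 0); apply: val_inj.
    by rewrite (_ : Ordinal Hi = ord0) ?p0 ?eqxx //; apply: val_inj.
  case=> -[|[|//]] Hl; rewrite /= /pt2 /= ?mulr0 ?mulr1.
    by rewrite -p0; congr (p _); apply: val_inj.
  by congr (p _); apply: val_inj.
exists (Some (p ord_max / p ord0)), (p ord0) => //.
case=> -[|[|//]] Hl; rewrite /= /pt2 /= ?mulr1; first by congr (p _); apply: val_inj.
by rewrite mulrC divfK //; congr (p _); apply: val_inj.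
Qed.

Let rel_exists' x : exists w, Rel w x.
Proof. by have [w ow same] := iso_e.2 _ (line_pt_on x); exists w. Qed.

Let rel_inj w w' x : Rel w x -> Rel w' x -> proj_eq w w'.
Proof.
move=> [ow same] [ow' same']; apply: (same_local_ring_proj ow ow') => a.
by rewrite same same'.
Qed.

Let rel_fun w x x' : Rel w x -> Rel w x' -> x = x'.
Proof.
move=> [_ same] [_ same'].
have [c nzc] : proj_eq (line_pt x) (line_pt x').
  by apply: (same_local_ring_proj (line_pt_on x) (line_pt_on x')) => a; rewrite -same same'.
case: x x' {same same'} => [a|] [b|] // px; have := (px ord0, px ord_max);
  rewrite /= /pt2 /= !(mulr1, mulr0) => -[e1 e2].
- by rewrite e2 -e1 mul1r.
- by move/eqP: e1; rewrite oner_eq0.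
- by move/eqP: nzc; rewrite -e1.
Qed.

Let order_transfer w x r (l : int) : Rel w x -> order_at rc e w r l ->
  order_at rc line (line_pt x) r l.
Proof.
move=> [ow same] [tau [v' [maxE nzv' vO v'O rE]]].
have := line_pt_on x => -[_ spx]; have [_ spw] := ow.
exists tau, v'; split=> //; try exact/same.
move=> a; rewrite -(same_local_max spw spx same) maxE.
by split=> -[b bO ->]; exists b => //; apply/same.
Qed.

Lemma order_at_neq0 w r (l : int) : on_curve e w -> order_at rc e w r l -> r != 0.
Proof.
move=> ow ord_l; have [x wx] := rel_exists ow.
have [p [q [nzp nzq -> _]]] := line_order_parity (order_transfer wx ord_l).
by rewrite mulf_neq0 ?invr_eq0 ?tofrac_eq0.
Qed.

Variables (r0 : ratfun k) (mu : ('I_n -> k) -> int -> Prop).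
Hypothesis nz_r0 : r0 != 0.
Hypothesis muP : forall w l, on_curve e w -> mu w l -> exists v c s,
  [/\ cspec rc e w v c, c != 0, s != 0 & order_at rc e w (v * s ^+ 2 * r0) l].

(** Units have order 0 and squares have even order, so the parity is that of r0. *)
Let mu_parity w x l : Rel w x -> mu w l -> order_parity x r0 (odd `|l|).
Proof.
move=> wx; have [ow same] := wx => /(muP ow)[v [c [s [vc nzc nzs ord_l]]]].
have := line_pt_on x => -[_ spx]; have [_ spw] := ow.
have [c' nzc' vc'] : exists2 c', c' != 0 & cspec rc line (line_pt x) v c'.
  have /same/local_ringP[c' vc'] : local_ring rc e w v by apply/local_ringP; exists c.
  have /same/local_ringP[d vd] : local_ring rc e w v^-1.
    by apply/local_ringP; exists c^-1; apply: gspecV.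
  exists c' => //; apply: contraTneq isT => c0.
  have := gspecM vc' vd; rewrite divff ?(gspec_neq0 spw nzc vc) // c0 mul0r.
  by move=> /(gspec_fun spx (gspec1 _ _ _ _))/eqP; rewrite oner_eq0.
have [b r0b] := order_parity_exists x nz_r0.
have par := order_parityM (order_parityM (unit_parity vc' nzc') (order_parity_sqr x nzs)) r0b.
by rewrite -(order_parity_fun par (line_order_parity (order_transfer wx ord_l))).
Qed.

(* Modulo 2 the cycle is the divisor of r0, which has degree 0. *)
Lemma rational_curve_even N : cycle_degree (on_curve e) mu N -> ~~ odd `|N|.
Proof.
move=> [r [p [m [pm pinj cover ->]]]].
have /fin_all_exists[x xP] i : exists x, Rel (p i) x.
  by apply: rel_exists; have [] := pm i.
have par i : order_parity (x i) r0 (odd `|m i|).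
  by apply: (mu_parity (xP i)); have [] := pm i.
have [P [Q [nzP nzQ r0E]]] : exists P Q : {poly k}, [/\ P != 0, Q != 0 & r0 = tf P / tf Q].
  have [b [P [Q [nzP nzQ r0E _]]]] := order_parity_exists None nz_r0.
  by exists P, Q.
have parE y b : order_parity y r0 b -> b = odd (mult y (P * Q)).
  move=> yb; apply: (order_parity_fun yb).
  by exists P, Q; split=> //; rewrite multM.
have x_inj : injective x.
  by move=> i l xE; apply/pinj/(rel_inj (xP i)); rewrite xE.
rewrite odd_absz_sum.
have -> : odd (\sum_i odd `|m i|) = odd (\sum_(y <- codom x) mult y (P * Q)).
  rewrite big_image /=.
  apply: (big_rec2 (fun a b => odd a = odd b)) => // i a b _ ab.
  by rewrite !oddD ab (parE _ _ (par i)) oddb.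
apply: poly_mult_even => [||y ny]; first by rewrite mulf_neq0.
  by rewrite map_inj_uniq ?enum_uniq.
(* At a point outside the cycle the order 0 is a value of [mu], so r0 has even order there. *)
have [w wy] := rel_exists' y.
case: (cover w wy.1) => [[i wp]|mu0]; last by rewrite -(parE _ _ (mu_parity wy mu0)).
case/negP: ny; apply/codomP; exists i; apply: (rel_fun wy).
have [opi same] := xP i; split=> [|a]; first by have [] := wy.
rewrite -same !local_ringP.
by split=> -[c ac]; exists c; [apply: (cspec_projZ (proj_eq_sym wp)) | apply: (cspec_projZ wp)].
Qed.

End Degree.

Lemma homogenize_line (K : fieldType) (a b c d : K) : c != 0 ->
  a * c + b * d = c * (a + b * (d / c)).
Proof. by move=> nzc; field. Qed.

(** * Containment of curves *)

Section CurveIdeals.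
Variable k : closedFieldType.
Local Notation rc := (ratfun_const k).
Local Notation tf := (@FracField.tofrac {poly k}).
Local Notation u := (tf 'X : ratfun k).
Variable n : nat.
Implicit Types (e : 'I_n -> ratfun k) (F : {mpoly k[n]}).

Lemma common_denominator e : exists q (P : 'I_n -> {poly k}),
  q != 0 /\ forall i, tf q * e i = tf (P i).
Proof.
suff [q nzq qP] : exists2 q, q != 0 & forall i, i \in enum 'I_n -> exists P, tf q * e i = tf P.
  have /fin_all_exists[P PE] i : exists P, tf q * e i = tf P by apply: qP; rewrite mem_enum.
  by exists q, P.
elim: (enum 'I_n) => [|j s [q nzq qP]]; first by exists 1; rewrite ?oner_neq0.
have [a [b [nzb ejE]]] := fractionP (e j).
exists (q * b) => [|i]; first by rewrite mulf_neq0.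
rewrite inE => /predU1P[->|/qP[P PE]].
  exists (q * a); rewrite ejE !tofracM -mulrA; congr (_ * _).
  by rewrite mulrC divfK // tofrac_eq0.
by exists (P * b); rewrite !tofracM mulrAC PE.
Qed.

(** After clearing denominators the coordinates are polynomials in u, which can be evaluated at an s
    where neither F nor a chosen coordinate vanishes. *)
Lemma nonvanishing_point e d F : nonzero_vec e -> F \is d.-homog ->
  ~ hvanish rc e F -> exists2 w, on_curve e w & F.@[w] != 0.
Proof.
move=> [l nzel] hF nzF.
have [q [P [nzq PE]]] := common_denominator e.
have nzfq : tf q != 0 by rewrite tofrac_eq0.
have formE d' G : G \is d'.-homog -> tf q ^+ d' * mmap rc e G = tf (mmap polyC P G).
  move=> hG; rewrite -(mmap_homogZ _ _ _ hG); by apply: rmorph_mmap.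
have evalE s G : (mmap polyC P G).[s] = G.@[fun i => (P i).[s]].
  rewrite -[LHS]/(horner_eval s _); apply/esym; apply: rmorph_mmap => // c.
  by rewrite /= horner_evalE hornerC.
have : mmap polyC P F * P l != 0.
  apply: mulf_neq0.
    rewrite -tofrac_eq0 -(formE _ _ hF); apply: mulf_neq0; last exact/eqP.
    exact: expf_neq0.
  by have := mulf_neq0 nzfq nzel; rewrite PE tofrac_eq0.
move=> /closed_nonrootP[s]; rewrite /root hornerM mulf_eq0 negb_or evalE.
move=> /andP[nzFw nzl]; exists (fun i => (P i).[s]) => //; split; first by exists l.
move=> d' G hG G0; rewrite -evalE.
have := formE _ _ hG; rewrite G0 mulr0 => /esym/eqP.
by rewrite tofrac_eq0 => /eqP ->; rewrite horner0.
Qed.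

(** Otherwise choose for each o a form that vanishes on E o and not on e. Their product does not
    vanish on e, since K is a field, yet it vanishes at every closed point of e. *)
Lemma curve_in_union (O : finType) (E : O -> 'I_n -> ratfun k) e :
    nonzero_vec e ->
    (forall w, on_curve e w -> exists o, on_curve (E o) w) ->
  exists o, forall d F, F \is d.-homog -> hvanish rc (E o) F -> hvanish rc e F.
Proof.
move=> nze cover; apply: NNPP => none.
have /fin_all_exists[F FP] o : exists F : {mpoly k[n]},
    [/\ exists d, F \is d.-homog, hvanish rc (E o) F & ~ hvanish rc e F].
  apply: NNPP => noF; apply: none; exists o => d F hF EF; apply: NNPP => eF.
  by apply: noF; exists F; split=> //; exists d.
have [d hF] : exists d, \prod_o F o \is d.-homog.
  apply: (big_ind (fun G => exists d, G \is d.-homog)).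
  - by exists 0; apply: dhomog1.
  - by move=> G H [d hG] [d' hH]; exists (d + d')%N; apply: dhomogM.
  - by move=> o _; have [] := FP o.
have [|w ew] := nonvanishing_point nze hF.
  rewrite /hvanish rmorph_prod /= => /eqP/prodf_eq0[o _ /eqP eo].
  by have [_ _ []] := FP o.
have [o [_ ow]] := cover w ew; rewrite rmorph_prod (bigD1 o) //=.
by have [[d' hFo] EF _] := FP o; rewrite (ow _ _ hFo EF) mul0r eqxx.
Qed.

Variables (la mu : 'I_n -> k) (na nb : 'I_n).
Hypotheses (la_na : la na = 1) (mu_na : mu na = 0).
Hypotheses (la_nb : la nb = 0) (mu_nb : mu nb = 1).

Lemma constant_not_model e t (w : 'I_n -> k) :
  (forall i, e i = t * rc (w i)) -> ~ projective_model rc e.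
Proof.
move=> eE [[i nzei] gen]; have [d [F [G [hF hG nzG uE]]]] := gen u.
have form H : H \is d.-homog -> mmap rc e H = t ^+ d * rc (H.@[w]).
  move=> hH; rewrite (eq_mmap _ _ eE) (mmap_homogZ _ _ _ hH); congr (_ * _).
  exact: rmorph_mmap.
have nzt : t != 0 by apply: contra_neq nzei; rewrite eE => ->; rewrite mul0r.
have : u = rc (F.@[w] / G.@[w]).
  rewrite uE (form _ hF) (form _ hG) -mulf_div divff ?expf_neq0 // mul1r.
  by rewrite fmorph_div.
move/eqP; rewrite tofrac_eq => /eqP/(congr1 (fun p : {poly k} => size p)).
by rewrite size_polyX size_polyC; case: (_ == 0).
Qed.

(** A form vanishing on e but not on the line would make the parameter e_nb / e_na algebraic over k,
    hence constant, and e would be a single point. *)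
Lemma lin_ideal_eq e : projective_model rc e ->
    (forall d F, F \is d.-homog -> hvanish rc (lin la mu) F -> hvanish rc e F) ->
  forall d F, F \is d.-homog -> hvanish rc e F -> hvanish rc (lin la mu) F.
Proof.
move=> model sub d F hF eF; apply: NNPP => nzF.
have eE i : e i = rc (la i) * e na + rc (mu i) * e nb.
  pose G : {mpoly k[n]} := 'X_i - la i *: 'X_na - mu i *: 'X_nb.
  have hG : G \is 1.-homog by rewrite !rpredB ?rpredZ ?dhomogXU.
  have GE h : mmap rc h G = h i - rc (la i) * h na - rc (mu i) * h nb.
    by rewrite !rmorphB /= !mmapZ !mmapXU.
  have := sub _ G hG; rewrite /hvanish !GE (lin_na la_na mu_na) (lin_nb la_nb mu_nb) => eE0.
  apply/eqP; rewrite -subr_eq0 opprD addrA; apply/eqP/eE0.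
  by rewrite /lin mulr1 [_ + _ * u]addrC addrK subrr.
have [ea0|nzea] := eqVneq (e na) 0.
  apply: (@constant_not_model e (e nb) mu) model => i.
  by rewrite eE ea0 mulr0 add0r mulrC.
pose P := mmap polyC (fun i => (la i)%:P + (mu i)%:P * 'X) F.
have PE r : mmap rc (fun i => rc (la i) + rc (mu i) * r) F = (map_poly rc P).[r].
  rewrite -[RHS]/(horner_eval r (map_poly rc P)).
  apply: (rmorph_mmap (h := horner_eval r \o map_poly rc)) => [c|i] /=.
    by rewrite /horner_eval map_polyC hornerC.
  by rewrite /horner_eval rmorphD rmorphM /= map_polyX !map_polyC !hornerE.
have nzP : P != 0.
  by apply: contra_not_neq nzF => P0; rewrite /hvanish PE P0 rmorph0 horner0.
have [c cE] : exists c, e nb / e na = rc c.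
  apply: (ratfun_algebraic nzP); rewrite -PE.
  apply/eqP; rewrite -(mulrI_eq0 _ (mulfI (expf_neq0 d nzea))) -(mmap_homogZ _ _ _ hF).
  rewrite (eq_mmap _ (w := e)); first by apply/eqP.
  by move=> i; rewrite [RHS]eE homogenize_line.
apply: (@constant_not_model e (e na) (fun i => la i + mu i * c)) model => i.
by rewrite rmorphD rmorphM -cE [LHS]eE homogenize_line.
Qed.

End CurveIdeals.

(** * The resolution and its exceptional curves *)

Lemma quad_M_perm (k A : comNzRingType) (m : 'I_3 -> k) (f : {rmorphism k -> A})
    (y : 'I_3 -> A) i j l : uniq [:: i; j; l] ->
  quad_M m f y = f (m i) * (y j * y l) + f (m j) * (y i * y l) + f (m l) * (y i * y j).
Proof.
by elim/ord3_ind: i; elim/ord3_ind: j; elim/ord3_ind: l => //= _; rewrite /quad_M; ring.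
Qed.

Lemma sum3_perm (A : comNzRingType) (y : 'I_3 -> A) i j l : uniq [:: i; j; l] ->
  y o0 + y o1 + y o2 = y i + y j + y l.
Proof.
by elim/ord3_ind: i; elim/ord3_ind: j; elim/ord3_ind: l => //= _; ring.
Qed.

Lemma prod3_perm (A : comNzRingType) (y : 'I_3 -> A) i j l : uniq [:: i; j; l] ->
  y o0 * y o1 * y o2 = y i * y j * y l.
Proof.
by elim/ord3_ind: i; elim/ord3_ind: j; elim/ord3_ind: l => //= _; ring.
Qed.

Lemma ord3_perm_ind (P : 'I_3 -> Prop) i j l : uniq [:: i; j; l] ->
  P i -> P j -> P l -> forall x, P x.
Proof.
by elim/ord3_ind: i; elim/ord3_ind: j; elim/ord3_ind: l => //= _ *; apply: ord3_ind.
Qed.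

(** The three components index the three factors of the map; [None] is the entry 1 in the first and
    the entry W in the third. *)
Definition res_index : finType := (option 'I_3 * 'I_3 * option 'I_3)%type.
Local Notation I := res_index.
Local Notation N := #|{: I}|.

Section Forms.
Variables (k : comNzRingType) (m : 'I_3 -> k).

(* Segre product of the three maps (1 : Y), (Y) and (W : Y_i ^ 2) *)
Definition res_form (A : comNzRingType) (f : {rmorphism k -> A}) (y : 'I_3 -> A)
    (t : I) : A :=
  let: (a, j, b) := t in
  (if a is Some i then y i else 1) * y j *
  (if b is Some i then y i ^+ 2 else quad_W (fun=> 1) m f 1 y).

Lemma rmorph_res_form (A B : comNzRingType) (f : {rmorphism k -> A})
    (f' : {rmorphism k -> B}) (h : {rmorphism A -> B}) y y' t :
    (forall c, f' c = h (f c)) -> (forall i, y' i = h (y i)) ->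
  res_form f' y' t = h (res_form f y t).
Proof.
move=> fE yE; case: t => [[a j] b]; rewrite /res_form !rmorphM yE /=.
congr (_ * _ * _); first by case: a => [i|]; rewrite ?rmorph1.
case: b => [i|]; first by rewrite yE rmorphXn.
by rewrite /quad_W /quad_M !fE !yE !(rmorphD, rmorphM) !rmorph1.
Qed.

End Forms.

Section Curves.
Variables (A : comNzRingType) (a b : A).

(** In characteristic 2 this parametrizes the line Y_1 + Y_2 + Y_3 = 0, the image of the central
    curve in the second factor. *)
Definition line_coord (j : 'I_3) : A :=
  if j == o0 then b else if j == o1 then a else a + b.

(* Points (a : b) of the exceptional curves; None stands for the central one. *)
Definition curve_pt (o : option 'I_3) (t : I) : A :=
  let: (x, j, y) := t in
  if x is Some _ then 0 else
  match o, y with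
  | None, None => line_coord j
  | None, Some _ => 0
  | Some i, None => if j == i then 0 else a
  | Some i, Some l => if (j == i) || (l == i) then 0 else b
  end.

End Curves.

Lemma curve_pt_lin (A : comNzRingType) (a b : A) o t :
  curve_pt a b o t = a * curve_pt 1 0 o t + b * curve_pt 0 1 o t.
Proof.
case: t => [[[x|] j] y] /=; first by rewrite !mulr0 addr0.
case: o y => [i|] [l|]; rewrite /line_coord; repeat case: ifP => _; ring.
Qed.

Lemma rmorph_curve_pt (A B : comNzRingType) (h : {rmorphism A -> B}) a b o t :
  curve_pt (h a) (h b) o t = h (curve_pt a b o t).
Proof.
case: t => [[[x|] j] y] /=; first by rewrite rmorph0.
by case: o y => [i|] [l|]; rewrite /line_coord; repeat case: ifP => _;
  rewrite ?rmorph0 ?rmorphD.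
Qed.

Definition nxt (i : 'I_3) : 'I_3 := if i == o1 then o0 else o1.

Lemma nxt_neq i : nxt i != i.
Proof. by elim/ord3_ind: i. Qed.

(** Coordinates at which a point (a : b) of the curve shows a, respectively b. They serve as [na]
    and [nb] for the exceptional lines. *)
Definition base_a (o : option 'I_3) : I := (None, if o is Some i then nxt i else o1, None).
Definition base_b (o : option 'I_3) : I :=
  if o is Some i then (None, nxt i, Some (nxt i)) else (None, o0, None).

Lemma curve_pt_a (A : comNzRingType) (a b : A) o : curve_pt a b o (base_a o) = a.
Proof. by case: o => [i|] //=; rewrite (negbTE (nxt_neq i)). Qed.

Lemma curve_pt_b (A : comNzRingType) (a b : A) o : curve_pt a b o (base_b o) = b.
Proof. by case: o => [i|] //=; rewrite (negbTE (nxt_neq i)). Qed.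

(* Approximate arcs of the surface W^2 = e Y_1 Y_2 Y_3 through the vertex; the
   exceptional curves will be limits of such arcs. *)
Section Arcs.
Variables (k A : comNzRingType) (m : 'I_3 -> k) (e : k) (f : {rmorphism k -> A}).
Variables (i j l : 'I_3) (h v : A).
Hypothesis ijl : uniq [:: i; j; l].

Definition chart_mu (v t : A) := f (m i) * t + f (m l) * v + f (m j) * (v * t).
(** The relation between the ratios v = v_i and t = v_l, written as an expression to be
    annihilated. *)
Definition chart_eq (t : A) := v + 1 + t - f e * h * v * t * (1 - h * chart_mu v t).

(* Newton iteration for the root of chart_eq near t = - 1 - v. *)
Lemma chart_arc n : exists t r s,
  chart_eq t = (h * v) ^+ n * r /\ t = - 1 - v + h * v * s.
Proof.
elim: n => [|n [t [r [s [tE sE]]]]].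
  by exists (- 1 - v), (chart_eq (- 1 - v)), 0; rewrite mul1r mulr0 addr0.
(* Modulo h v the derivative of [chart_eq] in t is 1, so a Newton step is a plain subtraction, and
   it gains a factor h v. *)
exists (t - chart_eq t).
exists (f e * r * (1 - h * ((f (m i) + f (m j) * v) * (t *+ 2 - chart_eq t) + f (m l) * v))).
exists (f e * t * (1 - h * chart_mu v t)); split.
  have -> : chart_eq (t - chart_eq t) = f e * h * v * chart_eq t *
    (1 - h * ((f (m i) + f (m j) * v) * (t *+ 2 - chart_eq t) + f (m l) * v)).
    (* [r'] stays opaque for [ring]; its definition enters only once, through a 0 that is rewritten
       as a difference of [r'] and its value. *)
    set r' := chart_eq t; have : r' = chart_eq t by [].
    rewrite /chart_eq /chart_mu => rE; rewrite -[X in X - _ = _]subr0.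
    rewrite -{1}(subrr r') {2}rE; ring.
  by rewrite {1}tE exprS; ring.
by rewrite /chart_eq; ring.
Qed.

Variable t : A.
(** The value that Y_j = e h^2 v_i v_l prescribes for Y_j. *)
Let z := f e * h ^+ 2 * v * t.

Definition arc_dir (x : 'I_3) : A := if x == j then 1 else if x == i then v else t.
Definition arc_pt (x : 'I_3) : A := z * arc_dir x.

Lemma arc_dir_i : arc_dir i = v.
Proof.
move: ijl; rewrite /arc_dir /= inE negb_or => /andP[/andP[/negbTE -> _] _].
by rewrite eqxx.
Qed.

Lemma arc_dir_j : arc_dir j = 1.
Proof. by rewrite /arc_dir eqxx. Qed.

Lemma arc_dir_l : arc_dir l = t.
Proof.
move: ijl; rewrite /arc_dir /= !inE negb_or ![_ == l]eq_sym.
by move=> /and3P[/andP[_ /negbTE ->] /negbTE -> _].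
Qed.

Lemma arc_W : quad_W (fun=> 1) m f 1 arc_pt = z * (chart_eq t + f e * h * v * t).
Proof.
rewrite /quad_W rmorph1 !mul1r (sum3_perm _ ijl) (quad_M_perm _ _ _ ijl).
rewrite /arc_pt arc_dir_i arc_dir_j arc_dir_l /chart_eq /chart_mu /z.
by ring.
Qed.

(** The failure of the arc to lie on the surface is a multiple of [chart_eq t], which [chart_arc]
    makes as small as desired. *)
Lemma arc_quartic : quartic (fun=> 1) m e f 1 arc_pt =
  chart_eq t * (z ^+ 2 * (chart_eq t + (f e * h * v * t) *+ 2)).
Proof.
rewrite /quartic arc_W (prod3_perm _ ijl) /arc_pt arc_dir_i arc_dir_j arc_dir_l.
by rewrite /z; ring.
Qed.

(** The coordinates of the lifted arc without their common factor e^2 t^2 h^5 v^3, when [chart_eq t]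
    is h v r; they have a nonzero limit. *)
Definition arc_coord (r : A) (x : I) : A :=
  let: (a, p, b) := x in
  (if a is Some q then arc_pt q else 1) * arc_dir p *
  (if b is Some q then f e * t * h * arc_dir q ^+ 2 else r + f e * t).

Lemma arc_res_form r x : chart_eq t = h * v * r ->
  res_form m f arc_pt x = f e ^+ 2 * t ^+ 2 * h ^+ 5 * v ^+ 3 * arc_coord r x.
Proof.
case: x => [[a p] b] rE; rewrite /res_form /arc_coord arc_W rE.
by case: a b => [q|] [q'|]; rewrite /arc_pt /z; ring.
Qed.

End Arcs.

Definition third (i : 'I_3) : 'I_3 := if i == o2 then o0 else o2.

Lemma uniq_third i : uniq [:: i; nxt i; third i].
Proof. by elim/ord3_ind: i. Qed.

Lemma rmorph_arc_coord (k A B : comNzRingType) (m : 'I_3 -> k) e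
    (f : {rmorphism k -> A}) (f' : {rmorphism k -> B}) (phi : {rmorphism A -> B})
    i j h v t r x : (forall c, f' c = phi (f c)) ->
  phi (arc_coord e f i j h v t r x) = arc_coord e f' i j (phi h) (phi v) (phi t) (phi r) x.
Proof.
move=> fE; have dirE q : phi (arc_dir i j v t q) = arc_dir i j (phi v) (phi t) q.
  by rewrite /arc_dir; repeat case: ifP => _; rewrite ?rmorph1.
case: x => [[a p] b]; rewrite /arc_coord /arc_pt !rmorphM dirE fE.
congr (_ * _ * _).
  by case: a => [q|]; rewrite ?rmorph1 // !(rmorphXn, rmorphM) dirE ?fE.
by case: b => [q|]; rewrite ?rmorphD !(rmorphXn, rmorphM) ?dirE ?fE.
Qed.

Lemma horner0_cancelX (F : fieldType) (p q r : {poly F}) a :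
  p * 'X^a * r = q * 'X^(a.+1) -> p.[0] != 0 -> r.[0] = 0.
Proof.
move=> eq_pqr nzp.
have : p * r = q * 'X.
  apply: (@mulfI _ ('X^a : {poly F})); first by rewrite -size_poly_eq0 size_polyXn.
  by rewrite mulrA [_ * p]mulrC eq_pqr exprS; ring.
move/(congr1 (horner^~ 0)); rewrite /= !hornerE => /eqP.
by rewrite mulf_eq0 (negbTE nzp) => /eqP.
Qed.

Section ArcLimits.
Variables (k : comNzRingType) (R : fieldType) (f : {rmorphism k -> R}) (e : k) (u : R).
Hypothesis opprE : forall x : R, - x = x.

(** As v tends to 0 with h = u fixed, the lifted arcs tend to the generic point of an arm; as h
    tends to 0 with v = u fixed, to that of the central curve. *)
Lemma arc_limit_side i x : arc_coord e f i (nxt i) u 0 (- 1 - 0) 0 x =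
  f e * (- 1 - 0) * curve_pt 1 u (Some i) x.
Proof.
rewrite opprE subr0; case: x => [[[q|] p] b]; rewrite /arc_coord /arc_pt.
  by rewrite /= !(mulr0, mul0r).
elim/ord3_ind: i; elim/ord3_ind: p; case: b => [b|];
  rewrite /arc_dir /curve_pt /=; try elim/ord3_ind: b; rewrite /=; ring.
Qed.

Lemma arc_limit_central x : arc_coord e f o0 o1 0 u (- 1 - u) 0 x =
  f e * (- 1 - u) * curve_pt 1 u None x.
Proof.
rewrite -opprD opprE; case: x => [[[q|] p] b]; rewrite /arc_coord /arc_pt.
  by rewrite /= expr0n /= !(mulr0, mul0r).
elim/ord3_ind: p; case: b => [b|]; rewrite /arc_dir /curve_pt /line_coord /=; ring.
Qed.

End ArcLimits.

Section Resolution.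
Variables (k : closedFieldType) (m : 'I_3 -> k) (e : k).
Variables (K : fieldType) (iota : {rmorphism k -> K}) (Y : 'I_3 -> K).
Local Notation rc := (ratfun_const k).
Local Notation u := (FracField.tofrac ('X : {poly k}) : ratfun k).

Definition res_generic (n : 'I_N) : K := res_form m iota Y (enum_val n).
Definition exc_la (o : option 'I_3) (n : 'I_N) : k := curve_pt 1 0 o (enum_val n).
Definition exc_mu (o : option 'I_3) (n : 'I_N) : k := curve_pt 0 1 o (enum_val n).
Definition exc (o : option 'I_3) : 'I_N -> ratfun k := lin (exc_la o) (exc_mu o).

Lemma excE o n : exc o n = curve_pt 1 u o (enum_val n).
Proof.
rewrite /exc /lin /exc_la /exc_mu -!rmorph_curve_pt rmorph0 rmorph1.
by rewrite [RHS]curve_pt_lin mul1r [u * _]mulrC.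
Qed.

Hypothesis char2 : 2 \in [pchar k].
Hypothesis nz_e : e != 0.
(** The ideal of Y is generated by the quartic. This is stated through values in arbitrary algebras,
    the form in which it is applied to arcs. *)
Hypothesis dvd_quartic : forall P : {mpoly k[3]}, mmap iota Y P = 0 ->
  forall (A : comNzRingType) (f : {rmorphism k -> A}) z,
  exists b, mmap f z P = b * quartic (fun=> 1) m e f 1 z.

Section OneArc.
Variables (o : option 'I_3) (i j l : 'I_3) (h v : {poly (ratfun k)}) (b a : nat).
Variable c : {poly (ratfun k)}.
Hypothesis ijl : uniq [:: i; j; l].
Hypothesis hvE : h ^+ 5 * v ^+ 3 = c * 'X^b.
Hypothesis hvX : exists c', h * v = 'X * c'.
Hypothesis c0 : c.[0] != 0.
Hypothesis v1 : - 1 - v.[0] != 0.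
Hypothesis limit : forall t x, t = - 1 - v.[0] ->
  arc_coord e rc i j h.[0] v.[0] t 0 x = rc e * t * curve_pt 1 u o x.

(* A form F vanishing on the resolution vanishes along the arcs to an order which
   exceeds that of the common factor of their coordinates. *)
Lemma exc_limit d (F : {mpoly k[N]}) : F \is d.-homog ->
  hvanish iota res_generic F -> hvanish rc (exc o) F.
Proof.
move=> hF gF; pose f : {rmorphism k -> {poly (ratfun k)}} := polyC \o rc.
(* The d-th power of the common factor has order b d in X. After one factor h v is split off, the
   order b d + 1 remains, which exceeds b d and makes [r'] vanish at X = 0 even if b d = 0. *)
have [t [r [s [tE sE]]]] := chart_arc m e f i j l h v (b * d).+2.
have [c' hvX'] := hvX.
pose r' := (h * v) ^+ (b * d).+1 * r.
have rE : chart_eq m e f i j l h v t = h * v * r' by rewrite tE exprS; rewrite /r'; ring.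
pose P := mmap (@mpolyC 3 k) (fun n => res_form m (@mpolyC 3 k) (fun q => 'X_q) (enum_val n)) F.
have evalP (A : comNzRingType) (f' : {rmorphism k -> A}) z :
    mmap f' z P = mmap f' (fun n => res_form m f' z (enum_val n)) F.
  apply/esym; apply: rmorph_mmap => [x|n] /=; first by rewrite mmapC.
  by apply: rmorph_res_form => [x|q] /=; rewrite ?mmapC ?mmapXU.
have [|B] := dvd_quartic (P := P) _ f (arc_pt e f i j h v t); first by rewrite evalP.
rewrite evalP (@arc_quartic _ _ m e f i j l h v ijl t) rE.
rewrite (eq_mmap _ (w := fun n => f e ^+ 2 * t ^+ 2 * h ^+ 5 * v ^+ 3
    * arc_coord e f i j h v t r' (enum_val n))); last first.
  by move=> n; exact: (@arc_res_form _ _ m e f i j l h v ijl t).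
rewrite (mmap_homogZ _ _ _ hF) => FE.
have t0 : t.[0] = - 1 - v.[0].
  by rewrite sE hvX' !hornerE.
have r'0 : r'.[0] = 0 by rewrite /r' exprS hvX' !hornerE.
have : ((f e ^+ 2 * t ^+ 2 * c) ^+ d) * 'X^(b * d) *
   mmap f (fun n => arc_coord e f i j h v t r' (enum_val n)) F =
   (B * (c' * (c' ^+ (b * d).+1 * r * (rc e *: 1 * h ^+ 2 * v * t) ^+ 2 *
     (chart_eq m e f i j l h v t + (f e * h * v * t) *+ 2))) * 'X) * 'X^((b * d).+1).
  have -> : (f e ^+ 2 * t ^+ 2 * c) ^+ d * 'X^(b * d) = (f e ^+ 2 * t ^+ 2 * h ^+ 5 * v ^+ 3) ^+ d.
    rewrite exprM -exprMn; congr (_ ^+ d).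
    by rewrite -[RHS]mulrA hvE [RHS]mulrA.
  rewrite FE /r' rE /r' hvX' -mul_polyC mulr1 exprMn; ring.
move/horner0_cancelX => lim0.
have {lim0} : (mmap f (fun n => arc_coord e f i j h v t r' (enum_val n)) F).[0] = 0.
  apply: lim0; rewrite horner_exp 2!hornerM !horner_exp hornerC t0.
  have nzre : rc e != 0 by rewrite fmorph_eq0.
  exact: expf_neq0 (mulf_neq0 (mulf_neq0 (expf_neq0 2 nzre) (expf_neq0 2 v1)) c0).
rewrite -[LHS]/(horner_eval 0 _).
rewrite -(rmorph_mmap (f := f) (g := rc) (h := horner_eval 0)
  (w := fun n => rc e * t.[0] * exc o n)).
- rewrite (mmap_homogZ _ _ _ hF) => /eqP; rewrite mulf_eq0 => /orP[|/eqP //].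
  by rewrite expf_eq0 mulf_eq0 fmorph_eq0 (negbTE nz_e) t0 (negbTE v1) andbF.
- by move=> x; rewrite /= ?horner_evalE hornerC.
- move=> n; rewrite (@rmorph_arc_coord _ _ _ m e f rc) => [|x].
    by rewrite /= ?horner_evalE r'0 limit // excE.
  by rewrite /= ?horner_evalE hornerC.
Qed.

End OneArc.

Lemma ratfun_oppr (x : ratfun k) : - x = x.
Proof.
apply: oppr_pchar2; exact: (rmorph_pchar rc char2).
Qed.

Lemma exc_curve_on o : curve_on iota res_generic (exc o).
Proof.
have nzu : u != 0 by rewrite tofrac_eq0 polyX_eq0.
move=> d F hF; case: o => [i|].
  have u3 := uniq_third i.
  (* For an arm v is X, and for the central curve below h is X. So 3 and 5 are the orders in X of
     the common factor h^5 v^3. *)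
  apply: (@exc_limit (Some i) i (nxt i) (third i) u%:P 'X 3 (u ^+ 5)%:P u3) hF.
  - by rewrite rmorphXn.
  - by exists u%:P; rewrite mulrC.
  - by rewrite hornerC expf_neq0.
  - by rewrite hornerX subr0 oppr_eq0 oner_neq0.
  move=> t x; rewrite hornerX hornerC => ->.
  exact: arc_limit_side ratfun_oppr _ _.
apply: (@exc_limit None o0 o1 o2 'X u%:P 5 (u ^+ 3)%:P isT) hF.
- by rewrite rmorphXn mulrC.
- by exists u%:P.
- by rewrite hornerC expf_neq0.
- rewrite hornerC -opprD oppr_eq0 -tofrac1 -tofracD tofrac_eq0.
  by rewrite addrC -size_poly_eq0 -[1]/(1%:P) size_XaddC.
move=> t x; rewrite hornerX hornerC => ->.
exact: arc_limit_central ratfun_oppr _.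
Qed.

End Resolution.
Arguments exc {k}.
Arguments exc_la {k}.
Arguments exc_mu {k}.

(** * Charts of the resolution and points over the vertex *)

Section CurveChart.
Variables (k : closedFieldType) (K : fieldType) (f : {rmorphism k -> K}) (n : nat).
Variables (g : 'I_n -> K) (E : 'I_n -> ratfun k) (w : 'I_n -> k) (m : 'I_n).
Local Notation rc := (ratfun_const k).
Hypotheses (gE : curve_on f g E) (Ew : on_curve E w) (wm : w m != 0).
Variables (xi eta : K) (xi0 : k) (rho : ratfun k).
Hypotheses (xi_spec : cspec f g w xi xi0) (eta_spec : cspec f g w eta 0).
Hypotheses (xi_res : gspec f rc g E xi rho) (eta_res : gspec f rc g E eta 0).
Hypothesis rho_nonconst : forall c, rho <> rc c.
Hypothesis coords : forall i, polynomial_mod f g w xi eta (g i / g m).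

(** An element of the ideal is a unit times p(xi) + eta b. Its restriction to the curve gives p(rho)
    = 0, and rho, being nonconstant, is transcendental over k; so p = 0. *)
Lemma chart_local_equation : local_equation f g E w eta.
Proof.
have [_ sEw] := Ew; have gw : specializes f idfun g w := specializes_trans gE sEw.
move=> a; split.
- move=> [d [F [G [hF hG EF nzG aE]]]].
  have aw : cspec f g w a (F.@[w] / G.@[w]) by exists d, F, G.
  have aEF : gspec f rc g E a 0.
    exists d, F, G; split=> //; first exact: (specializes_neq0 sEw hG nzG).
    by rewrite EF mul0r.
  have [p [b [v [c [c' [bc vc' nzc' aE']]]]]] := cspec_chart gw wm xi_spec eta_spec coords aw.
  have [rb brb _] := gspec_mid sEw bc; have [rv vrv rvc'] := gspec_mid sEw vc'.
  have := gspecM vrv (gspecD gE (gspec_poly gE p xi_res) (gspecM eta_res brb)).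
  rewrite -aE' => /(gspec_fun gE aEF)/esym/eqP.
  rewrite mul0r addr0 mulf_eq0 (negbTE (gspec_neq0 sEw nzc' rvc')) /= => /eqP p0.
  have {}p0 : p = 0.
    apply/eqP; apply: contraT => nzp.
    by have [c0 rhoE] := ratfun_algebraic nzp p0; case: (rho_nonconst rhoE).
  exists (v * b); first by apply/local_ringP; exists (c' * c); apply: gspecM.
  by rewrite aE' p0 rmorph0 horner0 add0r; ring.
move=> [b /local_ringP[c bc] ->].
have [rb brb _] := gspec_mid sEw bc.
have [d [F [G [hF hG nzG abE _]]]] := gspecM eta_spec bc.
exists d, F, G; split=> //.
have nzGE := specializes_neq0 sEw hG nzG.
have : gspec f rc g E (eta * b) (mmap rc E F / mmap rc E G) by exists d, F, G.
move/(gspec_fun gE (gspecM eta_res brb))/esym/eqP.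
by rewrite mul0r mulf_eq0 invr_eq0 (negbTE nzGE) orbF => /eqP.
Qed.

End CurveChart.

Section Relations.
Variables (K : fieldType) (e mi mj ml yi yj yl w : K).
Hypotheses (nzi : yi != 0) (nzj : yj != 0) (nzl : yl != 0) (nzw : w != 0).
Hypothesis wE : w = yi + yj + yl + (mi * (yj * yl) + mj * (yi * yl) + ml * (yi * yj)).
Hypothesis w2 : w ^+ 2 = e * (yi * yj * yl).
Let h := yj ^+ 2 / w.
Let vi := yi / yj.
Let vl := yl / yj.
Let mu := mi * vl + ml * vi + mj * (vi * vl).

(** The two B relations are the definition of W divided by Y_j and the quartic equation divided by
    Y_j^3. The A relations express the same in terms of h. *)
Lemma chart_rel_B2 : vi + 1 + vl = yj * (w / yj ^+ 2 - mu).
Proof. by rewrite wE /mu /vi /vl; field. Qed.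

Lemma chart_rel_B1 : e * vi * vl = (w / yj ^+ 2) ^+ 2 * yj.
Proof.
rewrite expr_div_n w2 /vi /vl; field; exact: nzj.
Qed.

Lemma chart_rel_A1 : yj = e * h ^+ 2 * vi * vl.
Proof.
have -> : e * h ^+ 2 * vi * vl = e * vi * vl * (yj ^+ 2 / w) ^+ 2 by rewrite /h; ring.
by rewrite chart_rel_B1; field; rewrite nzw nzj.
Qed.

Lemma chart_rel_A2 : vi + 1 + vl = h * (e * vi * vl * (1 - h * mu)).
Proof.
rewrite chart_rel_B1 chart_rel_B2 /h; field; by rewrite nzw nzj.
Qed.

End Relations.

Section ResolutionCharts.
Variables (k : closedFieldType) (m : 'I_3 -> k) (e : k).
Variables (K : fieldType) (iota : {rmorphism k -> K}) (Y : 'I_3 -> K).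
Local Notation rc := (ratfun_const k).
Local Notation u := (FracField.tofrac ('X : {poly k}) : ratfun k).
Local Notation g := (res_generic m iota Y).

Hypothesis char2 : 2 \in [pchar k].
Hypothesis nz_e : e != 0.
Hypothesis dvd_quartic : forall P : {mpoly k[3]}, mmap iota Y P = 0 ->
  forall (A : comNzRingType) (f : {rmorphism k -> A}) z,
  exists b, mmap f z P = b * quartic (fun=> 1) m e f 1 z.
Hypothesis nzY : forall i, Y i != 0.
Hypothesis quarticY : quartic (fun=> 1) m e iota 1 Y = 0.

Definition Wq := quad_W (fun=> 1) m iota 1 Y.
Definition Rq (b : option 'I_3) := if b is Some i then Y i ^+ 2 else Wq.
Definition Xq (a : option 'I_3) := if a is Some i then Y i else 1.

Lemma Wq_sqr : Wq ^+ 2 = iota e * (Y o0 * Y o1 * Y o2).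
Proof. by apply/eqP; rewrite -subr_eq0 -[X in _ - _ * X]mul1r; apply/eqP. Qed.

Lemma Wq_neq0 : Wq != 0.
Proof.
have : Wq ^+ 2 != 0 by rewrite Wq_sqr !mulf_neq0 ?fmorph_eq0.
by rewrite expf_eq0.
Qed.

Lemma Rq_neq0 b : Rq b != 0.
Proof. by case: b => [i|] /=; rewrite ?expf_neq0 ?Wq_neq0. Qed.

Lemma Xq_neq0 b : Xq b != 0.
Proof. by case: b => [i|] /=; rewrite ?oner_neq0. Qed.

Lemma res_genericE t : g (enum_rank t) = Xq t.1.1 * Y t.1.2 * Rq t.2.
Proof. by rewrite /res_generic enum_rankK; case: t => [[a j] b]. Qed.

Lemma excE' o t : exc o (enum_rank t) = curve_pt 1 u o t.
Proof. by rewrite excE enum_rankK. Qed.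

Section Spec.
Variables (L : fieldType) (f : {rmorphism k -> L}) (h : 'I_N -> L).
Local Notation hv := (fun t : I => h (enum_rank t)).

(** Coordinates are products of one entry from each factor; two of them that differ in a single
    index have a ratio of entries of one factor as quotient. *)
Lemma spec_XV a a' j b : hv (a, j, b) != 0 ->
  gspec iota f g h (Xq a' / Xq a) (hv (a', j, b) / hv (a, j, b)).
Proof.
move=> nz; have := gspec_ratio iota f g (enum_rank (a', j, b)) nz.
rewrite !res_genericE /=; congr gspec.
by have := (nzY j, Rq_neq0 b, Xq_neq0 a) => -[[n1 n2] n3]; field; apply/and3P.
Qed.

Lemma spec_Y i j b : hv (None, j, b) != 0 ->
  gspec iota f g h (Y i) (hv (Some i, j, b) / hv (None, j, b)).
Proof. by move/(spec_XV (Some i)); rewrite /= divr1. Qed.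

Lemma spec_V i j a b : hv (a, j, b) != 0 ->
  gspec iota f g h (Y i / Y j) (hv (a, i, b) / hv (a, j, b)).
Proof.
move=> nz; have := gspec_ratio iota f g (enum_rank (a, i, b)) nz.
rewrite !res_genericE /=; congr gspec.
by have := (nzY j, Rq_neq0 b, Xq_neq0 a) => -[[n1 n2] n3]; field; apply/and3P.
Qed.

Lemma spec_R j a b b' : hv (a, j, b) != 0 ->
  gspec iota f g h (Rq b' / Rq b) (hv (a, j, b') / hv (a, j, b)).
Proof.
move=> nz; have := gspec_ratio iota f g (enum_rank (a, j, b')) nz.
rewrite !res_genericE /=; congr gspec.
by have := (nzY j, Rq_neq0 b, Xq_neq0 a) => -[[n1 n2] n3]; field; apply/and3P.
Qed.

End Spec.

Section Pivot.
Variables (i j l : 'I_3).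
Hypothesis ijl : uniq [:: i; j; l].
Local Notation vi := (Y i / Y j).
Local Notation vl := (Y l / Y j).
Local Notation h := (Rq (Some j) / Wq).
Local Notation h' := (Wq / Rq (Some j)).
Definition pivot_mu := iota (m i) * vl + iota (m l) * vi + iota (m j) * (vi * vl).

Let WqE : Wq = Y i + Y j + Y l + (iota (m i) * (Y j * Y l) + iota (m j) * (Y i * Y l)
  + iota (m l) * (Y i * Y j)).
Proof.
by rewrite /Wq /quad_W rmorph1 !mul1r (sum3_perm _ ijl) (quad_M_perm _ _ _ ijl).
Qed.

Let Wq2 : Wq ^+ 2 = iota e * (Y i * Y j * Y l).
Proof. by rewrite Wq_sqr (prod3_perm _ ijl). Qed.

Lemma rel_A1 : Y j = iota e * h ^+ 2 * vi * vl.
Proof. exact: (chart_rel_A1 (nzY j) Wq_neq0 Wq2). Qed.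

Lemma rel_A2 : vi + 1 + vl = h * (iota e * vi * vl * (1 - h * pivot_mu)).
Proof. exact: (chart_rel_A2 (nzY j) Wq_neq0 WqE Wq2). Qed.

Lemma rel_B1 : iota e * vi * vl = h' ^+ 2 * Y j.
Proof. exact: (chart_rel_B1 (nzY j) Wq2). Qed.

Lemma rel_B2 : vi + 1 + vl = Y j * (h' - pivot_mu).
Proof. exact: (chart_rel_B2 (nzY j) WqE). Qed.

End Pivot.

Lemma exc_la_a o : exc_la o (enum_rank (base_a o)) = 1 :> k.
Proof. by rewrite /exc_la enum_rankK curve_pt_a. Qed.
Lemma exc_mu_a o : exc_mu o (enum_rank (base_a o)) = 0 :> k.
Proof. by rewrite /exc_mu enum_rankK curve_pt_a. Qed.
Lemma exc_la_b o : exc_la o (enum_rank (base_b o)) = 0 :> k.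
Proof. by rewrite /exc_la enum_rankK curve_pt_b. Qed.
Lemma exc_mu_b o : exc_mu o (enum_rank (base_b o)) = 1 :> k.
Proof. by rewrite /exc_mu enum_rankK curve_pt_b. Qed.

Lemma exc_onE o (w : 'I_N -> k) : on_curve (exc o) w -> exists a b,
  (a != 0) || (b != 0) /\ forall t, w (enum_rank t) = curve_pt a b o t.
Proof.
move=> ow.
have [nzw wE] := (lin_on_curveP (exc_la_a o) (exc_mu_a o) (exc_la_b o) (exc_mu_b o) w).1 ow.
exists (w (enum_rank (base_a o))), (w (enum_rank (base_b o))); split=> [|t].
  have nzb := lin_coord_neq0 (exc_la_a o) (exc_mu_a o) (exc_la_b o) (exc_mu_b o) ow.
  have [a0|//] := eqVneq (w (enum_rank (base_a o))) 0.
  exact: nzb.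
by rewrite wE [RHS]curve_pt_lin /exc_la /exc_mu enum_rankK.
Qed.

Lemma exc_onI o (w : 'I_N -> k) a b : (a != 0) || (b != 0) ->
  (forall t, w (enum_rank t) = curve_pt a b o t) -> on_curve (exc o) w.
Proof.
move=> nzab wE; have wa : w (enum_rank (base_a o)) = a by rewrite wE curve_pt_a.
have wb : w (enum_rank (base_b o)) = b by rewrite wE curve_pt_b.
apply/(lin_on_curveP (exc_la_a o) (exc_mu_a o) (exc_la_b o) (exc_mu_b o)); split.
  case/orP: nzab => nz; [exists (enum_rank (base_a o))|exists (enum_rank (base_b o))].
    by rewrite wa.
  by rewrite wb.
move=> n; rewrite -{1}(enum_valK n) wE wa wb curve_pt_lin.
by rewrite /exc_la /exc_mu.
Qed.

(** By [over_vertexP] this is equivalent to lying over the vertex; it does not refer to the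
    embedding of the quartic. *)
Definition over_vertex w := forall i, cspec iota g w (Y i) 0.

Lemma exc_on_model o w : on_curve (exc o) w -> on_model iota g w.
Proof.
move=> [nzw ow]; split=> //.
exact: specializes_trans (exc_curve_on char2 nz_e dvd_quartic o) ow.
Qed.

Lemma exc_over_vertex o w : on_curve (exc o) w -> over_vertex w.
Proof.
move=> ow i; have [c [d [_ wE]]] := exc_onE ow.
have [[n nzn] _] := ow; move: nzn; rewrite -(enum_valK n).
case: (enum_val n) => [[a j] b]; rewrite wE; case: a => [a|] nz.
  by rewrite /= eqxx in nz.
have := @spec_Y _ idfun w i j b; rewrite /= !wE [curve_pt _ _ _ (Some i, j, b)]/= mul0r.
exact.
Qed.

Lemma line_coord_neq0 j : line_coord 1 u j != 0.
Proof.
have := (tofrac_eq0 ('X : {poly k}), tofrac_eq0 ('X + 1%:P : {poly k})) => -[uE u1E].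
elim/ord3_ind: j; rewrite /line_coord /= ?oner_neq0 ?uE ?polyX_eq0 //.
by rewrite addrC -tofrac1 -tofracD -[1]/(1%:P) u1E -size_poly_eq0 size_XaddC.
Qed.

Lemma line_coord_nonconst i j c : i != j -> line_coord 1 u i / line_coord 1 u j <> rc c.
Proof.
pose P (x : 'I_3) : {poly k} := line_coord 1 'X x.
have lcE x : line_coord 1 u x = FracField.tofrac (P x).
  by elim/ord3_ind: x; rewrite /P /line_coord /= ?tofracD ?tofrac1.
move=> ij /(congr1 ( *%R^~ (line_coord 1 u j))); rewrite /= divfK ?line_coord_neq0 //.
rewrite !lcE -tofracM => /eqP; rewrite tofrac_eq => /eqP PE.
have := (congr1 (horner^~ 0) PE, congr1 (horner^~ 1) PE) => -[].
have k2 : 1 + 1 = 0 :> k by rewrite addrr_pchar2.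
have n10 := oner_neq0 k.
move: ij; elim/ord3_ind: i {PE}; elim/ord3_ind: j => // _;
  rewrite /P /line_coord /= !hornerE ?k2 => e0 e1;
  rewrite ?(mulr0, mulr1, addr0, add0r) in e0 e1; case/eqP: n10;
  by first [exact: e0 | exact: e1 | rewrite [LHS]e1 -e0 | rewrite [LHS]e0 -e1].
Qed.

Section ChartCoordinates.
Variables (i j l : 'I_3).
Hypothesis ijl : uniq [:: i; j; l].
Variable T : K -> Prop.
Hypothesis TC : forall c, T (iota c).
Hypothesis TM : forall a b, T a -> T b -> T (a * b).
Hypotheses (Ti : T (Y i / Y j)) (Tl : T (Y l / Y j)).

Let T1 : T 1. Proof. by rewrite -(rmorph1 iota). Qed.

Let TV p : T (Y p / Y j).
Proof.
by apply: (ord3_perm_ind (P := fun p => T (Y p / Y j)) ijl); rewrite ?divff.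
Qed.

Let TX : T (Y j) -> forall a, T (Xq a).
Proof.
move=> Tj [p|] //=; have := TM (TV p) Tj; rewrite divfK //.
Qed.

(** Up to constants the coordinates divided by Y_j W are monomials in v_i, v_l and h, since Y_j is
    one. In the other chart the divisor is Y_j^3, and Y_j and 1 / h replace h. *)
Lemma chartA_coords : T (Rq (Some j) / Wq) ->
  forall n, T (g n / g (enum_rank (None, j, None))).
Proof.
move=> Th n; have Tj : T (Y j).
  rewrite (rel_A1 ijl); apply: (TM) => //; apply: (TM) => //; apply: (TM) => //.
  exact: TM.
rewrite -(enum_valK n) !res_genericE; case: (enum_val n) => [[a p] b] /=.
have -> : Xq a * Y p * Rq b / (1 * Y j * Wq) = Xq a * (Y p / Y j) * (Rq b / Wq).
  by have := (nzY j, Wq_neq0) => -[n1 n2]; field; rewrite n1 n2.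
apply: (TM); first by apply: (TM); [exact: TX | exact: TV].
case: b => [c|] /=; last by rewrite divff ?Wq_neq0.
have -> : Y c ^+ 2 / Wq = (Rq (Some j) / Wq) * (Y c / Y j) * (Y c / Y j).
  by have := (nzY j, Wq_neq0) => -[n1 n2]; rewrite /=; field; rewrite n1 n2.
by apply: (TM); [apply: (TM); [exact: Th | exact: TV] | exact: TV].
Qed.

Lemma chartB_coords : T (Wq / Rq (Some j)) -> T (Y j) ->
  forall n, T (g n / g (enum_rank (None, j, Some j))).
Proof.
move=> Th Tj n.
rewrite -(enum_valK n) !res_genericE; case: (enum_val n) => [[a p] b] /=.
have -> : Xq a * Y p * Rq b / (1 * Y j * Y j ^+ 2) = Xq a * (Y p / Y j) * (Rq b / Rq (Some j)).
  by have := nzY j => n1; rewrite /=; field; rewrite n1.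
apply: (TM); first by apply: (TM); [exact: TX | exact: TV].
case: b => [c|] //=.
have -> : Y c ^+ 2 / Y j ^+ 2 = (Y c / Y j) * (Y c / Y j).
  by have := nzY j => n1; field; rewrite n1.
exact: TM.
Qed.

End ChartCoordinates.

(* The names ending in A refer to the coordinate h, those in B to 1 / h. *)
Section LocalCharts.
Variables (o : option 'I_3) (w : 'I_N -> k).
Hypothesis ow : on_curve (exc o) w.
Variables (i j l : 'I_3).
Hypothesis ijl : uniq [:: i; j; l].
Local Notation sp := (cspec iota g w).
Local Notation vi := (Y i / Y j).
Local Notation vl := (Y l / Y j).
Local Notation h := (Rq (Some j) / Wq).
Local Notation h' := (Wq / Rq (Some j)).

Let gE : curve_on iota g (exc o) := exc_curve_on char2 nz_e dvd_quartic o.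
Let gw : specializes iota idfun g w := (exc_on_model ow).2.

Let poly_mod_coords xi xi0 eta : sp xi xi0 -> sp eta 0 ->
  [/\ forall a b, polynomial_mod iota g w xi eta a -> polynomial_mod iota g w xi eta b ->
       polynomial_mod iota g w xi eta (a + b)
   & forall a b, polynomial_mod iota g w xi eta a -> polynomial_mod iota g w xi eta b ->
       polynomial_mod iota g w xi eta (a * b)].
Proof.
move=> xiP etaP; split=> a b; first exact: polynomial_modD.
exact: (polynomial_modM gw xiP etaP).
Qed.

Let mu_spec c c' : sp vi c -> sp vl c' -> exists d, sp (pivot_mu i j l) d.
Proof.
move=> ic lc; eexists; apply: gspecD => //; last first.
  by apply: gspecM; [exact: gspecC | apply: gspecM; [exact: ic | exact: lc]].
by apply: gspecD => //; apply: gspecM; [exact: gspecC | exact: lc | exact: gspecC | exact: ic].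
Qed.

(** The parameters are v_i along the curve and h across it; [rel_A2] shows that v_l is -1 - v_i
    modulo h. *)
Lemma chart_central : o = None -> w (enum_rank (None, j, None)) != 0 ->
  regular_surface_point iota g w /\ local_equation iota g (exc o) w h.
Proof.
move=> oE nzw; have [a [b [_ wE]]] := exc_onE ow.
have iP := @spec_V _ idfun w i j None None nzw.
have lP := @spec_V _ idfun w l j None None nzw.
have hP : sp h 0.
  by have := @spec_R _ idfun w j None None (Some j) nzw; rewrite /= wE oE mul0r; apply.
have [d muP] := mu_spec iP lP.
have [PD PM] := poly_mod_coords iP hP.
have coords : forall n, polynomial_mod iota g w vi h (g n / g (enum_rank (None, j, None))).
  have Pi : polynomial_mod iota g w vi h vi by apply: polynomial_mod_xi.
  have Ph : polynomial_mod iota g w vi h h.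
    by rewrite -[X in polynomial_mod _ _ _ _ _ X]mulr1; apply: polynomial_mod_eta; apply: gspec1.
  apply: (chartA_coords ijl) => //; first exact: polynomial_modC.
  have -> : vl = iota (-1) + iota (-1) * vi + h * (iota e * vi * vl * (1 - h * pivot_mu i j l)).
    by rewrite -(rel_A2 ijl) rmorphN rmorph1; ring.
  apply: (PD); first by apply: (PD); [|apply: (PM) => //]; apply: polynomial_modC.
  apply: polynomial_mod_eta; apply: gspecM.
    by apply: gspecM; [apply: gspecM; [exact: gspecC | exact: iP] | exact: lP].
  by apply: gspecB => //; [exact: gspec1 | apply: gspecM; [exact: hP | exact: muP]].
split; first exact: (chart_regular gw nzw iP hP coords).
have nzE p : @exc k o (enum_rank ((None, p, None) : I)) != 0.
  by rewrite excE' oE; apply: line_coord_neq0.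
apply: (chart_local_equation gE ow nzw iP hP _ _ _ coords).
- exact: (@spec_V _ rc (exc o) i j None None (nzE j)).
- have := @spec_R _ rc (exc o) j None None (Some j) (nzE j).
  by rewrite /= excE' oE mul0r; apply.
- move=> c; rewrite /= !excE' oE; apply: line_coord_nonconst.
  by move: ijl; rewrite /= inE negb_or => /andP[/andP[]].
Qed.

Let u_nonconst c : u <> rc c.
Proof.
move=> /eqP; rewrite tofrac_eq => /eqP/(congr1 (fun p : {poly k} => size p)).
by rewrite size_polyX size_polyC; case: (_ == 0).
Qed.

Let ij : i != j.
Proof. by move: ijl; rewrite /= inE negb_or => /andP[/andP[]]. Qed.

(** The roles are exchanged: h is the parameter along the arm, v_i the one across it, and v_l is -1
    modulo v_i. *)
Lemma chart_arm_A : o = Some i -> w (enum_rank (None, j, None)) != 0 ->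
  regular_surface_point iota g w /\ local_equation iota g (exc o) w vi.
Proof.
move=> oE nzw; have [a [b [_ wE]]] := exc_onE ow.
have iP : sp vi 0.
  by have := @spec_V _ idfun w i j None None nzw; rewrite /= !wE oE /= eqxx mul0r; apply.
have lP := @spec_V _ idfun w l j None None nzw.
have hP := @spec_R _ idfun w j None None (Some j) nzw.
have [d muP] := mu_spec iP lP.
have [PD PM] := poly_mod_coords hP iP.
have coords : forall n, polynomial_mod iota g w h vi (g n / g (enum_rank (None, j, None))).
  have Ph : polynomial_mod iota g w h vi h by apply: polynomial_mod_xi.
  have Pi : polynomial_mod iota g w h vi vi.
    by rewrite -[X in polynomial_mod _ _ _ _ _ X]mulr1; apply: polynomial_mod_eta; apply: gspec1.
  apply: (chartA_coords ijl) => //; first exact: polynomial_modC.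
  have -> : vl = iota (-1) + vi * (iota (-1) + h * (iota e * vl * (1 - h * pivot_mu i j l))).
    have := rel_A2 ijl; rewrite rmorphN rmorph1 => rel.
    by transitivity ((vi + 1 + vl) - vi - 1); [ring | rewrite rel; ring].
  apply: (PD); first exact: polynomial_modC.
  apply: polynomial_mod_eta; apply: gspecD => //; first exact: gspecC.
  apply: gspecM; first exact: hP; apply: gspecM.
    by apply: gspecM; [exact: gspecC | exact: lP].
  by apply: gspecB => //; [exact: gspec1 | apply: gspecM; [exact: hP | exact: muP]].
split; first exact: (chart_regular gw nzw hP iP coords).
have Ej : @exc k o (enum_rank ((None, j, None) : I)) = 1.
  by rewrite excE' oE /= eq_sym (negbTE ij).
have nzE : @exc k o (enum_rank ((None, j, None) : I)) != 0 by rewrite Ej oner_neq0.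
have hu : gspec iota rc g (exc o) h u.
  have := @spec_R _ rc (exc o) j None None (Some j) nzE.
  by rewrite /= Ej excE' oE /= eq_sym (negbTE ij) /= divr1; apply.
apply: (chart_local_equation gE ow nzw hP iP hu _ u_nonconst coords).
have := @spec_V _ rc (exc o) i j None None nzE.
by rewrite /= Ej excE' oE /= eqxx mul0r; apply.
Qed.

(** Near h infinite the parameters are 1 / h and Y_j. On the arm v_l has the value 1, so [rel_B1]
    can be divided by e v_l and makes v_i a multiple of Y_j; [rel_B2] then gives v_l. *)
Lemma chart_arm_B : o = Some i -> w (enum_rank (None, j, Some j)) != 0 ->
  regular_surface_point iota g w /\ local_equation iota g (exc o) w (Y j).
Proof.
move=> oE nzw; have [a [b [_ wE]]] := exc_onE ow.
have jP : sp (Y j) 0.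
  by have := @spec_Y _ idfun w j j (Some j) nzw; rewrite /= !wE mul0r; apply.
have iP : sp vi 0.
  by have := @spec_V _ idfun w i j None (Some j) nzw; rewrite /= !wE oE /= eqxx mul0r; apply.
have li : (l == i) = false.
  by move: ijl; rewrite /= !inE negb_or => /andP[/andP[_ il] _]; rewrite eq_sym (negbTE il).
have ji : (j == i) = false by rewrite eq_sym (negbTE ij).
have lP : sp vl 1.
  have := @spec_V _ idfun w l j None (Some j) nzw; move: nzw.
  by rewrite /= !wE oE /= li ji /= => nzb; rewrite divff //; apply.
have hP := @spec_R _ idfun w j None (Some j) None nzw.
have [d muP] := mu_spec iP lP.
have [PD PM] := poly_mod_coords hP jP.
have nzv q : Y q / Y j != 0 by rewrite mulf_neq0 ?invr_eq0.
have nziota : iota e != 0 by rewrite fmorph_eq0.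
have viE : vi = Y j * (h' ^+ 2 / (iota e * vl)).
  have nzel : iota e * vl != 0 by apply: mulf_neq0.
  have gen (x y z : K) : x != 0 -> z * y = x * (y * (z / x)) by move=> nzx; field.
  apply: (mulfI nzel); rewrite -gen // -(rel_B1 ijl); ring.
have elP : sp (h' ^+ 2 / (iota e * vl)) ((w (enum_rank (None, j, None)) /
     w (enum_rank (None, j, Some j))) ^+ 2 / (e * 1)).
  apply: gspec_div; first by rewrite mulr1.
    by apply: gspecX; exact: hP.
  by apply: gspecM; [exact: gspecC | exact: lP].
have coords : forall n, polynomial_mod iota g w h' (Y j) (g n / g (enum_rank (None, j, Some j))).
  have Ph : polynomial_mod iota g w h' (Y j) h' by apply: polynomial_mod_xi.
  have Pj : polynomial_mod iota g w h' (Y j) (Y j).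
    by rewrite -[X in polynomial_mod _ _ _ _ _ X]mulr1; apply: polynomial_mod_eta; apply: gspec1.
  have Pi : polynomial_mod iota g w h' (Y j) vi.
    by rewrite viE; apply: polynomial_mod_eta elP.
  apply: (chartB_coords ijl) => //; first exact: polynomial_modC.
  have -> : vl = iota (-1) + (vi * iota (-1) + Y j * (h' - pivot_mu i j l)).
    by rewrite -(rel_B2 ijl) rmorphN rmorph1; ring.
  apply: (PD); first exact: polynomial_modC.
  apply: (PD); first by apply: (PM) => //; apply: polynomial_modC.
  by apply: polynomial_mod_eta; apply: gspecB => //; [exact: hP | exact: muP].
split; first exact: (chart_regular gw nzw hP jP coords).
have Ej : @exc k o (enum_rank ((None, j, Some j) : I)) = u by rewrite excE' oE /= ji.
have nzu : u != 0 by rewrite tofrac_eq0 polyX_eq0.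
have nzE : @exc k o (enum_rank ((None, j, Some j) : I)) != 0 by rewrite Ej.
have hu : gspec iota rc g (exc o) h' u^-1.
  have := @spec_R _ rc (exc o) j None (Some j) None nzE.
  by rewrite /= Ej excE' oE /= ji mul1r; apply.
apply: (chart_local_equation gE ow nzw hP jP hu _ _ coords).
  have := @spec_Y _ rc (exc o) j j (Some j) nzE.
  by rewrite /= excE' mul0r; apply.
move=> c uc; apply: (@u_nonconst c^-1).
by rewrite fmorphV -uc invrK.
Qed.

End LocalCharts.

Section Classification.
Variable w : 'I_N -> k.
Hypotheses (gw : on_model iota g w) (ow : over_vertex w).
Let spw : specializes iota idfun g w := gw.2.

Lemma over_vertex_Some a p b : w (enum_rank (Some a, p, b)) = 0.
Proof.
apply: contraTeq isT => nz.
have /(gspecM (ow a)) := @spec_XV _ idfun w (Some a) None p b nz.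
rewrite mul0r /= mulrA mulr1 divff //.
by move=> /(gspec_fun spw (gspec1 _ _ _ _))/eqP; rewrite oner_eq0.
Qed.

(** Otherwise Y_c / Y_p would have value 0 while Y_p^2 / Y_c^2 has a finite one, although the square
    of the first times the second is 1. *)
Lemma over_vertex_diag p c :
  w (enum_rank (None, p, Some c)) != 0 -> w (enum_rank (None, c, Some c)) != 0.
Proof.
move=> nz; apply: contraTneq isT => w0.
have := @spec_V _ idfun w c p None (Some c) nz; rewrite /= w0 mul0r => cp.
have := gspecM (gspecX 2 cp) (@spec_R _ idfun w p None (Some c) (Some p) nz).
rewrite expr0n /= mul0r.
have -> : (Y c / Y p) ^+ 2 * (Y p ^+ 2 / Y c ^+ 2) = 1.
  by have := (nzY c, nzY p) => -[n1 n2]; field; rewrite n1 n2.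
by move=> /(gspec_fun spw (gspec1 _ _ _ _))/eqP; rewrite oner_eq0.
Qed.

Lemma k_oppr (x : k) : - x = x.
Proof. exact: oppr_pchar2. Qed.

(** As Y_j and v_i have value 0, [rel_B2] forces v_l = -1 = 1. This fixes the second factor and
    leaves only the ratio of W to Y_j^2 free in the third. *)
Let arm_point i j l : uniq [:: i; j; l] -> w (enum_rank (None, j, Some j)) != 0 ->
    w (enum_rank (None, i, Some j)) = 0 -> on_curve (exc (Some i)) w.
Proof.
move=> ijl nzw wi0.
have vP p := @spec_V _ idfun w p j None (Some j) nzw.
have hP := @spec_R _ idfun w j None (Some j) None nzw.
set s := w (enum_rank (None, j, Some j)) in nzw vP hP *.
have q_l : w (enum_rank (None, l, Some j)) / s = 1.
  have [d muP] : exists d, cspec iota g w (pivot_mu i j l) d.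
    eexists; apply: gspecD => //; last first.
      by apply: gspecM; [exact: gspecC | apply: gspecM; [exact: vP | exact: vP]].
    by apply: gspecD => //; apply: gspecM; [exact: gspecC | exact: vP | exact: gspecC | exact: vP].
  have := gspecM (ow j) (gspecB spw hP muP); rewrite mul0r -(rel_B2 ijl).
  have := gspecD spw (gspecD spw (vP i) (gspec1 _ _ _ _)) (vP l).
  move=> val /(gspec_fun spw val)/eqP; rewrite wi0 mul0r add0r addr_eq0 => /eqP.
  by rewrite k_oppr.
pose q p := if p == i then 0 else 1 : k.
have qE p : w (enum_rank (None, p, Some j)) / s = q p.
  have [/negbTE ij /negbTE li] : j != i /\ l != i.
    by move: ijl; rewrite /= !inE negb_or ![_ == i]eq_sym => /andP[/andP[]].
  apply: (ord3_perm_ind (P := fun p => w (enum_rank (None, p, Some j)) / s = q p) ijl).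
  - by rewrite wi0 mul0r /q eqxx.
  - by rewrite divff // /q ij.
  - by rewrite q_l /q li.
have RP b : cspec iota g w (Rq b / Rq (Some j))
    (if b is Some c then q c ^+ 2 else w (enum_rank (None, j, None)) / s).
  case: b => [c|]; last exact: hP.
  by have := gspecX 2 (vP c); rewrite expr_div_n /= qE.
apply: (@exc_onI _ w (w (enum_rank (None, j, None))) s); first by rewrite nzw orbT.
move=> [[[a|] p] b]; first exact: over_vertex_Some.
apply: (mulIf (invr_neq0 nzw)).
have := gspecM (vP p) (RP b); rewrite qE.
have -> : Y p / Y j * (Rq b / Rq (Some j)) = g (enum_rank (None, p, b)) / g (enum_rank (None, j, Some j)).
  by rewrite !res_genericE /= !mul1r mulf_div.
move=> val; have /(gspec_fun spw)/(_ val) -> := gspec_ratio iota idfun g (enum_rank (None, p, b)) nzw.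
rewrite /q /=; case: b {val} => [c|] /=; repeat case: eqP => _ /=;
  by rewrite ?(mul0r, mulr0, mul1r, mulr1, expr0n, expr1n, divff nzw).
Qed.

Lemma ord3_complete (j : 'I_3) : exists i l, uniq [:: i; j; l].
Proof. by elim/ord3_ind: j; [exists o1, o2 | exists o0, o2 | exists o0, o1]. Qed.

(** If some entry Y_j^2 of the third factor is nonzero, [rel_B1] at Y_j = 0 gives v_i v_l = 0, hence
    an arm. Otherwise only the entry W survives, so h = 0, and [rel_A2] is the equation of the
    central line. *)
Lemma over_vertex_curve : exists o, on_curve (exc o) w.
Proof.
have [/= j nzj|all0] := pickP (fun j => w (enum_rank (None, j, Some j)) != 0).
  have [i [l ijl]] := ord3_complete j.
  have vP p := @spec_V _ idfun w p j None (Some j) nzj.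
  have hP := @spec_R _ idfun w j None (Some j) None nzj.
  have := gspecM (gspecX 2 hP) (ow j); rewrite mulr0 -(rel_B1 ijl).
  have := gspecM (gspecM (gspecC iota idfun g w e) (vP i)) (vP l).
  move=> val /(gspec_fun spw val)/eqP.
  rewrite !mulf_eq0 (negbTE nz_e) invr_eq0 /= (negbTE nzj) !orbF.
  case/orP=> /eqP w0; first by exists (Some i); apply: (arm_point ijl).
  exists (Some l); apply: (@arm_point l j i) => //.
  by rewrite -rev_uniq.
have w0 p c : w (enum_rank (None, p, Some c)) = 0.
  apply/eqP; apply: contraT => /over_vertex_diag; by rewrite (all0 c).
have [[n nzn] _] := gw; move: nzn; rewrite -(enum_valK n).
case: (enum_val n) => [[[a|] j] [b|]]; rewrite ?over_vertex_Some ?w0 ?eqxx // => nzj.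
have [i [l ijl]] := ord3_complete j.
have vP p := @spec_V _ idfun w p j None None nzj.
have hP := @spec_R _ idfun w j None None (Some j) nzj.
rewrite /= w0 mul0r in hP.
have [d muP] : exists d, cspec iota g w (pivot_mu i j l) d.
  eexists; apply: gspecD => //; last first.
    by apply: gspecM; [exact: gspecC | apply: gspecM; [exact: vP | exact: vP]].
  by apply: gspecD => //; apply: gspecM; [exact: gspecC | exact: vP | exact: gspecC | exact: vP].
have := gspecM hP (gspecM (gspecM (gspecM (gspecC iota idfun g w e) (vP i)) (vP l))
  (gspecB spw (gspec1 _ _ _ _) (gspecM hP muP))).
rewrite mul0r -(rel_A2 ijl).
have := gspecD spw (gspecD spw (vP i) (gspec1 _ _ _ _)) (vP l).
move=> val /(gspec_fun spw val) {val} sum0.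
pose x p := w (enum_rank (None, p, None)).
have {}sum0 : x o0 + x o1 + x o2 = 0.
  rewrite (sum3_perm _ ijl); apply: (mulIf (invr_neq0 nzj)).
  by rewrite mul0r -[RHS]sum0 /x !mulrDl divff.
exists None; apply: (@exc_onI None w (x o1) (x o0)).
  have [x1|//] := eqVneq (x o1) 0; have [x0|//] := eqVneq (x o0) 0.
  move: nzj; rewrite -/(x j); apply: contraNT => _; apply/eqP.
  move: sum0; rewrite x1 x0 !add0r => x2.
  by apply: (ord3_ind (P := fun j => x j = 0)).
move=> [[[a|] p] [c|]]; rewrite ?over_vertex_Some ?w0 //.
rewrite -/(x p) /=; apply: (ord3_ind (P := fun p => x p = line_coord (x o1) (x o0) p)) => //.
by rewrite /line_coord /= -[LHS]k_oppr; apply/eqP; rewrite eq_sym -addr_eq0 [x o1 + _]addrC sum0.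
Qed.

End Classification.

End ResolutionCharts.

(** * Intersection numbers *)

Section Cycles.
Variables (k : fieldType) (n : nat) (C : ('I_n -> k) -> Prop).
Variable mu : ('I_n -> k) -> int -> Prop.

Lemma cycle_degree1 p m : C p -> mu p m ->
  (forall w, C w -> proj_eq w p \/ mu w 0) -> cycle_degree C mu m.
Proof.
move=> Cp mup cover; exists 1%N, (fun=> p), (fun=> m); split=> //.
- by move=> i j _; rewrite !ord1.
- by move=> w /cover[wp|]; [left; exists ord0 | right].
- by rewrite big_ord1.
Qed.

Lemma cycle_degree0 : (forall w, C w -> mu w 0) -> cycle_degree C mu 0.
Proof.
move=> cover; exists 0%N, (fun _ _ => 0), (fun=> 0); split=> [[]//|[]//|w /cover|].
  by right.
by rewrite big_ord0.
Qed.

End Cycles.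

Lemma restricts_toP (k : fieldType) (K : fieldType) (f : {rmorphism k -> K}) n
    (g : 'I_n -> K) e a r :
  restricts_to f g e a r <-> gspec f (ratfun_const k) g e a r.
Proof.
split=> -[d [F [G [hF hG nz aE rE]]]]; exists d, F, G; split=> //.
  exact/eqP.
exact/eqP.
Qed.

(** Some form vanishes on D but not at w, so the ideal of D is the whole local ring. *)
Lemma local_equation1 (k K : fieldType) (f : {rmorphism k -> K}) n (g : 'I_n -> K)
    (D : 'I_n -> ratfun k) w : on_model f g w -> ~ on_curve D w ->
  local_equation f g D w 1.
Proof.
move=> [nzw gw] Dw.
have [d [F [hF DF nzF]]] : exists d (F : {mpoly k[n]}),
    [/\ F \is d.-homog, hvanish (ratfun_const k) D F & F.@[w] != 0].
  apply: NNPP => none; apply: Dw; split=> // d F hF DF; apply/eqP.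
  by apply: contraT => nzF; case: none; exists d, F.
move=> a; split=> [[d' [P [Q [hP hQ _ nzQ ->]]]]|[b [d' [P [Q [hP hQ nzQ ->]]]] ->]].
  by exists (mmap f g P / mmap f g Q); [exists d', P, Q | rewrite mul1r].
exists (d' + d)%N, (P * F), (Q * F).
rewrite !dhomogM ?hP //; split=> //.
- by rewrite /hvanish rmorphM /= DF mulr0.
- by rewrite mevalM mulf_neq0.
rewrite mul1r !rmorphM /= -mulf_div divff ?mulr1 //.
exact: (specializes_neq0 gw hF nzF).
Qed.

Section Intersections.
Variables (k : closedFieldType) (m : 'I_3 -> k) (e : k).
Variables (K : fieldType) (iota : {rmorphism k -> K}) (Y : 'I_3 -> K).
Local Notation rc := (ratfun_const k).
Local Notation u := (FracField.tofrac ('X : {poly k}) : ratfun k).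
Local Notation g := (res_generic m iota Y).
Local Notation exc := (@exc k).

Hypothesis char2 : 2 \in [pchar k].
Hypothesis nz_e : e != 0.
Hypothesis dvd_quartic : forall P : {mpoly k[3]}, mmap iota Y P = 0 ->
  forall (A : comNzRingType) (f : {rmorphism k -> A}) z,
  exists b, mmap f z P = b * quartic (fun=> 1) m e f 1 z.
Hypothesis nzY : forall i, Y i != 0.
Hypothesis quarticY : quartic (fun=> 1) m e iota 1 Y = 0.

Local Notation Wq := (Wq m iota Y).
Local Notation Rq := (Rq m iota Y).

Let nzW : Wq != 0 := Wq_neq0 nz_e nzY quarticY.
Let nzu : u != 0. Proof. by rewrite tofrac_eq0 polyX_eq0. Qed.

Lemma exc_smooth o : smooth_rational_curve (exc o).
Proof.
have [la ma lb mb] := And4 (exc_la_a k o) (exc_mu_a k o) (exc_la_b k o) (exc_mu_b k o).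
by split; [apply: (lin_projective_model la ma lb mb) | apply: (lin_isomorphic la ma lb mb)].
Qed.

Definition exc_point (o : option 'I_3) (a b : k) : 'I_N -> k :=
  fun n => curve_pt a b o (enum_val n).

Lemma exc_pointE o a b t : exc_point o a b (enum_rank t) = curve_pt a b o t.
Proof. by rewrite /exc_point enum_rankK. Qed.

Lemma exc_point_on o a b : (a != 0) || (b != 0) -> on_curve (exc o) (exc_point o a b).
Proof. by move=> nz; apply: (exc_onI nz) => t; apply: exc_pointE. Qed.

Lemma exc_point_proj o w a b c a' b' : on_curve (exc o) w ->
  (forall t, w (enum_rank t) = curve_pt a b o t) ->
  c != 0 -> a = c * a' -> b = c * b' -> proj_eq w (exc_point o a' b').
Proof.
move=> _ wE nzc aE bE; exists c => // n.
rewrite -(enum_valK n) wE exc_pointE curve_pt_lin [in RHS]curve_pt_lin aE bE.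
by rewrite mulrDr !mulrA.
Qed.

Lemma exc_order1 o w : on_curve (exc o) w -> order_at rc (exc o) w 1 0.
Proof.
move=> ow; have [la ma lb mb] := And4 (exc_la_a k o) (exc_mu_a k o) (exc_la_b k o) (exc_mu_b k o).
have s1 := gspec1 rc idfun (exc o) w.
have [wa|nza] := eqVneq (w (enum_rank (base_a o))) 0.
  by have := lin_order_inf la ma lb mb 0 ow wa s1 (oner_neq0 _); rewrite oppr0 expr0z mulr1.
by have := lin_order_fin la ma lb mb 0 ow nza s1 (oner_neq0 _); rewrite expr0z mulr1.
Qed.

Lemma exc_order_zero o w (l : int) c : on_curve (exc o) w ->
    w (enum_rank (base_a o)) != 0 -> w (enum_rank (base_b o)) = c * w (enum_rank (base_a o)) ->
  order_at rc (exc o) w ((u - rc c) ^ l) l.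
Proof.
move=> ow nza bE; have [la ma lb mb] := And4 (exc_la_a k o) (exc_mu_a k o) (exc_la_b k o) (exc_mu_b k o).
have := lin_order_fin la ma lb mb l ow nza (gspec1 rc idfun (exc o) w) (oner_neq0 _).
by rewrite mul1r bE mulfK.
Qed.

Lemma exc_order_inf o w (l : int) c : on_curve (exc o) w -> c != 0 ->
    w (enum_rank (base_a o)) = 0 ->
  order_at rc (exc o) w (rc c * u ^ (- l)) l.
Proof.
move=> ow nzc a0; have [la ma lb mb] := And4 (exc_la_a k o) (exc_mu_a k o) (exc_la_b k o) (exc_mu_b k o).
exact: (lin_order_inf la ma lb mb l ow a0 (gspecC rc idfun (exc o) w c) nzc).
Qed.


Let eq_central w i j l : on_curve (exc None) w -> uniq [:: i; j; l] ->
    w (enum_rank ((None, j, None) : I)) != 0 ->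
  local_equation iota g (exc None) w (Rq (Some j) / Wq).
Proof.
by move=> ow ijl nz; have [] := chart_central char2 nz_e dvd_quartic nzY quarticY ow ijl erefl nz.
Qed.

Let eq_arm_A w i j l : on_curve (exc (Some i)) w -> uniq [:: i; j; l] ->
    w (enum_rank ((None, j, None) : I)) != 0 ->
  local_equation iota g (exc (Some i)) w (Y i / Y j).
Proof.
by move=> ow ijl nz; have [] := chart_arm_A char2 nz_e dvd_quartic nzY quarticY ow ijl erefl nz.
Qed.

Let eq_arm_B w i j l : on_curve (exc (Some i)) w -> uniq [:: i; j; l] ->
    w (enum_rank ((None, j, Some j) : I)) != 0 ->
  local_equation iota g (exc (Some i)) w (Y j).
Proof.
by move=> ow ijl nz; have [] := chart_arm_B char2 nz_e dvd_quartic nzY quarticY ow ijl erefl nz.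
Qed.

Let res_V o i j b : exc o (enum_rank ((None, j, b) : I)) != 0 ->
  gspec iota rc g (exc o) (Y i / Y j) (curve_pt 1 u o (None, i, b) / curve_pt 1 u o (None, j, b)).
Proof.
by move=> nz; rewrite -!excE'; exact: (@spec_V _ m e _ iota Y nz_e nzY quarticY _ rc (exc o) i j None b nz).
Qed.

Let res_R o j b b' : exc o (enum_rank ((None, j, b) : I)) != 0 ->
  gspec iota rc g (exc o) (Rq b' / Rq b) (curve_pt 1 u o (None, j, b') / curve_pt 1 u o (None, j, b)).
Proof.
by move=> nz; rewrite -!excE'; exact: (@spec_R _ m e _ iota Y nz_e nzY quarticY _ rc (exc o) j None b b' nz).
Qed.

Let res_eq1 o : restricts_to iota g (exc o) 1 1.
Proof. by apply/restricts_toP; apply: gspec1. Qed.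

(** The local equation Y_j^2 / W with j = [o1] serves everywhere except where Y_j vanishes on the
    line. There j = [o0] is used, and the quotient of the two equations restricts to u^2, which has
    order -2 at infinity. *)
Lemma intersection_central : intersection_number iota g (exc None) (exc None) (-2).
Proof.
pose h0 := Rq (Some o1) / Wq.
have nzh0 : h0 != 0 by rewrite mulf_neq0 ?invr_eq0 ?expf_neq0.
have ow0 : on_curve (exc None) (exc_point None 0 1) by apply: exc_point_on; rewrite oner_neq0 orbT.
exists h0 => //; apply: (cycle_degree1 (p := exc_point None 0 1)) => //.
  exists (Rq (Some o0) / Wq), (u ^+ 2); split.
  - by apply: (@eq_central _ o1 o0 o2) => //; rewrite exc_pointE /= oner_neq0.
  - apply/restricts_toP.
    have := gspecX 2 (@res_V None o0 o1 None _).
    rewrite excE' /= oner_neq0 divr1 /h0 => /(_ isT); congr gspec.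
    have gen (a b w : K) : b != 0 -> w != 0 -> (a / b) ^+ 2 = a ^+ 2 / w / (b ^+ 2 / w).
      by move=> nzb nzw; field; rewrite nzb nzw.
    exact: gen.
  - have := @exc_order_inf None (exc_point None 0 1) (-2) 1 ow0 (oner_neq0 _).
    rewrite exc_pointE rmorph1 mul1r /=; exact.
move=> w ow; have [a [b [nzab wE]]] := exc_onE ow.
have [a0|nza] := eqVneq a 0.
  left; move: nzab; rewrite a0 eqxx /= => nzb.
  by apply: (exc_point_proj ow wE nzb); rewrite ?mulr0 ?mulr1.
right; exists h0, 1; split.
- by apply: (@eq_central _ o0 o1 o2) => //; rewrite wE.
- by rewrite divff //; apply: res_eq1.
- exact: exc_order1.
Qed.

(** The equation v_i serves wherever h is finite. At the remaining point the equation is Y_j, and by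
    [rel_B1] Y_j / v_i is e v_l h^2, which restricts to e u^2, of order -2 at infinity. *)
Lemma intersection_arm i : intersection_number iota g (exc (Some i)) (exc (Some i)) (-2).
Proof.
pose j := nxt i; pose l := third i; have ijl : uniq [:: i; j; l] := uniq_third i.
pose h0 := Y i / Y j.
have nzh0 : h0 != 0 by rewrite mulf_neq0 ?invr_eq0.
have ji : (j == i) = false := negbTE (nxt_neq i).
have li : (l == i) = false by rewrite /l; elim/ord3_ind: (i).
have ow0 : on_curve (exc (Some i)) (exc_point (Some i) 0 1).
  by apply: exc_point_on; rewrite oner_neq0 orbT.
exists h0 => //; apply: (cycle_degree1 (p := exc_point (Some i) 0 1)) => //.
  exists (Y j), (rc e * u ^+ 2); split.
  - by apply: (eq_arm_B ow0 ijl); rewrite exc_pointE /= ji oner_neq0.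
  - apply/restricts_toP.
    have nzE : exc (Some i) (enum_rank ((None, j, Some j) : I)) != 0 by rewrite excE' /= ji.
    have lP := res_V l nzE; have hP := res_R None nzE.
    rewrite /= ji li /= (divff nzu) in lP; rewrite /= ji /= mul1r in hP.
    have := gspec_div _ (gspecM (gspecC iota rc g (exc (Some i)) e) lP) (gspecX 2 hP).
    rewrite mulr1 exprVn invrK => /(_ (invr_neq0 (expf_neq0 2 nzu))).
    congr gspec; have nzh : Wq / Rq (Some j) != 0 by rewrite mulf_neq0 ?invr_eq0 ?expf_neq0.
    have gen (E vi vl h2 yj : K) : h2 != 0 -> vi != 0 ->
        E * vi * vl = h2 * yj -> E * vl / h2 = yj / vi.
      by move=> nzh2 nzvi rel; apply/eqP; rewrite eqr_div // mulrAC rel mulrC.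
    by apply: gen (rel_B1 nzY quarticY ijl) => //; rewrite expf_neq0.
  - have := @exc_order_inf (Some i) (exc_point (Some i) 0 1) (-2) e ow0 nz_e.
    by rewrite exc_pointE curve_pt_a; apply.
move=> w ow; have [a [b [nzab wE]]] := exc_onE ow.
have [a0|nza] := eqVneq a 0.
  left; move: nzab; rewrite a0 eqxx /= => nzb.
  by apply: (exc_point_proj ow wE nzb); rewrite ?mulr0 ?mulr1.
right; exists h0, 1; split.
- by apply: (eq_arm_A ow ijl); rewrite wE /= ji.
- by rewrite divff //; apply: res_eq1.
- exact: exc_order1.
Qed.

Lemma intersection_arm_central i :
  intersection_number iota g (exc (Some i)) (exc None) 1.
Proof.
pose j := nxt i; pose l := third i; have ijl : uniq [:: i; j; l] := uniq_third i.
have k2 : 1 + 1 = 0 :> k by rewrite addrr_pchar2.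
(* (a0 : b0) is the zero of [line_coord] at index i, where the arm meets the central line. *)
pose a0 : k := if i == o1 then 0 else 1; pose b0 : k := if i == o0 then 0 else 1.
have nzab0 : (a0 != 0) || (b0 != 0).
  by rewrite /a0 /b0; elim/ord3_ind: (i); rewrite /= oner_neq0 ?orbT.
have ow0 : on_curve (exc None) (exc_point None a0 b0) by apply: exc_point_on.
have ow1 : on_curve (exc (Some i)) (exc_point None a0 b0).
  apply: (@exc_onI k (Some i) _ 1 0); first by rewrite oner_neq0.
  move=> [[[x|] p] [y|]]; rewrite exc_pointE //=; first by case: ifP.
  rewrite /a0 /b0; elim/ord3_ind: (i); elim/ord3_ind: p; rewrite /line_coord /= ?addr0 ?add0r //.
have nzpt : exc_point None a0 b0 (enum_rank ((None, j, None) : I)) != 0.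
  rewrite exc_pointE /a0 /b0 /j; elim/ord3_ind: (i);
  by rewrite /line_coord /= ?oner_neq0 ?addr0 ?add0r ?oner_neq0.
exists 1; first exact: oner_neq0.
apply: (cycle_degree1 (p := exc_point None a0 b0)) => //.
  exists (Y i / Y j), (line_coord 1 u i / line_coord 1 u j); split.
  - exact: (eq_arm_A ow1 ijl).
  - rewrite divr1; apply/restricts_toP; apply: (@res_V None i j None).
    by rewrite excE'; apply: line_coord_neq0.
  - rewrite /j; move: (ow0); rewrite /a0 /b0; elim/ord3_ind: (i) => ow;
      rewrite /line_coord /= in ow *.
    + have := @exc_order_zero None (exc_point None 1 0) 1 0 ow.
      by rewrite !exc_pointE /= mul0r oner_neq0 rmorph0 subr0 expr1z divr1; apply.
    + have := @exc_order_inf None (exc_point None 0 1) 1 1 ow (oner_neq0 _).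
      by rewrite exc_pointE curve_pt_a rmorph1 !mul1r exprN1; apply.
    + have := @exc_order_zero None (exc_point None 1 1) 1 1 ow.
      rewrite !exc_pointE /= mul1r oner_neq0 rmorph1 expr1z divr1 (ratfun_oppr char2).
      by rewrite [1 + u]addrC; apply.
move=> w ow; have [a [b [nzab wE]]] := exc_onE ow.
have [li0|nzli] := eqVneq (line_coord a b i) 0.
  left; have [c [nzc aE bE]] : exists c, [/\ c != 0, a = c * a0 & b = c * b0].
    move: li0 nzab; rewrite /a0 /b0 /line_coord; elim/ord3_ind: (i) => /= [b0'|a0'|ab0].
    - by rewrite b0' eqxx orbF => nza; exists a; rewrite mulr1 mulr0.
    - by rewrite a0' eqxx => nzb; exists b; rewrite mulr1 mulr0.
    - have -> : b = a by apply/eqP; rewrite -[X in b == X](k_oppr char2) -addr_eq0 addrC ab0.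
      by rewrite orbb => nza; exists a; rewrite mulr1.
  exact: (exc_point_proj ow wE nzc aE bE).
right; exists 1, 1; split; last exact: exc_order1.
- apply: local_equation1; first exact: (exc_on_model char2 nz_e dvd_quartic ow).
  move=> /exc_onE[c [d [_ wE']]]; case/eqP: nzli.
  by have := wE (None, i, None); rewrite wE' /= eqxx => <-.
- by rewrite divr1; apply: res_eq1.
Qed.

(** The definition of the intersection number is not symmetric: now the degree is taken on the arm,
    where h restricts to u. *)
Lemma intersection_central_arm i :
  intersection_number iota g (exc None) (exc (Some i)) 1.
Proof.
pose j := nxt i; pose l := third i; have ijl : uniq [:: i; j; l] := uniq_third i.
have k2 : 1 + 1 = 0 :> k by rewrite addrr_pchar2.
have ji : (j == i) = false := negbTE (nxt_neq i).
have ow0 : on_curve (exc (Some i)) (exc_point (Some i) 1 0).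
  by apply: exc_point_on; rewrite oner_neq0.
have ow1 : on_curve (exc None) (exc_point (Some i) 1 0).
  apply: (@exc_onI k None _ (if i == o1 then 0 else 1) (if i == o0 then 0 else 1)).
    by elim/ord3_ind: (i); rewrite /= oner_neq0 ?orbT.
  move=> [[[x|] p] [y|]]; rewrite exc_pointE //=; first by case: ifP.
  by elim/ord3_ind: (i); elim/ord3_ind: p; rewrite /line_coord /= ?addr0 ?add0r ?k2.
exists 1; first exact: oner_neq0.
apply: (cycle_degree1 (p := exc_point (Some i) 1 0)) => //.
  exists (Rq (Some j) / Wq), u; split.
  - by apply: (eq_central ow1 ijl); rewrite exc_pointE /= ji oner_neq0.
  - rewrite divr1; apply/restricts_toP.
    have nzE : exc (Some i) (enum_rank ((None, j, None) : I)) != 0 by rewrite excE' /= ji oner_neq0.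
    by have := res_R (Some j) nzE; rewrite /= ji /= divr1.
  - have := @exc_order_zero (Some i) (exc_point (Some i) 1 0) 1 0 ow0.
    rewrite !exc_pointE curve_pt_a curve_pt_b mul0r oner_neq0 => /(_ isT erefl).
    by rewrite rmorph0 subr0 expr1z.
move=> w ow; have [a [b [nzab wE]]] := exc_onE ow.
have [b0|nzb] := eqVneq b 0.
  left; move: nzab; rewrite b0 eqxx orbF => nza.
  by apply: (exc_point_proj ow wE nza); rewrite ?mulr0 ?mulr1.
right; exists 1, 1; split; last exact: exc_order1.
- apply: local_equation1; first exact: (exc_on_model char2 nz_e dvd_quartic ow).
  move=> /exc_onE[c [d [_ wE']]]; case/eqP: nzb.
  by have := wE (None, j, Some j); rewrite wE' /= ji /= => <-.
- by rewrite divr1; apply: res_eq1.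
Qed.

Lemma intersection_arms i l : i != l ->
  intersection_number iota g (exc (Some i)) (exc (Some l)) 0.
Proof.
move=> il; exists 1; first exact: oner_neq0.
apply: cycle_degree0 => w ow; exists 1, 1; split; last exact: exc_order1.
- apply: local_equation1; first exact: (exc_on_model char2 nz_e dvd_quartic ow).
  have [a [b [nzab wE]]] := exc_onE ow; move=> /exc_onE[c [d [_ wE']]].
  (* These two entries vanish on arm i, while on arm l they are the homogeneous parameters a and
     b. *)
  have := (wE (None, i, None), wE (None, i, Some i)); rewrite !wE' /= (negbTE il) eqxx /=.
  by case=> ea eb; move: nzab; rewrite -ea -eb eqxx.
- by rewrite divr1; apply: res_eq1.
Qed.

End Intersections.

(** * The D4 singularity *)

Lemma gspec_self (k K : fieldType) (f : {rmorphism k -> K}) n (g : 'I_n -> K) a r :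
  gspec f f g g a r -> r = a.
Proof. by move=> [d [F [G [_ _ _ -> ->]]]]. Qed.

(** The functions expressible as ratios of forms of equal degree are those that specialize from g to
    g itself, and they form a field. *)
Lemma generated_model (k K : fieldType) (f : {rmorphism k -> K}) n (g : 'I_n -> K)
    (S : K -> Prop) : nonzero_vec g ->
    (forall P : K -> Prop, (forall c, P (f c)) ->
       (forall a b, P a -> P b -> P (a + b)) -> (forall a b, P a -> P b -> P (a * b)) ->
       (forall a, P a -> P a^-1) -> (forall a, S a -> P a) -> forall a, P a) ->
    (forall a, S a -> exists r, gspec f f g g a r) ->
  projective_model f g.
Proof.
move=> nzg gen Sg; split=> // a.
have sp : specializes f f g g by [].
suff [d [F [G [hF hG nzG -> _]]]] : gspec f f g g a a.
  by exists d, F, G; split=> //; apply/eqP.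
apply: (gen (fun a => gspec f f g g a a)) => [c|b c|b c|b|b /Sg[r br]].
- exact: gspecC.
- exact: gspecD.
- exact: gspecM.
- have [->|nzb] := eqVneq b 0; first by rewrite invr0 => _; apply: gspec0.
  exact: gspecV.
- by rewrite -{2}(gspec_self br).
Qed.

(** Homogeneous relations between the xi hold between their ratios, and pass to the values of these
    ratios at w. *)
Lemma cspec_specializes (k K : fieldType) (f : {rmorphism k -> K}) n n'
    (g : 'I_n -> K) w (xi : 'I_n' -> K) p m : specializes f idfun g w ->
    xi m != 0 -> p m != 0 -> (forall i, cspec f g w (xi i / xi m) (p i / p m)) ->
  specializes f idfun xi p.
Proof.
move=> gw nzx nzp ratio d F hF; rewrite (mmap_ratio f nzx hF) (mmap_ratio idfun nzp hF).
move/eqP; rewrite mulf_eq0 expf_eq0 (negbTE nzx) andbF /= => /eqP F0.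
have : cspec f g w (mmap f (fun i => xi i / xi m) F) (mmap idfun (fun i => p i / p m) F).
  apply: (mmap_rel (T := cspec f g w)) => // *.
  - exact: gspecC.
  - exact: gspecD.
  - exact: gspecM.
by rewrite F0 => /(gspec_fun gw (gspec0 _ _ _ _)) <-; rewrite mulr0.
Qed.

Section Resolution.
Variables (k : closedFieldType) (m : 'I_3 -> k) (e : k).
Variables (K : fieldType) (iota : {rmorphism k -> K}) (Y : 'I_3 -> K).
Local Notation rc := (ratfun_const k).
Local Notation u := (FracField.tofrac ('X : {poly k}) : ratfun k).
Local Notation g := (res_generic m iota Y).
Local Notation exc := (@exc k).

Hypothesis char2 : 2 \in [pchar k].
Hypothesis nz_e : e != 0.
Hypothesis dvd_quartic : forall P : {mpoly k[3]}, mmap iota Y P = 0 ->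
  forall (A : comNzRingType) (f : {rmorphism k -> A}) z,
  exists b, mmap f z P = b * quartic (fun=> 1) m e f 1 z.
Hypothesis nzY : forall i, Y i != 0.
Hypothesis quarticY : quartic (fun=> 1) m e iota 1 Y = 0.
Hypothesis genY : forall P : K -> Prop, (forall c, P (iota c)) ->
  (forall a b, P a -> P b -> P (a + b)) -> (forall a b, P a -> P b -> P (a * b)) ->
  (forall a, P a -> P a^-1) -> (forall i, P (Y i)) -> forall a, P a.

Variables (al : 'I_3 -> k) (i0 : 'I_4).
Hypothesis nz_al : forall j, al j != 0.

(** In terms of [Y] the linear form is a plain sum; dividing by [al] returns to the coordinates of
    the quartic. *)
Definition vertex_generic : 'I_4 -> K := hom_pt i0 1 (fun j => Y j / iota (al j)).
Local Notation xi := vertex_generic.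
Local Notation P := (@vertex k i0).

Local Notation Wq := (Wq m iota Y).
Local Notation Rq := (Rq m iota Y).

Let alo (a : option 'I_3) : k := if a is Some j then al j else 1.
Let nz_alo a : alo a != 0. Proof. by case: a => [j|] /=; rewrite ?oner_neq0. Qed.

Let xiE i : xi i = Xq Y (unlift i0 i) / iota (alo (unlift i0 i)).
Proof. by rewrite /xi /hom_pt; case: unlift => [j|] //=; rewrite rmorph1 divr1. Qed.

Let sp_XV := fun L f h a a' j b nz => @spec_XV k m e K iota Y nz_e nzY quarticY L f h a a' j b nz.
Let nzR b : Rq b != 0 := Rq_neq0 nz_e nzY quarticY b.

Let nz_g t : g (enum_rank t) != 0.
Proof. by rewrite res_genericE !mulf_neq0 ?Xq_neq0. Qed.

Lemma res_projective_model : projective_model iota g.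
Proof.
apply: (@generated_model _ _ _ _ _ (fun a => exists i, a = Y i)) => [|Q QC QD QM QV QY|a [i ->]].
- by exists (enum_rank ((None, o0, None) : I)).
- by apply: (genY QC QD QM QV) => i; apply: QY; exists i.
- have := @spec_Y _ m e _ iota Y nz_e nzY quarticY _ iota g i o0 None (nz_g _).
  by move=> H; eexists; exact: H.
Qed.

Lemma vertex_projective_model : projective_model iota xi.
Proof.
have nz0 : xi i0 != 0 by rewrite /xi hom_pt0 oner_neq0.
apply: (@generated_model _ _ _ _ _ (fun a => exists i, a = Y i)) => [|Q QC QD QM QV QY|a [j ->]].
- by exists i0.
- by apply: (genY QC QD QM QV) => i; apply: QY; exists i.
- have := gspecM (gspecC iota iota xi xi (al j)) (gspec_ratio iota iota xi (lift i0 j) nz0).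
  rewrite /xi hom_pt0 hom_pt_lift divr1 mulrC divfK ?fmorph_eq0 // => H.
  by eexists; exact: H.
Qed.

Let index_of (a : option 'I_3) : 'I_4 := if a is Some j then lift i0 j else i0.
Let unlift_index a : unlift i0 (index_of a) = a.
Proof. by case: a => [j|] /=; rewrite ?liftK ?unlift_none. Qed.

(** The image is read off from the first factor, with the indices of the other two fixed at a
    nonzero coordinate. *)
Lemma res_over w : on_model iota g w ->
  exists2 p, on_model iota xi p & lies_over iota g w xi p.
Proof.
move=> [[n nzn] gw]; move: nzn; rewrite -(enum_valK n).
case: (enum_val n) => [[a j] b] nz.
pose p i := w (enum_rank ((unlift i0 i, j, b) : I)) / w (enum_rank ((a, j, b) : I))
  / alo (unlift i0 i).
pose l := index_of a.
have nzp : p l != 0 by rewrite /p unlift_index !mulf_neq0 ?invr_eq0.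
have nzx : xi l != 0 by rewrite xiE mulf_neq0 ?invr_eq0 ?fmorph_eq0 // Xq_neq0.
have ratio i : cspec iota g w (xi i / xi l) (p i / p l).
  have := gspecM (sp_XV idfun (unlift i0 i) nz) (gspecC iota idfun g w (alo a / alo (unlift i0 i))).
  have gen (F : fieldType) (x y z t : F) : y != 0 -> z != 0 -> t != 0 ->
    x / y * (z / t) = x / t / (y / z) by move=> ? ? ?; field; apply/and3P.
  have nzi c : iota (alo c) != 0 by rewrite fmorph_eq0.
  rewrite fmorph_div gen ?(Xq_neq0 nzY) // !xiE unlift_index.
  suff -> : p i / p l = w (enum_rank ((unlift i0 i, j, b) : I)) /
      w (enum_rank ((a, j, b) : I)) * (alo a / alo (unlift i0 i)) by [].
  have gen2 (x z t : k) : z != 0 -> t != 0 -> x / t / (1 / z) = x * (z / t).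
    by move=> ? ?; rewrite div1r invrK; field.
  by rewrite /p unlift_index (divff nz) gen2.
have xp := cspec_specializes gw nzx nzp ratio.
exists p; first by split=> //; exists l.
by apply/(lies_overP gw xp); apply: (cspec_lies_over gw xp nzp ratio).
Qed.

Let vertex0 : P i0 = 1. Proof. by rewrite /vertex eqxx. Qed.
Let vertex_lift j : P (lift i0 j) = 0.
Proof. by rewrite /vertex (negbTE (neq_lift _ _)). Qed.

(** The vertex is the image of a point of the central curve, so relations between the xi specialize
    there. *)
Lemma vertex_on_model : on_model iota xi P.
Proof.
have nz1 : (1 != 0 :> k) || (0 != 0 :> k) by rewrite oner_neq0.
have [w ow] : exists w, on_curve (exc None) w.
  by exists (exc_point None 1 0); apply: exc_point_on.
have over : over_vertex m iota Y w := exc_over_vertex nz_e nzY quarticY ow.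
have [_ gw] := exc_on_model char2 nz_e dvd_quartic ow.
have nzx : xi i0 != 0 by rewrite /xi hom_pt0 oner_neq0.
have nzp : P i0 != 0 by rewrite /vertex eqxx oner_neq0.
split; first by exists i0.
apply: (cspec_specializes gw nzx nzp) => i.
rewrite vertex0 /xi hom_pt0 !divr1; case: (unliftP i0 i) => [j|] ->.
  rewrite vertex_lift hom_pt_lift -(mul0r (al j)^-1) -fmorphV.
  by apply: gspecM; [exact: (over j) | exact: gspecC].
by rewrite vertex0 hom_pt0; apply: gspec1.
Qed.

Lemma over_vertexP w : on_model iota g w ->
  (lies_over iota g w xi P <-> over_vertex m iota Y w).
Proof.
move=> [nzw gw]; have [_ xp] := vertex_on_model.
have nzx : xi i0 != 0 by rewrite /xi hom_pt0 oner_neq0.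
have nzp : P i0 != 0 by rewrite /vertex eqxx oner_neq0.
rewrite (lies_overP gw xp); split=> [dom j|over].
  apply: dom; have := gspecM (gspecC iota idfun xi P (al j)) (gspec_ratio iota idfun xi (lift i0 j) nzp).
  rewrite /xi hom_pt0 hom_pt_lift divr1 mulrC divfK ?fmorph_eq0 //.
  by rewrite vertex_lift mul0r mulr0.
apply: (cspec_lies_over gw xp nzp) => i.
rewrite vertex0 /xi hom_pt0 !divr1; case: (unliftP i0 i) => [j|] ->.
  rewrite vertex_lift hom_pt_lift -(mul0r (al j)^-1) -fmorphV.
  by apply: gspecM; [exact: (over j) | exact: gspecC].
by rewrite vertex0 hom_pt0; apply: gspec1.
Qed.

Lemma over_vertex_regular w : on_model iota g w -> over_vertex m iota Y w ->
  regular_surface_point iota g w.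
Proof.
move=> gw over.
have [o ow] := over_vertex_curve char2 nz_e nzY quarticY gw over.
have [a [b [nzab wE]]] := exc_onE ow.
case: o ow wE => [i|] ow wE.
  have ji : (nxt i == i) = false := negbTE (nxt_neq i).
  have [a0|nza] := eqVneq a 0.
    move: nzab; rewrite a0 eqxx /= => nzb.
    have nz : w (enum_rank ((None, nxt i, Some (nxt i)) : I)) != 0 by rewrite wE /= ji.
    by have [] := chart_arm_B char2 nz_e dvd_quartic nzY quarticY ow (uniq_third i) erefl nz.
  have nz : w (enum_rank ((None, nxt i, None) : I)) != 0 by rewrite wE /= ji.
  by have [] := chart_arm_A char2 nz_e dvd_quartic nzY quarticY ow (uniq_third i) erefl nz.
have u1 : uniq [:: o0; o1; o2] by []; have u0 : uniq [:: o1; o0; o2] by [].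
have [a0|nza] := eqVneq a 0.
  move: nzab; rewrite a0 eqxx /= => nzb.
  have nz : w (enum_rank ((None, o0, None) : I)) != 0 by rewrite wE.
  by have [] := chart_central char2 nz_e dvd_quartic nzY quarticY ow u0 erefl nz.
have nz : w (enum_rank ((None, o1, None) : I)) != 0 by rewrite wE.
by have [] := chart_central char2 nz_e dvd_quartic nzY quarticY ow u1 erefl nz.
Qed.

(** Away from the vertex some Y_j is nonzero at p. Then Y_q / Y_j, 1 / Y_j and W / Y_j^2 lie in the
    local ring at p, so the inverse map is defined there. *)
Lemma res_iso_away w p : on_model iota g w -> on_model iota xi p ->
  lies_over iota g w xi p -> ~ proj_eq p P -> same_local_ring iota g w xi p.
Proof.
move=> [nzw gw] [nzp xp] /(lies_overP gw xp) dom pP.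
have [j nzpj] : exists j, p (lift i0 j) != 0.
  apply: NNPP => none; apply: pP; have p0 j : p (lift i0 j) = 0.
    by apply/eqP; apply: contraT => nz; case: none; exists j.
  have [i nzpi] := nzp; exists (p i0).
    by move: nzpi; case: (unliftP i0 i) => [j|] ->; rewrite ?p0 ?eqxx.
  move=> i'; case: (unliftP i0 i') => [j|] ->.
    by rewrite p0 vertex_lift mulr0.
  by rewrite vertex0 mulr1.
pose O a := exists c, cspec iota xi p a c.
have OC c : O (iota c) by exists c; apply: gspecC.
have OM a b : O a -> O b -> O (a * b).
  by move=> [c ac] [d bd]; exists (c * d); apply: gspecM.
have OD a b : O a -> O b -> O (a + b).
  by move=> [c ac] [d bd]; exists (c + d); apply: gspecD.
have nzxj : xi (lift i0 j) = Y j / iota (al j) by rewrite /xi hom_pt_lift.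
have nzia q : iota (al q) != 0 by rewrite fmorph_eq0.
have OX a : O (Xq Y a / Y j).
  have : O (xi (index_of a) / xi (lift i0 j)).
    by exists (p (index_of a) / p (lift i0 j)); apply: gspec_ratio.
  have := OC (alo a / al j); rewrite nzxj xiE unlift_index fmorph_div => O1 O2.
  have := OM _ _ O2 O1; congr O.
  have nzia' : iota (alo a) != 0 by rewrite fmorph_eq0.
  have gen (x y z t : K) : y != 0 -> z != 0 -> t != 0 -> x / y / (z / t) * (y / t) = x / z.
    by move=> ? ? ?; field; apply/and3P.
  exact: gen.
have OV q : O (Y q / Y j) := OX (Some q).
have OR b : O (Rq b / Y j ^+ 2).
  case: b => [q|]; first by rewrite /= -expr_div_n expr2; apply: (OM).
  have gen (F : fieldType) (y0 y1 y2 t a b c : F) : t != 0 ->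
    (1 * (1 * y0 + 1 * y1 + 1 * y2) + (a * (y1 * y2) + b * (y0 * y2) + c * (y0 * y1))) / t ^+ 2
    = (y0 / t + y1 / t + y2 / t) * (1 / t) + (a * (y1 / t * (y2 / t))
      + b * (y0 / t * (y2 / t)) + c * (y0 / t * (y1 / t))).
    by move=> nzt; field.
  rewrite /= /Wq /quad_W /quad_M rmorph1 gen //.
  apply: (OD); first by apply: (OM); [apply: (OD); [apply: (OD)|] | exact: (OX None)].
  by apply: (OD); [apply: (OD)|]; apply: (OM) => //; apply: (OM).
(* The coordinate Y_j Y_j Y_j^2; every other coordinate is a multiple of it in the local ring at
   p. *)
pose t1 : I := (Some j, j, Some j).
have Og n : O (g n / g (enum_rank t1)).
  rewrite -(enum_valK n) !res_genericE; case: (enum_val n) => [[a q] b] /=.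
  have gen (F : fieldType) (x y z t : F) : t != 0 ->
    x * y * z / (t * t * t ^+ 2) = x / t * (y / t) * (z / t ^+ 2).
    by move=> nzt; field.
  by rewrite gen //; apply: (OM) => //; apply: (OM).
have nzw1 : w (enum_rank t1) != 0.
  have [n nzn] := nzw; apply: contraTneq isT => w1.
  have [c /dom nc] := Og n.
  have := gspecM nc (gspec_ratio iota idfun g (enum_rank t1) nzn).
  rewrite w1 mul0r mulr0 mulrA divfK // divff ?(specializes_coord gw nzn) //.
  by move=> /(gspec_fun gw (gspec1 _ _ _ _))/eqP; rewrite oner_eq0.
apply: same_local_ringP => a c; split; first exact: dom.
apply: (cspec_lies_over xp gw nzw1) => n.
have [d nd] := Og n.
by rewrite (gspec_fun gw (gspec_ratio iota idfun g n nzw1) (dom _ _ nd)).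
Qed.

Lemma res_resolution : resolution_at iota g xi P.
Proof.
split.
- exact: res_projective_model.
- exact: res_over.
- exact: res_iso_away.
- by move=> w gw /(over_vertexP gw); apply: over_vertex_regular.
Qed.

End Resolution.

(** * Minimality of the resolution *)

Section SameIdeal.
Variables (k : closedFieldType) (K : fieldType) (f : {rmorphism k -> K}) (n : nat).
Variables (g : 'I_n -> K) (D E : 'I_n -> ratfun k).
Local Notation rc := (ratfun_const k).
Hypothesis DE : forall d F, F \is d.-homog -> hvanish rc D F <-> hvanish rc E F.

Lemma same_ideal_on_curve w : on_curve D w <-> on_curve E w.
Proof. by split=> -[nzw ow]; split=> // d F hF F0; apply: (ow _ _ hF); apply/(DE hF). Qed.

Lemma same_ideal_local_equation w eps :
  local_equation f g D w eps -> local_equation f g E w eps.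
Proof.
move=> eqD a; rewrite -eqD.
by split=> -[d [F [G [hF hG EF nzG aE]]]]; exists d, F, G; split=> //; apply/(DE hF).
Qed.

Lemma same_ideal_res a r : r != 0 -> gspec f rc g D a r ->
  exists2 r', r' != 0 & gspec f rc g E a r'.
Proof.
move=> nzr [d [F [G [hF hG nzG aE rE]]]].
have nzF : mmap rc D F != 0 by apply: contra_neq nzr; rewrite rE => ->; rewrite mul0r.
have tr P : P \is d.-homog -> mmap rc D P != 0 -> mmap rc E P != 0.
  by move=> hP; apply: contra_neq => /(DE hP).
exists (mmap rc E F / mmap rc E G).
  by apply: mulf_neq0; [exact: tr hF nzF | rewrite invr_eq0; exact: tr hG nzG].
by exists d, F, G; split; [exact: hF | exact: hG | exact: tr hG nzG | exact: aE |].
Qed.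

End SameIdeal.

Section Minimality.
Variables (k : closedFieldType) (m : 'I_3 -> k) (e : k).
Variables (K : fieldType) (iota : {rmorphism k -> K}) (Y : 'I_3 -> K).
Local Notation rc := (ratfun_const k).
Local Notation u := (FracField.tofrac ('X : {poly k}) : ratfun k).
Local Notation g := (res_generic m iota Y).
Local Notation exc := (@exc k).

Hypothesis char2 : 2 \in [pchar k].
Hypothesis nz_e : e != 0.
Hypothesis dvd_quartic : forall P : {mpoly k[3]}, mmap iota Y P = 0 ->
  forall (A : comNzRingType) (f : {rmorphism k -> A}) z,
  exists b, mmap f z P = b * quartic (fun=> 1) m e f 1 z.
Hypothesis nzY : forall i, Y i != 0.
Hypothesis quarticY : quartic (fun=> 1) m e iota 1 Y = 0.

Local Notation Wq := (Wq m iota Y).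
Local Notation Rq := (Rq m iota Y).

Let nzu : u != 0. Proof. by rewrite tofrac_eq0 polyX_eq0. Qed.
Let nzW : Wq != 0 := Wq_neq0 nz_e nzY quarticY.

(* Up to units the local equations of an exceptional curve differ by squares,
   so that its self-intersection number is even. *)
Lemma local_equation_square o : exists2 h0 : K, h0 != 0 &
  forall w, on_curve (exc o) w -> exists eta v c s rho,
  [/\ local_equation iota g (exc o) w eta, eta = h0 * (v * s ^+ 2),
      cspec iota g w v c /\ c != 0, rho != 0 & gspec iota rc g (exc o) s rho].
Proof.
case: o => [i|].
  pose j := nxt i; pose l := third i; have ijl : uniq [:: i; j; l] := uniq_third i.
  have ji : (j == i) = false := negbTE (nxt_neq i).
  have li : (l == i) = false by rewrite /l; elim/ord3_ind: (i).
  exists (Y i / Y j) => [|w ow]; first by rewrite mulf_neq0 ?invr_eq0.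
  have [a [b [nzab wE]]] := exc_onE ow.
  have [b0|nzb] := eqVneq b 0.
    have nz : w (enum_rank ((None, j, None) : I)) != 0.
      by rewrite wE /= ji; move: nzab; rewrite b0 eqxx orbF.
    exists (Y i / Y j), 1, 1, 1, 1; split.
    - by have [] := chart_arm_A char2 nz_e dvd_quartic nzY quarticY ow ijl erefl nz.
    - by rewrite expr1n !mulr1.
    - by split; [exact: gspec1 | exact: oner_neq0].
    - exact: oner_neq0.
    - exact: gspec1.
  have nz : w (enum_rank ((None, j, Some j) : I)) != 0 by rewrite wE /= ji.
  (* By [rel_B1], Y_j is v_i times the unit e v_l times the square of h. *)
  exists (Y j), (iota e * (Y l / Y j)), (e * 1), (Rq (Some j) / Wq), u; split.
  - by have [] := chart_arm_B char2 nz_e dvd_quartic nzY quarticY ow ijl erefl nz.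
  - have gen (E vi vl h yj : K) : h != 0 -> vi != 0 ->
        E * vi * vl = h^-1 ^+ 2 * yj -> yj = vi * (E * vl * h ^+ 2).
      move=> nzh nzvi rel; transitivity (E * vi * vl * h ^+ 2); last by ring.
      by rewrite rel; field.
    apply: gen; rewrite ?mulf_neq0 ?invr_eq0 ?expf_neq0 //.
    by rewrite invf_div; exact: (rel_B1 nzY quarticY ijl).
  - split; last by rewrite mulr1.
    apply: gspecM; first exact: gspecC.
    have := @spec_V _ m e _ iota Y nz_e nzY quarticY _ idfun w l j None (Some j) nz.
    by rewrite /= !wE /= ji li /= divff //; apply.
  - exact: nzu.
  - have nzE : exc (Some i) (enum_rank ((None, j, None) : I)) != 0.
      by rewrite excE' /= ji oner_neq0.
    have := @spec_R _ m e _ iota Y nz_e nzY quarticY _ rc (exc (Some i)) j None None (Some j) nzE.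
    by rewrite /= !excE' /= ji /= divr1; apply.
exists (Rq (Some o1) / Wq) => [|w ow].
  by rewrite mulf_neq0 ?invr_eq0 ?expf_neq0.
have [a [b [nzab wE]]] := exc_onE ow.
have nzlc : line_coord 1 u o1 != 0 by exact: line_coord_neq0.
have [j [i [l [ijl nz]]]] : exists j i l, uniq [:: i; j; l] /\
    w (enum_rank ((None, j, None) : I)) != 0.
  have [a0|nza] := eqVneq a 0; last by exists o1, o0, o2; rewrite wE.
  by exists o0, o1, o2; rewrite wE; split=> //; move: nzab; rewrite a0 eqxx.
(* The equations for different j have the same denominator W and squares as numerators. *)
exists (Rq (Some j) / Wq), 1, 1, (Y j / Y o1), (line_coord 1 u j / line_coord 1 u o1); split.
- by have [] := chart_central char2 nz_e dvd_quartic nzY quarticY ow ijl erefl nz.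
- have gen (a' b' w' : K) : b' != 0 -> w' != 0 ->
    a' ^+ 2 / w' = b' ^+ 2 / w' * (1 * (a' / b') ^+ 2).
    by move=> nzb nzw; field; rewrite nzb nzw.
  exact: gen.
- by split; [exact: gspec1 | exact: oner_neq0].
- by apply: mulf_neq0; [apply: line_coord_neq0 | rewrite invr_eq0].
- have nzE : exc None (enum_rank ((None, o1, None) : I)) != 0 by rewrite excE'.
  have := @spec_V _ m e _ iota Y nz_e nzY quarticY _ rc (exc None) j o1 None None nzE.
  by rewrite !excE'; apply.
Qed.

(** Such a curve has the ideal of one of the exceptional curves. Hence the functions whose orders
    make up its self-intersection number are, up to units and squares, the restriction of the single
    function h0 / h. *)
Lemma no_minus_one_curve (E : 'I_N -> ratfun k) :
    smooth_rational_curve_of_square iota g E (-1) ->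
  ~ (forall w, on_curve E w -> over_vertex m iota Y w).
Proof.
move=> [[modelE isoE] gE [h nzh cyc]] over.
have [nzE _] := modelE.
have [o sub] : exists o, forall d F, F \is d.-homog ->
    hvanish rc (exc o) F -> hvanish rc E F.
  apply: curve_in_union => // w ow.
  have gw : on_model iota g w.
    by have [nzw spw] := ow; split=> //; exact: specializes_trans gE spw.
  exact: (over_vertex_curve char2 nz_e nzY quarticY gw (over w ow)).
have EE d F : F \is d.-homog -> hvanish rc (exc o) F <-> hvanish rc E F.
  move=> hF; split; first exact: (sub _ _ hF).
  exact: (lin_ideal_eq (exc_la_a k o) (exc_mu_a k o) (exc_la_b k o) (exc_mu_b k o) modelE sub hF).
have [h0 nzh0 eqs] := local_equation_square o.
pose mu w l := exists eps : K, exists r : ratfun k,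
  [/\ local_equation iota g E w eps, restricts_to iota g E (eps / h) r & order_at rc E w r l].
have key w l : on_curve E w -> mu w l -> exists r v c s,
    [/\ cspec rc E w v c, c != 0, s != 0, order_at rc E w r l /\ r != 0
      & exists2 y, gspec iota rc g E y (v * s ^+ 2) & gspec iota rc g E ((h0 / h) * y) r /\ y != 0].
  move=> ow [eps [r [eq_eps /restricts_toP res_r ord_r]]].
  have [nzw spw] := ow; have gw : specializes iota idfun g w := specializes_trans gE spw.
  have /eqs[eta [v [c [s [rho [eq_eta etaE [vc nzc] nzrho srho]]]]]] : on_curve (exc o) w.
    by apply/(same_ideal_on_curve EE).
  have {}eq_eta := same_ideal_local_equation EE eq_eta.
  have [rho' nzrho' srho'] := same_ideal_res EE nzrho srho.
  have O1 : local_ring iota g w 1 by apply/local_ringP; exists 1; apply: gspec1.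
  have /eq_eta[b1 /local_ringP[c1 bc1] epsE] : curve_ideal iota g E w eps.
    by apply/eq_eps; exists 1; rewrite ?mulr1.
  have /eq_eps[b2 /local_ringP[c2 bc2] etaE'] : curve_ideal iota g E w eta.
    by apply/eq_eta; exists 1; rewrite ?mulr1.
  have nzv := gspec_neq0 gw nzc vc; have nzs := gspec_neq0 gE nzrho' srho'.
  have nzeta : eta != 0 by rewrite etaE !mulf_neq0 ?expf_neq0.
  (* [eps] and [eta] generate the same ideal, so they differ by a unit. *)
  have b12 : b1 * b2 = 1 by apply: (mulfI nzeta); rewrite mulrA -epsE -etaE' mulr1.
  have nzc1 : c1 != 0.
    apply: contraTneq isT => c10; have := gspecM bc1 bc2; rewrite b12 c10 mul0r.
    by move=> /(gspec_fun gw (gspec1 _ _ _ _))/eqP; rewrite oner_eq0.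
  have [rv gvrv rvc] := gspec_mid spw (gspecM vc bc1).
  exists r, rv, (c * c1), rho'; split.
  - exact: rvc.
  - exact: mulf_neq0.
  - exact: nzrho'.
  - split; [exact: ord_r | exact: (order_at_neq0 isoE ow ord_r)].
  exists (v * b1 * s ^+ 2); first by apply: gspecM; [exact: gvrv | exact: gspecX].
  split; last by rewrite !mulf_neq0 ?expf_neq0 ?(gspec_neq0 gw nzc1 bc1).
  suff <- : eps / h = h0 / h * (v * b1 * s ^+ 2) by exact: res_r.
  by rewrite epsE etaE; field.
(* Every point of the curve has a value of [mu] or is projectively equal to a point that has one; a
   single such point is enough. *)
have [w1 [l1 [ow1 mu1]]] : exists w l, on_curve E w /\ mu w l.
  have [||w ow _] := @nonvanishing_point k N E 0 1 nzE.
  - exact: dhomog1.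
  - by rewrite /hvanish rmorph1 => /eqP; rewrite oner_eq0.
  have [r [p [l [pl _ cover _]]]] := cyc.
  case: (cover w ow) => [[i _]|mu0]; last by exists w, 0.
  by exists (p i), (l i); apply: pl.
have [r1 [v1 [c1 [s1 [v1c nzc1 nzs1 [_ nzr1] [y1 y1r [res1 nzy1]]]]]]] := key _ _ ow1 mu1.
have [_ sp1] := ow1.
(* That h0 / h has a nonzero restriction to the curve is not given; it is obtained by solving for it
   at this one point. *)
pose r0 := r1 / (v1 * s1 ^+ 2).
have nzv1 : v1 * s1 ^+ 2 != 0.
  exact: mulf_neq0 (gspec_neq0 sp1 nzc1 v1c) (expf_neq0 2 nzs1).
have nzr0 : r0 != 0 by exact: mulf_neq0 nzr1 (invr_neq0 nzv1).
have res0 : gspec iota rc g E (h0 / h) r0.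
  by have := gspec_div nzv1 res1 y1r; rewrite mulfK.
suff: ~~ odd `|(-1)%R : int| by [].
apply: (@rational_curve_even k N E isoE r0 mu nzr0 _ (-1) cyc) => w l ow.
move=> /(key _ _ ow)[r [v [c [s [vc nzc nzs [ord_r nzr] [y yr [res_r nzy]]]]]]].
exists v, c, s; split; [exact: vc | exact: nzc | exact: nzs |].
have val := gspecM res0 yr; have := gspec_fun gE res_r val.
by rewrite mulrC => <-.
Qed.

End Minimality.

Section Rescale.
Variables (k : fieldType) (al m : 'I_3 -> k) (e : k).
Hypothesis nz_al : forall j, al j != 0.

(** Coefficients after the substitution y_j = Y_j / al_j, which turns the linear form into a sum. *)
Definition rescaled_m (i : 'I_3) : k :=
  if i == o0 then m o0 * (al o1)^-1 * (al o2)^-1 else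
  if i == o1 then m o1 * (al o0)^-1 * (al o2)^-1 else
  m o2 * (al o0)^-1 * (al o1)^-1.

Definition rescaled_e : k := e * (al o0)^-1 * (al o1)^-1 * (al o2)^-1.

Lemma quartic_rescale (A : comNzRingType) (f : {rmorphism k -> A}) z :
  quartic al m e f 1 (fun j => f (al j)^-1 * z j) =
  quartic (fun=> 1) rescaled_m rescaled_e f 1 z.
Proof.
have ab j x : f (al j) * (f (al j)^-1 * x) = x.
  by rewrite mulrA -rmorphM divff ?nz_al // rmorph1 mul1r.
rewrite /quartic /quad_W /quad_M /rescaled_m /rescaled_e /= !ab.
by rewrite !rmorphM rmorph1; ring.
Qed.

End Rescale.

Lemma rdp_D4_quartic (k : closedFieldType) (al m : 'I_3 -> k) (e : k) (i0 : 'I_4) :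
    2 \in [pchar k] -> (forall j, al j != 0) -> (forall j, m j != 0) -> e != 0 ->
  rdp_D4 (d4_quartic al m e i0) (@vertex k i0).
Proof.
move=> char2 nz_al nz_m nz_e.
have [K [iota [y [nzy quartic_y gen_y dvd_y]]]] := function_field_exists nz_al nz_m nz_e.
pose Y j := iota (al j) * y j.
pose m' := rescaled_m al m; pose e' := rescaled_e al e.
have nzia j : iota (al j) != 0 by rewrite fmorph_eq0.
have yE j : iota (al j)^-1 * Y j = y j by rewrite /Y fmorphV mulKf.
have nz_e' : e' != 0 by rewrite /e' /rescaled_e !mulf_neq0 ?invr_eq0.
have nzY j : Y j != 0 by rewrite mulf_neq0.
have quarticY : quartic (fun=> 1) m' e' iota 1 Y = 0.
  rewrite -quartic_rescale // -quartic_y.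
  by rewrite /quartic /quad_W /quad_M !yE.
have dvd_quartic (P : {mpoly k[3]}) : mmap iota Y P = 0 ->
    forall (A : comNzRingType) (f : {rmorphism k -> A}) z,
    exists b, mmap f z P = b * quartic (fun=> 1) m' e' f 1 z.
  move=> P0 A f z.
  pose P' := mmap (@mpolyC 3 k) (fun j => al j *: 'X_j) P.
  have P'E (B : comNzRingType) (f' : {rmorphism k -> B}) x :
      mmap f' x P' = mmap f' (fun j => f' (al j) * x j) P.
    apply/esym; apply: rmorph_mmap => [c|j] /=; first by rewrite mmapC.
    by rewrite mmapZ mmapXU.
  have /dvd_y[H HE] : mmap iota y P' = 0 by rewrite P'E.
  exists (mmap f (fun j => f (al j)^-1 * z j) H).
  have -> : mmap f z P = mmap f (fun j => f (al j)^-1 * z j) P'.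
    rewrite P'E; apply: eq_mmap => j.
    by rewrite mulrA -rmorphM divff // rmorph1 mul1r.
  rewrite HE rmorphM /= -quartic_rescale //; congr (_ * _); apply/esym.
  apply: rmorph_quartic => [c||j] /=; first by rewrite mmapC.
    by rewrite rmorph1.
  by rewrite mmapXU.
have genY (P : K -> Prop) : (forall c, P (iota c)) ->
    (forall a b, P a -> P b -> P (a + b)) -> (forall a b, P a -> P b -> P (a * b)) ->
    (forall a, P a -> P a^-1) -> (forall i, P (Y i)) -> forall a, P a.
  move=> PC PD PM PV PY; apply: gen_y => // j.
  by rewrite -yE; apply: (PM) => //; apply: (PY j).
pose xi := vertex_generic iota Y al i0.
have xiE : xi =1 hom_pt i0 1 y.
  move=> i; rewrite /xi /vertex_generic /hom_pt; case: unlift => // j.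
  by rewrite /Y mulrC mulKf.
exists K, iota, xi, #|{: res_index}|, (res_generic m' iota Y).
(* The central vertex 0 of the diagram becomes [None], the outer vertices the three arms. *)
exists (fun i => exc (unlift ord0 i)).
have res := res_resolution char2 nz_e' dvd_quartic nzY quarticY genY i0 nz_al.
have onP := vertex_on_model char2 nz_e' dvd_quartic nzY quarticY al i0.
have overP := over_vertexP char2 nz_e' dvd_quartic nzY quarticY i0 nz_al.
split.
- split; last exact: onP.
  split; first exact: (vertex_projective_model genY i0 nz_al).
  move=> d F hF; rewrite /hvanish (eq_mmap _ _ xiE); split.
    by apply: d4_quartic_dvd hF => // P /dvd_y.
  case=> H ->; rewrite rmorphM /= mmap_d4_quartic hom_pt0.
  have -> : quartic al m e iota 1 (fun l => hom_pt i0 1 y (lift i0 l)) = 0.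
    rewrite -quartic_y; rewrite /quartic /quad_W /quad_M.
    by rewrite !hom_pt_lift.
  by rewrite mulr0.
- split=> // E sqE overE; apply: (no_minus_one_curve char2 nz_e' dvd_quartic nzY quarticY sqE).
  move=> w ow; have [_ gE _] := sqE; apply/overP; last exact: overE.
  by have [nzw spw] := ow; split=> //; exact: specializes_trans gE spw.
- move=> w gw; rewrite (overP w gw); split=> [over|[i ow]].
    have [o ow] := over_vertex_curve char2 nz_e' nzY quarticY gw over.
    exists (if o is Some j then lift ord0 j else ord0).
    by case: o ow => [j|]; rewrite ?liftK ?unlift_none.
  exact: (exc_over_vertex nz_e' nzY quarticY ow).
- move=> i; split; first exact: exc_smooth.
    exact: (exc_curve_on char2 nz_e' dvd_quartic).
  case: unlift => [j|].
    exact: (intersection_arm char2 nz_e' dvd_quartic nzY quarticY j).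
  exact: (intersection_central char2 nz_e' dvd_quartic nzY quarticY).
- move=> i j; rewrite /D4_edge.
  case: (unliftP ord0 i) => [a|] ->; case: (unliftP ord0 j) => [b|] -> ij.
  + rewrite ij ![lift _ _ == ord0]eq_sym !(negbTE (neq_lift _ _)) /=.
    have ab : a != b by apply: contra_neq ij => ->.
    exact: (intersection_arms char2 nz_e' dvd_quartic ab).
  + rewrite ij eqxx orbT /=; exact: (intersection_arm_central char2 nz_e' dvd_quartic nzY quarticY a).
  + rewrite ij eqxx /=; exact: (intersection_central_arm char2 nz_e' dvd_quartic nzY quarticY b).
  + by rewrite eqxx in ij.
Qed.

(** * Singular points and tropes *)

Lemma mderivXU (n : nat) (k : nzRingType) (i j : 'I_n) :
  ('X_j : {mpoly k[n]})^`M(i) = (j == i)%:R.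
Proof.
rewrite mderivX mnm1E; case: eqP => [->|_]; last by rewrite scale0r.
by rewrite -{1}[U_(i)%MM]add0m addmK scale1r mpolyX0.
Qed.

Lemma mderiv_sqr_pchar2 (n : nat) (k : comNzRingType) (p : {mpoly k[n]}) i :
  2 \in [pchar k] -> (p ^+ 2)^`M(i) = 0.
Proof.
move=> char2; rewrite expr2 mderivM [X in _ + X]mulrC -mulr2n -mulr_natl.
by rewrite -mpolyC_nat pcharf0 // mpolyC0 mul0r.
Qed.

Lemma vertex_proj_inj (k : fieldType) n (i j : 'I_n) :
  proj_eq (fun l => (i == l)%:R : k) (fun l => (j == l)%:R) -> i = j.
Proof.
move=> [c _ /(_ i)]; rewrite eqxx; case: eqP => // _ /eqP.
by rewrite mulr0 oner_eq0.
Qed.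

Lemma proj_vertexP (k : fieldType) n (p : 'I_n -> k) : nonzero_vec p ->
  (exists i, proj_eq p (fun l => (i == l)%:R)) <-> (forall i j, i != j -> p i * p j = 0).
Proof.
move=> [l nzl]; split=> [[i [c _ pE]] a b ab|cross].
  rewrite !pE; have [ia|_] := eqVneq i a; last by rewrite mulr0 mul0r.
  by rewrite ia (negbTE ab) !mulr0.
exists l, (p l) => // i; case: eqP => [->|/eqP li]; first by rewrite mulr1.
by have /eqP := cross l i li; rewrite mulf_eq0 (negbTE nzl) mulr0 => /eqP.
Qed.

(** If a b were nonzero, x and y would vanish, and only c a b would remain of the relation. *)
Lemma cross_term0 (k : fieldType) (c a b x y s t : k) : c != 0 ->
  a * b * x = 0 -> a * b * y = 0 -> c * (a * b) + x * s + y * t = 0 -> a * b = 0.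
Proof.
move=> nzc abx aby rel; have [//|nzab] := eqVneq (a * b) 0.
move/eqP: abx; rewrite mulf_eq0 (negbTE nzab) => /eqP x0.
move/eqP: aby; rewrite mulf_eq0 (negbTE nzab) => /eqP y0.
by apply: (mulfI nzc); rewrite mulr0 -rel x0 y0 !mul0r !addr0.
Qed.

Section Quartic.
Variables (k : closedFieldType) (al m : 'I_3 -> k) (e : k) (i0 : 'I_4).
Hypotheses (char2 : 2 \in [pchar k]) (nz_al : forall j, al j != 0).
Hypotheses (nz_m : forall j, m j != 0) (nz_e : e != 0).
Local Notation f := (d4_quartic al m e i0).
Local Notation y p := (fun j => p (lift i0 j)).

Lemma meval_d4_quartic p : f.@[p] = quartic al m e idfun (p i0) (y p).
Proof. exact: mmap_d4_quartic. Qed.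

Lemma mderiv_d4_quartic i p : (f^`M(i)).@[p] =
  - (e * ((i == i0)%:R * (p (lift i0 o0) * p (lift i0 o1) * p (lift i0 o2))
   + p i0 * ((i == lift i0 o0)%:R * (p (lift i0 o1) * p (lift i0 o2))
     + (i == lift i0 o1)%:R * (p (lift i0 o0) * p (lift i0 o2))
     + (i == lift i0 o2)%:R * (p (lift i0 o0) * p (lift i0 o1))))).
Proof.
rewrite /d4_quartic /quartic mderivB mderiv_sqr_pchar2 // sub0r mderiv_mulC.
rewrite !mderivM !mderivXU ![_ == i]eq_sym mevalN mevalM mevalC !(mevalD, mevalM).
rewrite !mevalXU !rmorph_nat; congr (- (_ * _)).
by ring.
Qed.

Lemma singular_d4_quartic p : singular_point f p <->
  nonzero_vec p /\ exists i, proj_eq p (@vertex k i).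
Proof.
split=> [[nzp f0 df]|[nzp /(proj_vertexP nzp) cross]].
  split=> //; apply/(proj_vertexP nzp).
  have eq0 (a : k) : - (e * a) = 0 -> a = 0.
    by move/eqP; rewrite oppr_eq0 mulf_eq0 (negbTE nz_e) => /eqP.
  have li j : (lift i0 j == i0) = false by rewrite eq_sym (negbTE (neq_lift _ _)).
  have ll j j' : (lift i0 j == lift i0 j') = (j == j') by rewrite (inj_eq lift_inj).
  have d0 := df i0; have d1 := df (lift i0 o0); have d2 := df (lift i0 o1).
  have d3 := df (lift i0 o2).
  rewrite !mderiv_d4_quartic ?eqxx ?li ?ll ?(negbTE (neq_lift _ _)) /= in d0 d1 d2 d3.
  move: d0 d1 d2 d3 f0; rewrite meval_d4_quartic /quartic /quad_W /quad_M /=.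
  move=> /eq0 d0 /eq0 d1 /eq0 d2 /eq0 d3.
  rewrite !(mul0r, mul1r, add0r, addr0, mulr0) in d0 d1 d2 d3 *.
  set x := p i0 in d1 d2 d3 *; set a := p (lift i0 o0) in d0 d2 d3 *.
  set b := p (lift i0 o1) in d0 d1 d3 *; set c := p (lift i0 o2) in d0 d1 d2 *.
  rewrite d0 !mulr0 subr0 => /eqP; rewrite expf_eq0 /= => /eqP W0.
  (* For each of the six pairs of coordinates, W is split into its term in u v and the terms that
     contain one of the other two coordinates w, z; the triple products already vanish. *)
  have pair u v w z q s t : q != 0 -> u * v * w = 0 -> u * v * z = 0 ->
      q * (u * v) + w * s + z * t = x * (al o0 * a + al o1 * b + al o2 * c)
       + (m o0 * (b * c) + m o1 * (a * c) + m o2 * (a * b)) -> u * v = 0.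
    by move=> nzq uvw uvz rel; exact: (cross_term0 nzq uvw uvz (etrans rel W0)).
  have xy j : x * y p j = 0.
    apply: (ord3_ind (P := fun j => x * y p j = 0)).
    - apply: (@pair x a b c (al o0) (x * al o1 + m o0 * c + m o2 * a) (x * al o2 + m o1 * a));
        [exact: nz_al | by rewrite -d3; ring | by rewrite -d2; ring | ring].
    - apply: (@pair x b a c (al o1) (x * al o0 + m o1 * c + m o2 * b) (x * al o2 + m o0 * b));
        [exact: nz_al | by rewrite -d3; ring | by rewrite -d1; ring | ring].
    - apply: (@pair x c a b (al o2) (x * al o0 + m o1 * c + m o2 * b) (x * al o1 + m o0 * c));
        [exact: nz_al | by rewrite -d2; ring | by rewrite -d1; ring | ring].
  have bc : b * c = 0.
    apply: (@pair b c x a (m o0) (al o0 * a + al o1 * b + al o2 * c) (m o1 * c + m o2 * b));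
      [exact: nz_m | by rewrite -d1; ring | by rewrite -d0; ring | ring].
  have ac : a * c = 0.
    apply: (@pair a c x b (m o1) (al o0 * a + al o1 * b + al o2 * c) (m o0 * c + m o2 * a));
      [exact: nz_m | by rewrite -d2; ring | by rewrite -d0; ring | ring].
  have ab : a * b = 0.
    apply: (@pair a b x c (m o2) (al o0 * a + al o1 * b + al o2 * c) (m o0 * b + m o1 * a));
      [exact: nz_m | by rewrite -d3; ring | by rewrite -d0; ring | ring].
  move=> i j; case: (unliftP i0 i) => [i'|] ->; case: (unliftP i0 j) => [j'|] ->.
  - rewrite ll; elim/ord3_ind: i'; elim/ord3_ind: j' => // _; rewrite -/a -/b -/c //;
      by rewrite mulrC.
  - by rewrite mulrC.
  - by [].
  - by rewrite eqxx.
have xy j : p i0 * y p j = 0 by apply: cross; apply: neq_lift.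
have yy j j' : j != j' -> y p j * y p j' = 0.
  by move=> jj'; apply: cross; rewrite (inj_eq lift_inj).
split=> // [|i].
  rewrite meval_d4_quartic /quartic /quad_W /quad_M /=.
  rewrite (yy o1 o2) // (yy o0 o2) // (yy o0 o1) // mul0r !mulr0 !addr0 subr0.
  by rewrite !mulrDr ![p i0 * (_ * _)]mulrCA !xy !mulr0 !addr0 expr0n.
rewrite mderiv_d4_quartic (yy o1 o2) // (yy o0 o2) // (yy o0 o1) //.
by rewrite !(mul0r, mulr0, addr0) oppr0.
Qed.

(* If a product of linear forms vanishes at three points, one factor vanishes at
   two of them, and so does the product on the line joining these two. *)
Lemma quad_M_not_product (a b : 'I_3 -> k) : (forall j, a j * b j = 0) ->
  (forall i j l, uniq [:: i; j; l] -> (a i + a j) * (b i + b j) = m l) -> False.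
Proof.
move=> ab0 abm.
have a2 i j l : uniq [:: i; j; l] -> a i = 0 -> a j = 0 -> False.
  move=> ijl ai aj; have /eqP := abm _ _ _ ijl.
  by rewrite ai aj addr0 mul0r eq_sym (negbTE (nz_m l)).
have b2 i j l : uniq [:: i; j; l] -> b i = 0 -> b j = 0 -> False.
  move=> ijl bi bj; have /eqP := abm _ _ _ ijl.
  by rewrite bi bj addr0 mulr0 eq_sym (negbTE (nz_m l)).
have u012 : uniq [:: o0; o1; o2] by []; have u021 : uniq [:: o0; o2; o1] by [].
have u120 : uniq [:: o1; o2; o0] by [].
have zero j : a j = 0 \/ b j = 0.
  by have /eqP := ab0 j; rewrite mulf_eq0 => /orP[/eqP|/eqP]; [left|right].
case: (zero o0) (zero o1) (zero o2) => [h0|h0] [h1|h1] [h2|h2];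
  first [exact: a2 u012 h0 h1 | exact: a2 u021 h0 h2 | exact: a2 u120 h1 h2
        | exact: b2 u012 h0 h1 | exact: b2 u021 h0 h2 | exact: b2 u120 h1 h2].
Qed.

Lemma meval_linear n (l : {mpoly k[n]}) (v w : 'I_n -> k) : l \is 1.-homog ->
  l.@[fun i => v i + w i] = l.@[v] + l.@[w].
Proof.
move=> /dhomogP hl; rewrite (mpolyE l) !raddf_sum /= -big_split /=.
apply: eq_big_seq => x /hl /eqP/mdeg1P[i /eqP ->].
by rewrite !mevalZ !mevalXU mulrDr.
Qed.

Definition base_conic : {mpoly k[4]} :=
  quad_M m (@mpolyC 4 k) (fun j => 'X_(lift i0 j)).

Lemma meval_base_conic p : base_conic.@[p] = quad_M m idfun (y p).
Proof.
rewrite /base_conic /quad_M !mevalD !mevalM !mevalC !mevalXU.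
by [].
Qed.

Lemma trope_d4_quartic (C : ('I_4 -> k) -> Prop) :
    (forall p, C p <-> [/\ nonzero_vec p, p i0 = 0 & base_conic.@[p] = 0]) ->
  trope f C.
Proof.
move=> CE; exists 'X_i0, base_conic; split; [exact: dhomogXU | | |].
- by apply: (@meval_neq0 _ _ _ (fun=> 1)); rewrite mevalXU oner_neq0.
- rewrite /base_conic /quad_M; have h j j' (c : k) :
      (c%:MP * ('X_j * 'X_j') : {mpoly k[4]}) \is 2.-homog.
    by rewrite mul_mpolyC rpredZ // (dhomogM (dhomogXU _ _) (dhomogXU _ _)).
  by rewrite !rpredD ?h.
split=> [l1 l2 H hl1 hl2 qE|p nzp|].
(* The coordinate points of the plane: M vanishes at each of them, and takes the value m_l at the
   sum of the two others than l. *)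
- pose pt (i : 'I_3) : 'I_4 -> k := hom_pt i0 0 (fun j => (j == i)%:R).
  have qpt v : v i0 = 0 -> quad_M m idfun (y v) = l1.@[v] * l2.@[v].
    by move=> v0; rewrite -meval_base_conic qE mevalD !mevalM mevalXU v0 mul0r addr0.
  apply: (@quad_M_not_product (fun i => l1.@[pt i]) (fun i => l2.@[pt i])) => [i|i j l ijl].
    rewrite -qpt /pt ?hom_pt0 // /quad_M !hom_pt_lift /=.
    by elim/ord3_ind: i; rewrite /= !(mulr0, mul0r, addr0).
  rewrite -!meval_linear // -qpt /pt ?hom_pt0 ?addr0 // /quad_M !hom_pt_lift /=.
  by elim/ord3_ind: i ijl; elim/ord3_ind: j; elim/ord3_ind: l => //= _;
    rewrite /= !(mulr0, mul0r, addr0, add0r, mulr1).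
- by rewrite CE mevalXU; split=> [[_]|[]].
(* From (x L + M)^2 - e x y_1 y_2 y_3 = M^2 + x (x L^2 + 2 L M - e y_1 y_2 y_3). *)
exists 1, ('X_i0 * ((al o0)%:MP * 'X_(lift i0 o0) + (al o1)%:MP * 'X_(lift i0 o1)
   + (al o2)%:MP * 'X_(lift i0 o2)) ^+ 2
  + ((al o0)%:MP * 'X_(lift i0 o0) + (al o1)%:MP * 'X_(lift i0 o1)
   + (al o2)%:MP * 'X_(lift i0 o2)) * base_conic *+ 2
  - e%:MP * ('X_(lift i0 o0) * 'X_(lift i0 o1) * 'X_(lift i0 o2))).
split; first exact: oner_neq0.
by rewrite scale1r /d4_quartic /quartic /quad_W -/base_conic; ring.
Qed.

End Quartic.

(** * The focal quartic and its four normal forms *)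

Lemma quartic_pchar2 (R : comNzRingType) (a0 a1 a2 b0 b1 b2 e x y z t : R) :
    2 \in [pchar R] ->
  (x * (a0 * y + a1 * z + a2 * t) + (b0 * (z * t) + b1 * (y * t) + b2 * (y * z))) ^+ 2
    - e * (x * (y * z * t)) =
  a0 ^+ 2 * (x ^+ 2 * y ^+ 2) + b0 ^+ 2 * (z ^+ 2 * t ^+ 2)
  + (a1 ^+ 2 * (x ^+ 2 * z ^+ 2) + b1 ^+ 2 * (y ^+ 2 * t ^+ 2))
  + (a2 ^+ 2 * (x ^+ 2 * t ^+ 2) + b2 ^+ 2 * (y ^+ 2 * z ^+ 2))
  + e * (x * y * z * t).
Proof.
move=> char2; have sqD (u v : R) : (u + v) ^+ 2 = u ^+ 2 + v ^+ 2.
  by rewrite sqrrD mulr2n addrr_pchar2 // addr0.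
rewrite oppr_pchar2 // !mulrDr !sqD; ring.
Qed.

Section FocalSurface.
Variables (k : closedFieldType) (a1 a2 a3 r1 r2 r3 s1 s2 s3 : k).
Hypothesis char2 : 2 \in [pchar k].

(* The square of the quadric sum_(i < j) w_ij X_i X_j, with
   w_01 = (a1+a2) r3, w_23 = (a1+a2) s3, and so on, is the focal quartic up to
   the term in xyzt.  [lin_coef i] lists the w_ij with j != i, and
   [conic_coef i] the coefficients of the complementary pairs. *)
Definition lin_coef (i : 'I_4) : 'I_3 -> k :=
  tnth (tnth [tuple
    [tuple (a1 + a2) * r3; (a1 + a3) * r2; (a2 + a3) * r1];
    [tuple (a1 + a2) * r3; (a2 + a3) * s1; (a1 + a3) * s2];
    [tuple (a1 + a3) * r2; (a2 + a3) * s1; (a1 + a2) * s3];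
    [tuple (a2 + a3) * r1; (a1 + a3) * s2; (a1 + a2) * s3]] i).

Definition conic_coef (i : 'I_4) : 'I_3 -> k :=
  tnth (tnth [tuple
    [tuple (a1 + a2) * s3; (a1 + a3) * s2; (a2 + a3) * s1];
    [tuple (a1 + a2) * s3; (a2 + a3) * r1; (a1 + a3) * r2];
    [tuple (a1 + a3) * s2; (a2 + a3) * r1; (a1 + a2) * r3];
    [tuple (a2 + a3) * s1; (a1 + a3) * r2; (a1 + a2) * r3]] i).

Local Notation e := ((a1 + a2) * (a2 + a3) * (a3 + a1)).

Lemma ord4_ind (P : 'I_4 -> Prop) :
  P (@Ordinal 4 0 isT) -> P (@Ordinal 4 1 isT) -> P (@Ordinal 4 2 isT) ->
  P (@Ordinal 4 3 isT) -> forall i, P i.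
Proof.
move=> P0 P1 P2 P3 [[|[|[|[|//]]]] Hi]; [move: P0|move: P1|move: P2|move: P3];
  by congr P; apply: val_inj.
Qed.

Lemma lin_coef_neq0 i j : a1 + a2 != 0 -> a1 + a3 != 0 -> a2 + a3 != 0 ->
  r1 * r2 * r3 != 0 -> s1 * s2 * s3 != 0 -> lin_coef i j != 0.
Proof.
rewrite !mulf_eq0 !negb_or => nzA nzB nzC /andP[/andP[n1 n2] n3] /andP[/andP[n4 n5] n6].
by elim/ord4_ind: i; elim/ord3_ind: j; exact: mulf_neq0.
Qed.

Lemma conic_coef_neq0 i j : a1 + a2 != 0 -> a1 + a3 != 0 -> a2 + a3 != 0 ->
  r1 * r2 * r3 != 0 -> s1 * s2 * s3 != 0 -> conic_coef i j != 0.
Proof.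
rewrite !mulf_eq0 !negb_or => nzA nzB nzC /andP[/andP[n1 n2] n3] /andP[/andP[n4 n5] n6].
by elim/ord4_ind: i; elim/ord3_ind: j; exact: mulf_neq0.
Qed.

Local Notation i0 := (@Ordinal 4 0 isT).
Local Notation i1 := (@Ordinal 4 1 isT).
Local Notation i2 := (@Ordinal 4 2 isT).
Local Notation i3 := (@Ordinal 4 3 isT).

Lemma lift_coords :
  (lift i0 o0 = i1) * (lift i0 o1 = i2) * (lift i0 o2 = i3) *
  (lift i1 o0 = i0) * (lift i1 o1 = i2) * (lift i1 o2 = i3) *
  (lift i2 o0 = i0) * (lift i2 o1 = i1) * (lift i2 o2 = i3) *
  (lift i3 o0 = i0) * (lift i3 o1 = i1) * (lift i3 o2 = i2).
Proof. by do !split; apply: val_inj. Qed.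

Lemma trope_quadricE i :
  trope_quadric a1 a2 a3 r1 r2 r3 s1 s2 s3 i = base_conic (conic_coef i) i.
Proof.
elim/ord4_ind: i; rewrite /base_conic /quad_M !lift_coords !mul_mpolyC //.
- by rewrite [RHS]addrAC.
- by rewrite [RHS]addrC addrA.
- by rewrite [RHS]addrC [X in _ = _ + X]addrC addrA.
Qed.

(** In characteristic 2 the square of the quadric is the sum of the squares of its six terms, which
    can be grouped around any one of the coordinates. *)
Lemma focal_quarticE i : focal_quartic a1 a2 a3 (r1 ^+ 2) (r2 ^+ 2) (r3 ^+ 2)
    (s1 ^+ 2) (s2 ^+ 2) (s3 ^+ 2) =
  d4_quartic (lin_coef i) (conic_coef i) e i.
Proof.
have char2R : 2 \in [pchar {mpoly k[4]}] by rewrite (pchar_lalg {mpoly k[4]}).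
have gen (R : comNzRingType) (A B C p1 p2 p3 q1 q2 q3 D x y z t : R) :
    2 \in [pchar R] ->
  let F := A ^+ 2 * (p3 ^+ 2 * (x ^+ 2 * y ^+ 2) + q3 ^+ 2 * (z ^+ 2 * t ^+ 2))
    + B ^+ 2 * (p2 ^+ 2 * (x ^+ 2 * z ^+ 2) + q2 ^+ 2 * (y ^+ 2 * t ^+ 2))
    + C ^+ 2 * (p1 ^+ 2 * (x ^+ 2 * t ^+ 2) + q1 ^+ 2 * (y ^+ 2 * z ^+ 2))
    + D * (x * y * z * t) in
  [/\ F = (x * (A * p3 * y + B * p2 * z + C * p1 * t)
        + (A * q3 * (z * t) + B * q2 * (y * t) + C * q1 * (y * z))) ^+ 2
        - D * (x * (y * z * t)),
      F = (y * (A * p3 * x + C * q1 * z + B * q2 * t)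
        + (A * q3 * (z * t) + C * p1 * (x * t) + B * p2 * (x * z))) ^+ 2
        - D * (y * (x * z * t)),
      F = (z * (B * p2 * x + C * q1 * y + A * q3 * t)
        + (B * q2 * (y * t) + C * p1 * (x * t) + A * p3 * (x * y))) ^+ 2
        - D * (z * (x * y * t))
    & F = (t * (C * p1 * x + B * q2 * y + A * q3 * z)
        + (C * q1 * (y * z) + B * p2 * (x * z) + A * p3 * (x * y))) ^+ 2
        - D * (t * (x * y * z))].
  by move=> char2' F; rewrite !quartic_pchar2 //; split; rewrite /F; ring.
rewrite /focal_quartic -!mul_mpolyC !(rmorphXn (@mpolyC 4 k)) /=.
have [E0 E1 E2 E3] := @gen _ (a1 + a2)%:MP (a1 + a3)%:MP (a2 + a3)%:MP
  r1%:MP r2%:MP r3%:MP s1%:MP s2%:MP s3%:MP e%:MP (cx k) (cy k) (cz k) (ct k) char2R.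
elim/ord4_ind: i; [rewrite E0|rewrite E1|rewrite E2|rewrite E3];
  by rewrite /d4_quartic /quartic /quad_W /quad_M !lift_coords -!(rmorphM (@mpolyC 4 k)).
Qed.

End FocalSurface.

Theorem theorem4p1 (k : closedFieldType) (char2 : 2 \in [pchar k])
    (a1 a2 a3 c1 c2 c3 d1 d2 d3 : k)
    (a12 : a1 != a2) (a13 : a1 != a3) (a23 : a2 != a3)
    (cd_neq0 : (c1 * d1) * (c2 * d2) * (c3 * d3) != 0)
    (r1 r2 r3 s1 s2 s3 : k)
    (r1E : r1 ^+ 2 = c1) (r2E : r2 ^+ 2 = c2) (r3E : r3 ^+ 2 = c3)
    (s1E : s1 ^+ 2 = d1) (s2E : s2 ^+ 2 = d2) (s3E : s3 ^+ 2 = d3) :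
  let f := focal_quartic a1 a2 a3 c1 c2 c3 d1 d2 d3 in
  let P := @vertex k in
  let Theta := trope_curve a1 a2 a3 r1 r2 r3 s1 s2 s3 in
  (forall p : 'I_4 -> k, singular_point f p <->
     nonzero_vec p /\ exists i, proj_eq p (P i)) /\
  (forall i j, proj_eq (P i) (P j) -> i = j) /\
  (forall i, rdp_D4 f (P i)) /\
  (forall i, trope f (Theta i)) /\
  (forall i p, Theta i p -> f.@[p] = 0) /\
  (forall i j, Theta i (P j) <-> j != i).
Proof.
move=> f P Theta.
have nzD (a b : k) : a != b -> a + b != 0.
  by rewrite -[b in a + b](oppr_pchar2 char2) subr_eq0.
have [[nzA nzB] nzC] := (nzD _ _ a12, nzD _ _ a13, nzD _ _ a23).
have [nzr nzs] : r1 * r2 * r3 != 0 /\ s1 * s2 * s3 != 0.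
  move: cd_neq0; rewrite -r1E -r2E -r3E -s1E -s2E -s3E !mulf_eq0 !orbb !negb_or.
  by case/andP=> /andP[/andP[-> ->] /andP[-> ->]] /andP[-> ->].
pose al := lin_coef a1 a2 a3 r1 r2 r3 s1 s2 s3.
pose m := conic_coef a1 a2 a3 r1 r2 r3 s1 s2 s3.
pose e := (a1 + a2) * (a2 + a3) * (a3 + a1).
(* One normal form per vertex: each singular point and each trope is studied in the form that
   singles out its own coordinate. *)
have fE i : f = d4_quartic (al i) (m i) e i.
  by rewrite /f -r1E -r2E -r3E -s1E -s2E -s3E (focal_quarticE _ _ _ _ _ _ _ _ _ char2 i).
have nz_al i j : al i j != 0 by apply: lin_coef_neq0.
have nz_m i j : m i j != 0 by apply: conic_coef_neq0.
have nz_e : e != 0 by rewrite !mulf_neq0 // addrC.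
have ThetaE i p : Theta i p <->
    [/\ nonzero_vec p, p i = 0 & (base_conic (m i) i).@[p] = 0].
  by rewrite /Theta /trope_curve trope_quadricE.
split; [|split; [exact: vertex_proj_inj|split; [|split; [|split]]]].
- by move=> p; rewrite (fE ord0); apply: singular_d4_quartic.
- by move=> i; rewrite (fE i); apply: rdp_D4_quartic.
- by move=> i; rewrite (fE i); apply: trope_d4_quartic (ThetaE i).
- move=> i p /ThetaE[_ pi0]; rewrite (fE i) meval_d4_quartic meval_base_conic.
  by rewrite /quartic /quad_W pi0 => ->; rewrite !mul0r mulr0 addr0 expr0n subr0.
move=> i j; rewrite ThetaE; split=> [[_ + _]|ji].
  by rewrite /P /vertex; case: eqP => // _ /eqP; rewrite oner_eq0.
split; first by exists j; rewrite /P /vertex eqxx oner_neq0.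
  by rewrite /P /vertex (negbTE ji).
rewrite meval_base_conic /quad_M /P /vertex.
(* A vertex has a single nonzero coordinate, so every product in the conic vanishes there. *)
have yy l l' : l != l' -> (j == lift i l)%:R * (j == lift i l')%:R = 0 :> k.
  move=> ll'; case: eqP => [->|_]; last by rewrite mul0r.
  by rewrite (inj_eq lift_inj) (negbTE ll') mulr0.
by rewrite !yy // !mulr0 !addr0.
Qed.
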